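(* Suppose the self-similar measure $\mu$ satisfies the standard technical assumptions, and let $\Omega'\subseteq\Omega$ be a loop class of positive type. Then the set of local dimensions of $\mu$ at points in $\Omega'$, $\{\dim\mu(x): x\text{ in }\Omega',\ \dim\mu(x)\text{ exists}\}$, is a closed interval (possibly a single point). Moreover, this interval is the closure of the set of local dimensions of $\mu$ at the periodic points in $\Omega'$.
   Context: Measure. Let $m\ge 1$, $0<\varrho<1$, $d_0<\dots<d_m$ real, $S_j(x)=\varrho x+d_j$, $\mathcal A=\{0,\dots,m\}$. For $\sigma=(j_1,\dots,j_n)\in\mathcal A^n$ put $S_\sigma=S_{j_1}\circ\cdots\circ S_{j_n}$. Given $p_j>0$ with $\sum_j p_j=1$, $\mu$ is the unique Borel probability measure with $\mu=\sum_{j=0}^m p_j\,\mu\circ S_j^{-1}$. It is of finite type if there is a finite set $F\subset[0,\infty)$ such that for all $n\ge1$ and $\sigma,\sigma'\in\mathcal A^n$ either $\varrho^{-n}|S_\sigma(0)-S_{\sigma'}(0)|>c$ or $\varrho^{-n}|S_\sigma(0)-S_{\sigma'}(0)|\in F$, where $c=(1-\varrho)^{-1}(d_m-d_0)$. Standard technical assumptions: $\mu$ is such a measure and is of finite type; $p_0=p_m=\min_j p_j$; and $\operatorname{supp}\mu=[0,1]$ (equivalently $d_0=0$, $d_m=1-\varrho$, $d_{i+1}-d_i\le\varrho$ for all $i$). Local dimension. $\dim\mu(x)=\lim_{r\to0^+}\frac{\log\mu([x-r,x+r])}{\log r}$ when the limit exists. Net intervals and characteristic vectors. For $n\ge1$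 let $h_1<\dots<h_{s_n}$ be the distinct elements of $\{S_\sigma(0),S_\sigma(1):\sigma\in\mathcal A^n\}$; the net intervals of level $n$ are $\mathcal F_n=\{[h_j,h_{j+1}]:1\le j<s_n\}$, and $\mathcal F_0=\{[0,1]\}$. Each $\Delta\in\mathcal F_n$ ($n\ge1$) lies in a unique $\widehat\Delta\in\mathcal F_{n-1}$, its parent ($\Delta$ is a child of $\widehat\Delta$). For $\Delta=[a,b]\in\mathcal F_n$ put $\ell_n(\Delta)=\varrho^{-n}(b-a)$, and let $V_n(\Delta)=(a_1,\dots,a_k)$ be the increasing list of the distinct values $\varrho^{-n}(a-S_\sigma(0))$ over $\sigma\in\mathcal A^n$ with $\Delta\subseteq S_\sigma[0,1]$. Let $r_n(\Delta)$ be the position of $\Delta$, from left to right, among the children of $\widehat\Delta$ with the same $\ell_n$ and $V_n$. The characteristic vector is $\mathcal C_n(\Delta)=(\ell_n(\Delta),V_n(\Delta),r_n(\Delta))$, with $\mathcal C_0([0,1])=(1,(0),1)$. $\Omega$ is the (finite) set of all characteristic vectors. $\beta\in\Omega$ is a child of $\alpha\in\Omega$ (its parent) if $\alpha=\mathcal C_{n-1}(\widehat\Delta)$, $\beta=\mathcal C_n(\Delta)$ for some parent/child pair. An admissible path is a tuple $(\gamma_1,\dots,\gamma_n)$ in $\Omega$ with each $\gamma_j$ the parent of $\gamma_{j+1}$; its length is $n$. A symbolic representation of $x\in[0,1]$ is $[x]=(\mathcal C_0(\Delta_0),\mathcal C_1(\Delta_1),\dots)$, where $x\in\Delta_n\in\mathcal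 F_n$ and $\Delta_n$ is the parent of $\Delta_{n+1}$ for all $n$ (unique unless $x$ is an endpoint of a net interval, in which case there may be two). Transition matrices. For $\Delta=[a,b]\in\mathcal F_n$ with parent $\widehat\Delta=[c,d]$, $V_n(\Delta)=(a_1,\dots,a_K)$, $V_{n-1}(\widehat\Delta)=(c_1,\dots,c_J)$, the primitive transition matrix $T(\mathcal C_{n-1}(\widehat\Delta),\mathcal C_n(\Delta))$ is the $J\times K$ matrix with $(j,k)$ entry $p_0^{-1}p_\ell$ if $\ell\in\mathcal A$ satisfies $c-\varrho^{n-1}c_j+\varrho^{n-1}d_\ell=a-\varrho^na_k$, and $0$ if there is no such $\ell$ (it depends only on the two characteristic vectors). For an admissible path, $T(\gamma_1,\dots,\gamma_n)=T(\gamma_1,\gamma_2)\cdots T(\gamma_{n-1},\gamma_n)$. A matrix is positive if all entries are strictly positive. Loop classes. A non-empty $\Omega'\subseteq\Omega$ is a loop class if for all $\alpha,\beta\in\Omega'$ there is an admissible path $(\gamma_1,\dots,\gamma_n)$, $n\ge2$, with all $\gamma_j\in\Omega'$, $\gamma_1=\alpha$, $\gamma_n=\beta$. It is of positive type if some admissible path $\eta$ in $\Omega'$ (all its members in $\Omega'$) has $T(\eta)$ positive. A point $x$ is in $\Omega'$ if it has a symbolic representation $(\gamma_0,\gamma_1,\dots)$ with $\gamma_j\in\Omega'$ for all large $j$. Periodic points. $x$ is periodic with period $\theta$ if it has a symbolic representation $(\gamma_0,\dots,\gamma_s,\theta^-,\theta^-,\dots)$, where $\theta$ is an admissible cycle (a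 path of length at least 2 with equal first and last letters) and $\theta^-$ is $\theta$ with its last letter deleted. It is a periodic point in $\Omega'$ if it has such a period $\theta$ lying in $\Omega'$. The local dimension exists at every periodic point. *)

(* Defs.v *)
From HB Require Import structures.
From mathcomp Require Import all_boot all_order all_algebra.
From mathcomp Require Import all_classical all_reals all_analysis.

Set Implicit Arguments.
Unset Strict Implicit.
Unset Printing Implicit Defensive.

Import Order.TTheory GRing.Theory Num.Theory.
Import numFieldNormedType.Exports.

Local Open Scope classical_set_scope.
Local Open Scope ring_scope.

Section IFS.
Context {R : realType} {m : nat}.
Variables (rho : R) (d : 'I_m.+1 -> R).

Definition simil (j : 'I_m.+1) (x : R) : R := rho * x + d j.

(* S_(j_1, ..., j_n) = S_(j_1) \o ... \o S_(j_n) *)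
Definition simil_word (sigma : seq 'I_m.+1) (x : R) : R :=
  foldr simil x sigma.

Definition finite_type : Prop :=
  let c := (1 - rho)^-1 * (d ord_max - d ord0) in
  exists F : set R, [/\ finite_set F, F `<=` [set t | 0 <= t] &
    forall (n : nat) (sigma sigma' : n.-tuple 'I_m.+1), (1 <= n)%N ->
      let t := rho ^- n * `|simil_word sigma 0 - simil_word sigma' 0| in
      c < t \/ F t].

(* An interval [a, b] is encoded by the pair (a, b) of its endpoints. *)

Definition pair_sub (D E : R * R) : bool := (E.1 <= D.1) && (D.2 <= E.2).

Definition net_points (n : nat) : seq R :=
  sort <=%R (undup ([seq simil_word sigma 0 | sigma : n.-tuple 'I_m.+1] ++
                    [seq simil_word sigma 1 | sigma : n.-tuple 'I_m.+1])).

(* Listed from left to right; for n = 0 the only word is the empty one, so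
   that the only net interval is [0, 1]. *)
Definition net_intervals (n : nat) : seq (R * R) :=
  zip (net_points n) (behead (net_points n)).

Definition is_parent (n : nat) (P D : R * R) : Prop :=
  [/\ P \in net_intervals n, D \in net_intervals n.+1 & pair_sub D P].

(* Only one net interval of level n contains a given one of level n.+1. *)
Definition parent (n : nat) (D : R * R) : R * R :=
  head (0, 1) [seq P <- net_intervals n | pair_sub D P].

Definition norm_length (n : nat) (D : R * R) : R := rho ^- n * (D.2 - D.1).

Definition neighbours (n : nat) (D : R * R) : seq R :=
  sort <=%R (undup
    [seq rho ^- n * (D.1 - simil_word sigma 0)
       | sigma : n.-tuple 'I_m.+1 <- enum {: n.-tuple 'I_m.+1}
       & pair_sub D (simil_word sigma 0, simil_word sigma 1)]).

(* Positions are counted from 1. *)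
Definition sibling_rank (n : nat) (D : R * R) : nat :=
  if n is k.+1 then
    (index D [seq E <- net_intervals k.+1 |
                [&& pair_sub E (parent k D),
                    norm_length k.+1 E == norm_length k.+1 D
                  & neighbours k.+1 E == neighbours k.+1 D]]).+1
  else 1%N.

Definition charvec : Type := (R * seq R * nat)%type.

Definition charvec_nbs (alpha : charvec) : seq R := alpha.1.2.

Definition char_vector (n : nat) (D : R * R) : charvec :=
  (norm_length n D, neighbours n D, sibling_rank n D).

Definition Omega : set charvec :=
  [set alpha | exists n D, D \in net_intervals n /\ char_vector n D = alpha].

Definition represents (alpha beta : charvec) (n : nat) (P D : R * R) : Prop :=
  [/\ is_parent n P D, char_vector n P = alpha & char_vector n.+1 D = beta].

Definition child (alpha beta : charvec) : Prop :=
  exists n P D, represents alpha beta n P D.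

(* The tuple (alpha, s_1, ..., s_k), of length k + 1. *)
Definition admissible_path (alpha : charvec) (s : seq charvec) : Prop :=
  Omega alpha /\ path (fun beta gamma => `[< child beta gamma >]) alpha s.

Definition path_in (W : set charvec) (alpha : charvec) (s : seq charvec)
    : Prop :=
  admissible_path alpha s /\ (forall gamma, gamma \in alpha :: s -> W gamma).

Definition loop_class (W : set charvec) : Prop :=
  [/\ W !=set0, W `<=` Omega &
    forall alpha beta, W alpha -> W beta ->
      exists s, [/\ s != [::], path_in W alpha s & last alpha s = beta]].

Definition symbolic_rep (gamma : nat -> charvec) (x : R) : Prop :=
  exists Delta : nat -> R * R, forall n,
    [/\ (Delta n).1 <= x <= (Delta n).2,
        Delta n \in net_intervals n,
        is_parent n (Delta n) (Delta n.+1)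
      & gamma n = char_vector n (Delta n)].

Definition point_in (W : set charvec) (x : R) : Prop :=
  exists gamma, symbolic_rep gamma x /\
    exists N, forall j, (N <= j)%N -> W (gamma j).

Definition admissible_cycle (alpha : charvec) (s : seq charvec) : Prop :=
  [/\ s != [::], admissible_path alpha s & last alpha s = alpha].

(* The period is theta = (alpha, s_1, ..., s_k), and theta with its last letter
   deleted is [belast alpha s], which has k letters. *)
Definition periodic_with (alpha : charvec) (s : seq charvec) (x : R) : Prop :=
  admissible_cycle alpha s /\
  exists2 gamma, symbolic_rep gamma x &
    exists q, forall k,
      gamma (q.+1 + k)%N = nth alpha (belast alpha s) (k %% size s).

Definition periodic_in (W : set charvec) (x : R) : Prop :=
  exists alpha s, periodic_with alpha s x /\ path_in W alpha s.

Section Transition.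
Variable p : 'I_m.+1 -> R.

(* The equation linking j, k and l has the same solutions for all pairs of net
   intervals representing (alpha, beta), and determines l since d is
   injective. *)
Definition trans_index (alpha beta : charvec) (j k : nat) (l : 'I_m.+1)
    : Prop :=
  exists n P D, represents alpha beta n P D /\
    P.1 - rho ^+ n * (charvec_nbs alpha)`_j + rho ^+ n * d l =
    D.1 - rho ^+ n.+1 * (charvec_nbs beta)`_k.

Definition trans_mx (alpha beta : charvec)
    : 'M[R]_(size (charvec_nbs alpha), size (charvec_nbs beta)) :=
  \matrix_(j, k)
    if [pick l | `[< trans_index alpha beta j k l >]] is Some l
    then (p ord0)^-1 * p l else 0.

Fixpoint trans_path (alpha : charvec) (s : seq charvec)
    : 'M[R]_(size (charvec_nbs alpha), size (charvec_nbs (last alpha s))) :=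
  if s is beta :: s' then trans_mx alpha beta *m trans_path beta s'
  else 1%:M.

Definition positive_mx (r c : nat) (A : 'M[R]_(r, c)) : Prop :=
  forall i j, 0 < A i j.

Definition positive_type (W : set charvec) : Prop :=
  exists alpha s,
    [/\ s != [::], path_in W alpha s & positive_mx (trans_path alpha s)].

Definition self_similar (mu : probability (measurableTypeR R) R) : Prop :=
  forall A : set (measurableTypeR R), measurable A ->
    mu A = (\sum_(j < m.+1) (p j)%:E * mu (simil j @^-1` A))%E.

End Transition.

End IFS.

Section LocalDimension.
Context {R : realType}.
Variable mu : probability (measurableTypeR R) R.

Definition msupport : set R :=
  [set x | forall U : set R, open U -> U x -> (0 < mu U)%E].

Definition has_local_dim (x t : R) : Prop :=
  ln (fine (mu `[x - r, x + r]%classic)) / ln r @[r --> 0^'+] --> t.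

Definition local_dims (X : set R) : set R :=
  [set t | exists2 x, X x & has_local_dim x t].

End LocalDimension.

(* Main.v *)
Require Import Defs.
From mathcomp Require Import all_boot all_order all_algebra.
From mathcomp Require Import all_classical all_reals all_analysis.
From mathcomp Require Import measurable_realfun.
From mathcomp Require Import ring lra.
Import Order.TTheory GRing.Theory Num.Theory.
Import numFieldNormedType.Exports.
Set Implicit Arguments.
Unset Strict Implicit.
Unset Printing Implicit Defensive.
Local Open Scope classical_set_scope.
Local Open Scope ring_scope.

(* Let Delta_n be the net interval of level n given by a symbolic representation
   (gamma_0, gamma_1, ...) of x, and let w_n be the total weight of the words of
   length n whose image contains Delta_n. Then w_n = p_0 ^ n ||T(gamma_0, ..., gamma_n)||,
   with ||.|| the sum of the entries. A ball around x of radius comparable to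
   rho ^ n has mass at least a constant times w_n, and at most n times a constant
   times w_n: the words that only touch Delta_n at an endpoint b end with a run of
   outer letters, and moving the letter before this run to its neighbour yields a
   word covering Delta_n of comparable weight, because p_0 = p_m is minimal. Hence
   the local dimension at x is the limit of log w_n / (n log rho).

   In the loop class, call block a loop at alpha_0 that starts with the path eta
   for which T(eta) is positive. The nonzero entries of transition matrices are at
   least 1, so ||T(u eta v)|| >= ||T(u)|| ||T(v)||, and the exponent log w / log rho
   is additive up to a constant on concatenations of blocks. Let A be the set of
   limits of averages of the exponent over long blocks.
   - Closing up the initial segments of a representation puts dim mu(x) in A.
   - Repeating one long block gives a periodic point of almost its average.
   - Concatenating longer and longer blocks of average close to t gives a point
     of local dimension t.
   - Mixing two blocks shows that A is convex.
   So A is a closed bounded interval; it is the set of local dimensions at points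
   of the class, and the local dimensions at periodic points are dense in it. *)

(** The child relation and the matrices are defined through arbitrary representatives, at any level.
    Rigidity makes them usable: two net intervals with the same normalised length and the same
    neighbours have homothetic children, and the rank singles out one child among those that look
    alike. So a transition matrix can be computed on any representative, and every chain of
    characteristic vectors from the root represents a point: finding points becomes concatenating
    words. Finite type enters through the finiteness of the set of pairs (length, neighbours). It
    yields the uniform constants: the minimal gap between net points, the minimal mass of a rescaled
    net interval, the size of the matrices, the length of a path back to [alpha0]. The exponent
    changes by a bounded amount per letter, so prefixes, connecting paths and unfinished blocks of
    negligible length do not affect averages. Only the junctions of many blocks need positivity,
    hence a copy of [eta] at the start of each block. *)

Section ConsecutivePairs.
Context {disp : Order.disp_t} {T : orderType disp}.
Implicit Types (s : seq T) (a b x : T).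

Lemma mem_zip_behead s a b : sorted <%O s ->
  (a, b) \in zip s (behead s) <->
  [/\ a \in s, b \in s, (a < b)%O & forall c, c \in s -> (c <= a)%O \/ (b <= c)%O].
Proof.
elim: s => [|x [|y s] IH] /=; first by move=> _; split => // -[].
  move=> _; split=> // -[]; rewrite !inE => /eqP -> /eqP ->.
  by rewrite ltxx.
case/andP=> xy pth; have {}IH := IH pth.
have ys : forall c, c \in y :: s -> (y <= c)%O.
  move=> c; rewrite inE => /orP[/eqP->//|cs].
  by move: pth; rewrite (path_sortedE lt_trans) => /andP[/allP/(_ _ cs)/ltW].
rewrite inE; split.
  case/orP=> [/eqP[-> ->]|/IH[a_in b_in ab abN]].
    split=> //; rewrite ?inE ?eqxx ?orbT // => c; rewrite inE => /orP[/eqP->|/ys].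
      by left.
    by right.
  split=> // [||c]; [by rewrite inE a_in orbT|by rewrite inE b_in orbT|].
  rewrite inE => /orP[/eqP->|/abN//]; left.
  exact: le_trans (ltW xy) (ys _ a_in).
case; rewrite inE => /orP[/eqP-> | a_in] b_in ab abN.
  apply/orP; left; apply/eqP; congr pair; apply/eqP.
  move: b_in; rewrite inE => /orP[/eqP bx|b_in]; first by rewrite bx ltxx in ab.
  rewrite eq_le ys // andbT.
  have [|yx|//] := abN y; first by rewrite !inE eqxx orbT.
  by move: (lt_le_trans xy yx); rewrite ltxx.
apply/orP; right; apply/IH; split=> //.
  move: b_in; rewrite inE => /orP[/eqP bx|//]; move: ab; rewrite bx => ax.
  by move: (lt_trans (le_lt_trans (ys _ a_in) ax) xy); rewrite ltxx.
by move=> c cs; apply: abN; rewrite inE cs orbT.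
Qed.

Lemma sorted_zip_behead s : sorted <%O s ->
  sorted (fun D E : T * T => (D.1 < E.1)%O) (zip s (behead s)).
Proof.
elim: s => [|x [|y s] IH] //= /andP[xy pth].
by have := IH pth; case: s pth {IH} => [|z s] //= pth ->; rewrite xy.
Qed.

(** The half-open condition makes the pair start at [x] when [x] is itself in the list. Applied to
    the left end of a finer net interval, it finds the parent. *)
Lemma zip_behead_cover s a b x : sorted <%O s -> a \in s -> b \in s ->
  (a <= x)%O -> (x < b)%O ->
  exists D, [/\ D \in zip s (behead s), (D.1 <= x)%O & (x < D.2)%O].
Proof.
have aux y s' : path <%O y s' -> (y <= x)%O -> b \in s' -> (x < b)%O ->
    exists D, [/\ D \in zip (y :: s') s', (D.1 <= x)%O & (x < D.2)%O].
  elim: s' y => [|z s' IH] y //= /andP[yz pth] yx.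
  rewrite inE => /orP[/eqP->|bs] xb.
    by exists (y, z); rewrite inE eqxx.
  have [zx|xz] := leP z x; last by exists (y, z); rewrite inE eqxx.
  have [D [Din D1 D2]] := IH z pth zx bs xb.
  by exists D; rewrite inE Din orbT.
case: s => [|y s] //= pth a_in b_in ax xb.
have yx : (y <= x)%O.
  apply: le_trans ax; move: a_in; rewrite inE => /orP[/eqP->//|a_in].
  by move: pth; rewrite (path_sortedE lt_trans) => /andP[/allP/(_ _ a_in)/ltW].
apply: aux => //; move: b_in; rewrite inE => /orP[/eqP by_|//].
by rewrite by_ in xb; move: (lt_le_trans xb yx); rewrite ltxx.
Qed.

Lemma sort_undup_sorted s : sorted <%O (sort <=%O (undup s)).
Proof.
by rewrite lt_sorted_uniq_le sort_uniq undup_uniq sort_sorted //; exact: le_total.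
Qed.

End ConsecutivePairs.

Section Words.
Context {R : realType} {m : nat}.

(** Words grow at their last letter because [S_(s j)] maps into the image of [S_s]: passing from a
    net interval to a child appends a letter on the right. *)
Fixpoint words (n : nat) : seq (seq 'I_m.+1) :=
  if n is k.+1 then [seq rcons s j | s <- words k, j <- enum 'I_m.+1]
  else [:: [::]].

Lemma mem_words n s : (s \in words n) = (size s == n).
Proof.
elim: n s => [|n IH] s /=; first by rewrite inE; case: s.
apply/allpairsP/eqP => [[[t j]] /= [t_in _ ->]|].
  by move: t_in; rewrite IH size_rcons => /eqP ->.
case/lastP: s => // s j; rewrite size_rcons => -[sn].
by exists (s, j); rewrite /= IH sn eqxx mem_enum.
Qed.

Lemma words_uniq n : uniq (words n).
Proof.
elim: n => [|n IH] //=; apply: allpairs_uniq => //; first exact: enum_uniq.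
by move=> [s i] [t j] _ _ /= /rcons_inj[-> ->].
Qed.

Lemma big_words_S (V : nmodType) n (f : seq 'I_m.+1 -> V) :
  \sum_(s <- words n.+1) f s = \sum_(s <- words n) \sum_j f (rcons s j).
Proof.
rewrite /= big_allpairs_dep; apply: eq_bigr => s _.
by rewrite big_enum.
Qed.

End Words.

Section Geometry.
Context {R : realType} {m : nat}.
Variables (rho : R) (d : 'I_m.+1 -> R).

(** Since all maps have ratio [rho], a word of length n has image [[off s, off s + rho ^+ n]]; the
    offset carries all the geometry. *)
Definition off (s : seq 'I_m.+1) : R := simil_word rho d s 0.

Lemma simil_wordE s x : simil_word rho d s x = rho ^+ size s * x + off s.
Proof.
elim: s x => [|j s IH] x; first by rewrite /off /= expr0 mul1r addr0.
rewrite /off /= /simil IH -/(off s) exprS; rewrite mulrDr mulrA -!addrA; congr (_ + _).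
Qed.

Lemma off_rcons s j : off (rcons s j) = off s + rho ^+ size s * d j.
Proof.
rewrite /off /simil_word foldr_rcons -/(simil_word rho d s (simil rho d j 0)).
by rewrite simil_wordE /simil mulr0 add0r addrC.
Qed.

Lemma simil_word_rcons s j x :
  simil_word rho d (rcons s j) x = simil_word rho d s (simil rho d j x).
Proof. by rewrite /simil_word foldr_rcons. Qed.

Lemma mem_net_points n x : x \in net_points rho d n <->
  exists2 s, size s = n & x = off s \/ x = off s + rho ^+ n.
Proof.
rewrite /net_points mem_sort mem_undup mem_cat; split.
  case/orP=> /fintype.imageP[s _ ->]; exists s; rewrite ?size_tuple //; first by left.
  by right; rewrite simil_wordE size_tuple mulr1 addrC.
case=> s sn xE; have sn' : size s == n by rewrite sn.
apply/orP; case: xE => ->; [left|right]; apply/fintype.imageP;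
  exists (Tuple sn') => //=.
by rewrite simil_wordE sn mulr1 addrC.
Qed.

Lemma net_points_sorted n : sorted <%R (net_points rho d n).
Proof. exact: sort_undup_sorted. Qed.

Lemma mem_net_intervals n D : D \in net_intervals rho d n <->
  [/\ D.1 \in net_points rho d n, D.2 \in net_points rho d n, D.1 < D.2 &
   forall c, c \in net_points rho d n -> c <= D.1 \/ D.2 <= c].
Proof. by case: D => a b; apply: mem_zip_behead; apply: net_points_sorted. Qed.

Definition covers (n : nat) (D : R * R) (s : seq 'I_m.+1) : bool :=
  (off s <= D.1) && (D.2 <= off s + rho ^+ n).

Lemma mem_neighbours n D a : a \in neighbours rho d n D <->
  exists s, [/\ size s = n, covers n D s & a = rho ^- n * (D.1 - off s)].
Proof.
rewrite /neighbours mem_sort mem_undup; split.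
  case/mapP=> s; rewrite mem_filter /pair_sub /= => /andP[ds _] ->.
  exists s; rewrite size_tuple; split=> //.
  by move: ds; rewrite (simil_wordE s 1) size_tuple mulr1 addrC.
case=> s [sn cov ->]; have sn' : size s == n by rewrite sn.
apply/mapP; exists (Tuple sn') => //=.
rewrite mem_filter mem_enum inE andbT /pair_sub /=.
by rewrite (simil_wordE s 1) sn mulr1 addrC.
Qed.

Lemma neighbours_sorted n D : sorted <%R (neighbours rho d n D).
Proof. exact: sort_undup_sorted. Qed.

Lemma neighbours_uniq n D : uniq (neighbours rho d n D).
Proof. by rewrite sort_uniq undup_uniq. Qed.

End Geometry.

(** * Net intervals *)

(** The geometric content of the support being [0, 1]; [tiling_of_support] derives it from the
    measure. The absence of gaps is stated as a covering of [0, 1] by the images of the maps. *)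
Record tiling_ifs (R : realType) (m : nat) (rho : R) (d : 'I_m.+1 -> R) : Prop :=
  TilingIFS {
    ratio_gt0 : 0 < rho;
    ratio_lt1 : rho < 1;
    shift_incr : forall i j : 'I_m.+1, (i < j)%N -> d i < d j;
    shift0 : d ord0 = 0;
    shift_max : d ord_max = 1 - rho;
    shift_cover : forall x, 0 <= x <= 1 -> exists j, d j <= x <= d j + rho }.

Section NetIntervals.
Context {R : realType} {m : nat} {rho : R} {d : 'I_m.+1 -> R}.
Hypothesis H : tiling_ifs rho d.
Let rho0 : 0 < rho := ratio_gt0 H.
Local Notation off := (off rho d).
Local Notation F := (net_intervals rho d).
Local Notation N := (net_points rho d).
Local Notation covers := (covers rho d).

Lemma ratioX_gt0 n : 0 < rho ^+ n. Proof. exact: exprn_gt0. Qed.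

Lemma shift_le (i j : 'I_m.+1) : (i <= j)%N -> d i <= d j.
Proof.
rewrite leq_eqVlt => /orP[/eqP/val_inj->//|/(shift_incr H)/ltW//].
Qed.

Lemma shift_inj : injective d.
Proof.
move=> i j dij; apply: val_inj; case: (ltngtP i j) => // /(shift_incr H);
by rewrite dij ltxx.
Qed.

Lemma shift_bounds j : 0 <= d j <= 1 - rho.
Proof.
rewrite -{1}(shift0 H) -(shift_max H) !shift_le //=.
by rewrite -ltnS ltn_ord.
Qed.

Lemma off_rcons0 s : off (rcons s ord0) = off s.
Proof. by rewrite off_rcons (shift0 H) mulr0 addr0. Qed.

Lemma off_rcons_max s :
  off (rcons s ord_max) + rho ^+ (size s).+1 = off s + rho ^+ size s.
Proof. by rewrite off_rcons (shift_max H) exprS; ring. Qed.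

Lemma off_bounds s : 0 <= off s /\ off s + rho ^+ size s <= 1.
Proof.
elim: s => [|j s [s0 s1]]; first by rewrite /off /= expr0 add0r.
have /andP[dj0 dj1] := shift_bounds j.
have -> : off (j :: s) = rho * off s + d j by [].
have sp := ratioX_gt0 (size s).
rewrite exprS; split; first by rewrite addr_ge0 // mulr_ge0 // ltW.
have : rho * (off s + rho ^+ size s) <= rho * 1 by rewrite ler_pM2l.
by rewrite mulrDr; lra.
Qed.

(** The first map fixes 0 and the last one fixes 1, so appending [ord0] keeps the left end of an
    image and appending [ord_max] keeps the right end. *)
Lemma net_points_sub n : {subset N n <= N n.+1}.
Proof.
move=> x /mem_net_points[s sn xE]; apply/mem_net_points.
case: xE => xE; [exists (rcons s ord0)|exists (rcons s ord_max)];
  rewrite ?size_rcons ?sn //; [left|right].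
  by rewrite off_rcons0.
by rewrite -sn off_rcons_max sn.
Qed.

Lemma net_points0 n : 0 \in N n.
Proof.
elim: n => [|n /net_points_sub//]; apply/mem_net_points.
by exists [::]; [|left].
Qed.

Lemma net_points1 n : 1 \in N n.
Proof.
elim: n => [|n /net_points_sub//]; apply/mem_net_points.
by exists [::]; [|right; rewrite /off /= add0r].
Qed.

Lemma net_points_bounds n x : x \in N n -> 0 <= x <= 1.
Proof.
case/mem_net_points=> s sn xE; have [s0 s1] := off_bounds s.
have := ratioX_gt0 (size s); rewrite sn in s1 *.
by case: xE => ->; lra.
Qed.

Lemma net_intervals0 D : D \in F 0 <-> D = (0, 1).
Proof.
have mem0 x : x \in N 0 <-> x = 0 \/ x = 1.
  rewrite mem_net_points; split.
    by case=> [[|//]] _; rewrite /off /= add0r.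
  by move=> xE; exists [::] => //; rewrite /off /= add0r.
split.
  case/mem_net_intervals=> /mem0 D1 /mem0 D2 lt12 _.
  rewrite [D]surjective_pairing.
  by case: D1 lt12 => ->; case: D2 => -> //; rewrite ?ltxx // ltNge ler01.
move->; apply/mem_net_intervals; split => /=; rewrite ?ltr01 //; try by apply/mem0; auto.
by move=> c /mem0[]->; [left|right].
Qed.

Lemma net_interval_lt n D : D \in F n -> D.1 < D.2.
Proof. by case/mem_net_intervals. Qed.

(** Both ends of the image are net points of level n, so neither can fall strictly inside [D]. *)
Lemma covers_trichotomy n D s : D \in F n -> size s = n ->
  [\/ covers n D s, D.2 <= off s | off s + rho ^+ n <= D.1].
Proof.
case/mem_net_intervals=> _ _ _ DN sn.
have /DN : off s \in N n by apply/mem_net_points; exists s; auto.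
have /DN : off s + rho ^+ n \in N n by apply/mem_net_points; exists s; auto.
rewrite /covers; case=> h1 [] h2; [constructor 3|constructor 2|constructor 1|constructor 2] => //.
by rewrite h1 h2.
Qed.

Lemma covers_interior n D s x : D \in F n -> size s = n -> D.1 < x < D.2 ->
  off s <= x <= off s + rho ^+ n -> covers n D s.
Proof.
move=> DF sn Dx sx; have [//|h|h] := covers_trichotomy DF sn; suff : (0 : R) < 0; [by rewrite ltxx|lra|by rewrite ltxx|lra].
Qed.

Lemma word_cover_split s x : off s <= x <= off s + rho ^+ size s ->
  exists j, off (rcons s j) <= x <= off (rcons s j) + rho ^+ (size s).+1.
Proof.
move=> sx; have sp := ratioX_gt0 (size s).
have [|j] := shift_cover H (x := (x - off s) / rho ^+ size s).
  by rewrite divr_ge0 ?(ltW sp) //= ?ler_pdivrMr //; lra.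
rewrite ler_pdivlMr // ler_pdivrMr // => /andP[j1 j2]; exists j.
by rewrite off_rcons exprS; move: j1 j2; lra.
Qed.

Lemma word_cover n x : 0 <= x <= 1 ->
  exists2 s, size s = n & off s <= x <= off s + rho ^+ n.
Proof.
move=> x01; elim: n => [|n [s sn]].
  by exists [::] => //; rewrite /off /= add0r.
rewrite -{1}sn => /word_cover_split[j js].
by exists (rcons s j); rewrite ?size_rcons -sn.
Qed.

Lemma net_interval_mid n D : D \in F n ->
  D.1 < (D.1 + D.2) / 2 < D.2 /\ 0 <= (D.1 + D.2) / 2 <= 1.
Proof.
case/mem_net_intervals=> /net_points_bounds D1 /net_points_bounds D2 lt12 _.
by split; lra.
Qed.

Lemma covers_exists n D : D \in F n -> exists2 s, size s = n & covers n D s.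
Proof.
move=> DF; have [mid mid01] := net_interval_mid DF.
have [s sn sx] := word_cover n mid01; exists s => //.
exact: covers_interior mid sx.
Qed.

Lemma size_neighbours_gt0 n D : D \in F n -> (0 < size (neighbours rho d n D))%N.
Proof.
case/covers_exists=> s sn cov.
have : rho ^- n * (D.1 - off s) \in neighbours rho d n D.
  by apply/mem_neighbours; exists s.
by case: neighbours.
Qed.

Lemma covers_parent n P D s j : is_parent rho d n P D -> size s = n ->
  covers n.+1 D (rcons s j) -> covers n P s.
Proof.
case=> PF DF /andP[DP1 DP2] sn /andP[c1 c2].
have [mid _] := net_interval_mid DF.
have /andP[d1 d2] := shift_bounds j.
have sp := ratioX_gt0 n.
apply: (@covers_interior _ _ _ ((D.1 + D.2) / 2)) => //; first by lra.
rewrite off_rcons sn exprS in c1 c2.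
have h1 : 0 <= rho ^+ n * d j by rewrite mulr_ge0 // ltW.
have h2 : rho ^+ n * d j <= rho ^+ n * (1 - rho) by rewrite ler_pM2l.
by rewrite mulrBr mulr1 in h2; lra.
Qed.

Lemma covers_child n P D s : is_parent rho d n P D -> size s = n ->
  covers n P s -> exists j, covers n.+1 D (rcons s j).
Proof.
case=> PF DF /andP[DP1 DP2] sn /andP[c1 c2].
have [mid _] := net_interval_mid DF.
have [|j jx] := @word_cover_split s ((D.1 + D.2) / 2); first by rewrite sn; lra.
exists j; apply: covers_interior mid _ => //; first by rewrite size_rcons sn.
by rewrite -sn.
Qed.

Lemma parent_exists n D : D \in F n.+1 -> exists P, is_parent rho d n P D.
Proof.
move=> DF; have [/net_points_bounds b1 /net_points_bounds b2 lt12 DN] :=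
  (mem_net_intervals _ _ _ _).1 DF.
have [||P [PF P1 P2]] := zip_behead_cover (x := D.1) (net_points_sorted rho d n)
  (net_points0 n) (net_points1 n); [by lra|by lra|].
exists P; split=> //; rewrite /pair_sub P1 /=.
case/mem_net_intervals: PF => _ /net_points_sub/DN[]//.
by move=> h; move: (le_lt_trans h P2); rewrite ltxx.
Qed.

Lemma parent_unique n P Q D : is_parent rho d n P D -> is_parent rho d n Q D -> P = Q.
Proof.
case=> /mem_net_intervals[P1 P2 ltP PN] DF /andP[DP1 DP2].
case=> /mem_net_intervals[Q1 Q2 ltQ QN] _ /andP[DQ1 DQ2].
have D12 := net_interval_lt DF.
rewrite [P]surjective_pairing [Q]surjective_pairing; congr pair;
  apply/eqP; rewrite eq_le.
  by have := PN _ Q1; have := QN _ P1; lra.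
by have := PN _ Q2; have := QN _ P2; lra.
Qed.

Lemma parentE n P D : is_parent rho d n P D -> parent rho d n D = P.
Proof.
move=> PD; have [PF DF DP] := PD; rewrite /parent.
have : P \in [seq P <- F n | pair_sub D P] by rewrite mem_filter DP.
case E : [seq P <- F n | pair_sub D P] => [//|Q l] _ /=.
have : Q \in [seq P <- F n | pair_sub D P] by rewrite E inE eqxx.
rewrite mem_filter => /andP[DQ QF]; exact: (@parent_unique n Q P D).
Qed.

End NetIntervals.

(** * Net intervals of equal length and neighbours have homothetic children *)

Section Homothety.
Context {R : realType} {m : nat} {rho : R} {d : 'I_m.+1 -> R}.
Hypothesis H : tiling_ifs rho d.
Let rho0 : 0 < rho := ratio_gt0 H.
Local Notation off := (off rho d).
Local Notation F := (net_intervals rho d).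
Local Notation N := (net_points rho d).
Local Notation covers := (covers rho d).
Local Notation cv := (char_vector rho d).

(** The affine map of ratio [rho ^+ n' / rho ^+ n] sending the left end of [P] to that of [P']. The
    levels may be in any order, and exchanging the two pairs gives the inverse. *)
Definition homothety (n : nat) (P : R * R) (n' : nat) (P' : R * R) (x : R) : R :=
  P'.1 + rho ^+ n' * (rho ^- n * (x - P.1)).

Definition homothety2 n P n' P' (D : R * R) : R * R :=
  (homothety n P n' P' D.1, homothety n P n' P' D.2).

Lemma homothetyK n P n' P' : cancel (homothety n P n' P') (homothety n' P' n P).
Proof.
move=> x; rewrite /homothety; have := ratioX_gt0 H n; have := ratioX_gt0 H n'.
move=> /lt0r_neq0 a0 /lt0r_neq0 b0; field; exact/andP.
Qed.

Lemma homothety2K n P n' P' : cancel (homothety2 n P n' P') (homothety2 n' P' n P).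
Proof. by case=> a b; rewrite /homothety2 /= !homothetyK. Qed.

Lemma ler_homothety n P n' P' x y :
  (homothety n P n' P' x <= homothety n P n' P' y) = (x <= y).
Proof.
rewrite /homothety lerD2l (ler_pM2l (ratioX_gt0 H n')) ler_pM2l ?invr_gt0 ?(ratioX_gt0 H) //.
by rewrite lerD2r.
Qed.

Lemma ltr_homothety n P n' P' x y :
  (homothety n P n' P' x < homothety n P n' P' y) = (x < y).
Proof. by rewrite !ltNge ler_homothety. Qed.

Lemma homothety_left n P n' P' : homothety n P n' P' P.1 = P'.1.
Proof. by rewrite /homothety subrr !mulr0 addr0. Qed.

Lemma homothety_right n P n' P' :
  (cv n P).1 = (cv n' P').1 -> homothety n P n' P' P.2 = P'.2.
Proof.
case=> e _; rewrite /homothety -/(norm_length rho n P) e /norm_length.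
by rewrite mulrA divff ?(lt0r_neq0 (ratioX_gt0 H n')) // mul1r addrC subrK.
Qed.

Section Transfer.
Variables (n : nat) (P : R * R) (n' : nat) (P' : R * R).
Hypotheses (PF : P \in F n) (PF' : P' \in F n') (eqc : (cv n P).1 = (cv n' P').1).
Local Notation phi := (homothety n P n' P').
Local Notation phi2 := (homothety2 n P n' P').

(** Neighbours are the rescaled positions of [P] relative to its covering words, so equal lists
    match the covering words of [P] with those of [P']. *)
Lemma covering_transfer s : size s = n -> covers n P s ->
  exists s', [/\ size s' = n', covers n' P' s' & phi (off s) = off s'].
Proof.
move=> sn cov; have : rho ^- n * (P.1 - off s) \in neighbours rho d n P.
  by apply/mem_neighbours; exists s.
case: eqc => _ -> /mem_neighbours[s' [sn' cov' e]]; exists s'; split=> //.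
rewrite /homothety -[_ - P.1]opprB mulrN e -mulrN mulrA divff ?mul1r ?opprB.
  by rewrite addrC subrK.
by rewrite lt0r_neq0 ?(ratioX_gt0 H).
Qed.

Lemma homothety_scale x k : phi (x + rho ^+ n * k) = phi x + rho ^+ n' * k.
Proof.
rewrite /homothety; have := ratioX_gt0 H n => /lt0r_neq0 a0; field; exact: a0.
Qed.

(** A net point strictly inside [P] is an end of the image of some [s j] with [s] covering [P]; the
    matching word followed by the same letter [j] gives the image point. At an end of [P] the word
    could merely touch [P], so the ends are treated as net points of the coarser level. *)
Lemma homothety_net_points x : x \in N n.+1 -> P.1 <= x <= P.2 -> phi x \in N n'.+1.
Proof.
move=> xN /andP[]; rewrite le_eqVlt => /orP[/eqP<- _|Px].
  rewrite homothety_left; apply: net_points_sub => //.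
  by case/mem_net_intervals: PF'.
rewrite le_eqVlt => /orP[/eqP->|xP].
  rewrite homothety_right //; apply: net_points_sub => //.
  by case/mem_net_intervals: PF'.
case/mem_net_points: xN => s; case/lastP: s => // s j; rewrite size_rcons => -[sn] xE.
have cov : covers n P s.
  apply: (covers_interior PF sn (_ : P.1 < x < P.2)); first by rewrite Px.
  have /andP[d0 d1] := shift_bounds H j; have sp := ratioX_gt0 H n.
  have h1 : 0 <= rho ^+ n * d j by rewrite mulr_ge0 // ltW.
  have h2 : rho ^+ n * d j <= rho ^+ n * (1 - rho) by rewrite ler_pM2l.
  have h3 : 0 <= rho ^+ n * rho by rewrite mulr_ge0 // ltW.
  rewrite mulrBr mulr1 in h2; rewrite off_rcons sn exprS in xE.
  by case: xE => ->; lra.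
have [s' [sn' cov' e]] := covering_transfer sn cov.
apply/mem_net_points; exists (rcons s' j); first by rewrite size_rcons sn'.
rewrite off_rcons sn' -e; case: xE => ->; rewrite off_rcons sn; [left|right].
  exact: homothety_scale.
by rewrite !exprSr !homothety_scale.
Qed.

Lemma homothety_pair_sub D : pair_sub (phi2 D) P' = pair_sub D P.
Proof.
rewrite /pair_sub /= -{1}(homothety_left n P n' P') ler_homothety.
by rewrite -(homothety_right eqc) ler_homothety.
Qed.

End Transfer.

Lemma homothety_is_parent n P n' P' D : P' \in F n' -> (cv n P).1 = (cv n' P').1 ->
  is_parent rho d n P D -> is_parent rho d n' P' (homothety2 n P n' P' D).
Proof.
move=> PF' eqc [PF DF DP]; split=> //; last by rewrite homothety_pair_sub.
have /andP[DP1 DP2] := DP.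
case/mem_net_intervals: DF => D1 D2 lt12 DN.
apply/mem_net_intervals; split; rewrite /= ?ltr_homothety //.
- by apply: homothety_net_points => //; rewrite DP1 /= ltW // (lt_le_trans lt12).
- by apply: homothety_net_points => //; rewrite DP2 andbT ltW // (le_lt_trans DP1).
(* A net point strictly inside the image of [D] would be pulled back by the inverse homothety to a
   net point strictly inside [D]. *)
move=> c cN.
have [le1|lt1] := leP c (homothety n P n' P' D.1); first by left.
have [le2|lt2] := leP (homothety n P n' P' D.2) c; first by right.
have cE : c = homothety n P n' P' (homothety n' P' n P c) by rewrite homothetyK.
have xc : P.1 <= homothety n' P' n P c <= P.2.
  apply/andP; split; rewrite -(ler_homothety n P n' P') -cE ?homothety_left.
    by apply: le_trans (ltW lt1); rewrite -(homothety_left n P n' P') ler_homothety.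
  rewrite homothety_right //; apply: le_trans (ltW lt2) _.
  by rewrite -(homothety_right eqc) ler_homothety.
have c01 : P'.1 <= c <= P'.2.
  rewrite -(homothety_left n P n' P') -(homothety_right eqc) cE.
  by rewrite !ler_homothety.
have [h|h] := DN _ (homothety_net_points PF' PF (esym eqc) cN c01).
- by rewrite -(ler_homothety n P n' P') -cE leNgt lt1 in h.
- by rewrite -(ler_homothety n P n' P') -cE leNgt lt2 in h.
Qed.

Lemma homothety_neighbours_sub n P n' P' D :
  P' \in F n' -> (cv n P).1 = (cv n' P').1 -> is_parent rho d n P D ->
  {subset neighbours rho d n.+1 D <= neighbours rho d n'.+1 (homothety2 n P n' P' D)}.
Proof.
move=> PF' eqc PD a /mem_neighbours[s []]; case/lastP: s => // s j.
rewrite size_rcons => -[sn] cov ->.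
have [s' [sn' cov' e]] := covering_transfer eqc sn (covers_parent H PD sn cov).
apply/mem_neighbours; exists (rcons s' j); rewrite size_rcons sn'.
have eo : off (rcons s' j) = homothety n P n' P' (off (rcons s j)).
  by rewrite !off_rcons sn sn' homothety_scale // e.
split=> //.
  rewrite /covers eo /= ler_homothety; case/andP: cov => -> c2 /=.
  by rewrite exprSr -homothety_scale // ler_homothety -exprSr.
rewrite eo /= /homothety !exprSr; have := ratioX_gt0 H n => /lt0r_neq0 a0.
have := ratioX_gt0 H n' => /lt0r_neq0 b0; have := lt0r_neq0 rho0 => c0.
by field; rewrite ?a0 ?b0 ?c0.
Qed.

Lemma homothety_neighbours n P n' P' D :
  P' \in F n' -> (cv n P).1 = (cv n' P').1 -> is_parent rho d n P D ->
  neighbours rho d n'.+1 (homothety2 n P n' P' D) = neighbours rho d n.+1 D.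
Proof.
move=> PF' eqc PD; apply: lt_sorted_eq; try exact: neighbours_sorted.
move=> a; apply/idP/idP; last exact: homothety_neighbours_sub.
rewrite -{2}(homothety2K n P n' P' D).
apply: homothety_neighbours_sub => //; first by case: PD.
exact: homothety_is_parent.
Qed.

Lemma homothety_norm_length n P n' P' D :
  norm_length rho n'.+1 (homothety2 n P n' P' D) = norm_length rho n.+1 D.
Proof.
rewrite /norm_length /homothety2 /homothety /= !exprSr.
have := ratioX_gt0 H n => /lt0r_neq0 a0.
have := ratioX_gt0 H n' => /lt0r_neq0 b0; have := lt0r_neq0 rho0 => c0.
by field; rewrite ?a0 ?b0 ?c0.
Qed.

(** An equality of lists, not only of sets: the homothety is increasing, so the left-to-right order,
    and with it the sibling rank, is preserved. *)
Lemma homothety_children n P n' P' : P \in F n -> P' \in F n' ->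
  (cv n P).1 = (cv n' P').1 ->
  [seq E <- F n'.+1 | pair_sub E P'] =
  [seq homothety2 n P n' P' E | E <- [seq E <- F n.+1 | pair_sub E P]].
Proof.
move=> PF PF' eqc.
have tr : transitive (fun D E : R * R => D.1 < E.1) by move=> ? ? ?; exact: lt_trans.
have ir : irreflexive (fun D E : R * R => D.1 < E.1) by move=> ?; exact: ltxx.
apply: (irr_sorted_eq tr ir).
- apply: sorted_filter => //; apply: sorted_zip_behead; exact: net_points_sorted.
- rewrite sorted_map (eq_sorted (e' := fun D E : R * R => D.1 < E.1)).
    apply: sorted_filter => //; apply: sorted_zip_behead; exact: net_points_sorted.
  by move=> D E /=; rewrite ltr_homothety.
move=> D; rewrite mem_filter; apply/andP/mapP.
  case=> DP' DF'; exists (homothety2 n' P' n P D); last by rewrite homothety2K.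
  have [_ h1 h2] : is_parent rho d n P (homothety2 n' P' n P D).
    exact: homothety_is_parent.
  by rewrite mem_filter h1 h2.
case=> E; rewrite mem_filter => /andP[EP EF] ->.
have [_ h1 h2] : is_parent rho d n' P' (homothety2 n P n' P' E).
  exact: homothety_is_parent.
by [].
Qed.

Lemma sibling_rankE n P D : is_parent rho d n P D ->
  sibling_rank rho d n.+1 D =
  (index D [seq E <- [seq E <- F n.+1 | pair_sub E P] |
     (norm_length rho n.+1 E == norm_length rho n.+1 D) &&
     (neighbours rho d n.+1 E == neighbours rho d n.+1 D)]).+1.
Proof.
move=> PD; rewrite /sibling_rank (parentE PD) -filter_predI; congr (index _ _).+1.
by apply: eq_filter => E /=; rewrite andbC.
Qed.

Lemma homothety_char_vector n P n' P' D : P' \in F n' ->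
  (cv n P).1 = (cv n' P').1 -> is_parent rho d n P D ->
  cv n'.+1 (homothety2 n P n' P' D) = cv n.+1 D.
Proof.
move=> PF' eqc PD; rewrite /char_vector homothety_norm_length.
rewrite homothety_neighbours //; congr (_, _, _).
have PD' := homothety_is_parent PF' eqc PD.
have [PF _ _] := PD.
rewrite (sibling_rankE PD) (sibling_rankE PD') (homothety_children PF PF' eqc).
congr _.+1; rewrite filter_map index_map; last first.
  exact: can_inj (homothety2K n P n' P').
congr index; apply: eq_in_filter => E; rewrite mem_filter => /andP[EP EF] /=.
rewrite !homothety_norm_length (homothety_neighbours PF' eqc PD).
by rewrite (homothety_neighbours PF' eqc (D := E)).
Qed.

(** This is what the rank is for: it is the position among the siblings of equal length and
    neighbours. *)
Lemma char_vector_inj_children n P D E : is_parent rho d n P D ->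
  is_parent rho d n P E -> cv n.+1 D = cv n.+1 E -> D = E.
Proof.
move=> PD PE eDE.
have eL : norm_length rho n.+1 D = norm_length rho n.+1 E.
  by have := congr1 (fun v : @charvec R => v.1.1) eDE.
have eV : neighbours rho d n.+1 D = neighbours rho d n.+1 E.
  by have := congr1 (fun v : @charvec R => v.1.2) eDE.
have : sibling_rank rho d n.+1 D = sibling_rank rho d n.+1 E.
  by have := congr1 (fun v : @charvec R => v.2) eDE.
rewrite (sibling_rankE PD) (sibling_rankE PE) eL eV => -[].
set l := seq.filter _ _ => e.
have Dl : D \in l.
  by rewrite !mem_filter eL eV !eqxx /=; case: PD => _ -> ->.
have El : E \in l.
  by rewrite !mem_filter !eqxx /=; case: PE => _ -> ->.
by rewrite -(nth_index D Dl) e nth_index.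
Qed.

End Homothety.

(** * Finitely many pairs (length, neighbours) *)

Section FiniteCores.
Context {R : realType} {m : nat} {rho : R} {d : 'I_m.+1 -> R}.
Hypothesis H : tiling_ifs rho d.
Hypothesis FT : finite_type rho d.
Local Notation off := (off rho d).
Local Notation F := (net_intervals rho d).
Local Notation N := (net_points rho d).
Local Notation covers := (covers rho d).
Local Notation cv := (char_vector rho d).

Lemma finite_relative_positions : exists E : seq R, forall n x s,
  x \in N n -> size s = n -> off s <= x <= off s + rho ^+ n ->
  rho ^- n * (x - off s) \in E.
Proof.
have [F0 [/finite_seqP[fl ->] _ Ffl]] := FT.
have c1 : (1 - rho)^-1 * (d ord_max - d ord0) = 1.
  by rewrite (shift0 H) (shift_max H) subr0 mulVf // subr_eq0 gt_eqF // (ratio_lt1 H).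
(* The values 0 and 1 serve level 0, to which the finite type condition does not apply. At later
   levels [c] equals 1, so left ends give elements of [fl]; a right end [off s' + rho ^+ n] gives 1
   minus the rescaled difference [off s - off s']. *)
exists (0 :: 1 :: fl ++ [seq 1 - x | x <- fl]) => -[|n] x s xN sn sx.
  case/mem_net_points: xN => s' sn' xE; rewrite !inE.
  case: s sn sx => // _ _; case: s' sn' xE => // _.
  by rewrite /off /= expr0 invr1 mul1r subr0 add0r => -[] ->; rewrite eqxx ?orbT.
have near (u v : seq 'I_m.+1) : size u = n.+1 -> size v = n.+1 ->
    0 <= off u - off v <= rho ^+ n.+1 -> rho ^- n.+1 * (off u - off v) \in fl.
  move=> un vn /andP[uv0 uv1].
  have [||] := Ffl n.+1 (Tuple (introT eqP un)) (Tuple (introT eqP vn)) => //=.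
    rewrite c1 -/(off u) -/(off v) ger0_norm // mulrC ltr_pdivlMr ?(ratioX_gt0 H) //.
    by rewrite mul1r ltNge uv1.
  by rewrite -/(off u) -/(off v) ger0_norm.
case/mem_net_points: xN => s' sn' [] xE; rewrite xE !inE mem_cat.
  by rewrite near ?orbT // -xE; lra.
suff -> : rho ^- n.+1 * (off s' + rho ^+ n.+1 - off s) =
    1 - rho ^- n.+1 * (off s - off s').
  by apply/orP; right; apply/orP; right; apply/orP; right; apply: map_f; apply: near => //; lra.
have /lt0r_neq0 r0 := ratioX_gt0 H n.+1; rewrite !mulrBr !mulrDr mulVf //; ring.
Qed.

(** The pair (length, neighbours), called core here, determines the children up to homothety. Seen
    from one covering word, both ends of [D] have one of finitely many relative positions, and so
    does [D.1] seen from any covering word. *)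
Lemma finite_cores : exists L : seq (R * seq R), forall n D, D \in F n ->
  (cv n D).1 \in L.
Proof.
have [E EP] := finite_relative_positions.
pose l := sort <=%R (undup E).
(* The length is a difference of two relative positions; the neighbours form a sorted sublist of
   [l], coded by a boolean mask. *)
exists [seq (c.1 - c.2, mask (val t) l) | c <- [seq (x, y) | x <- E, y <- E],
  t <- enum {: (size l).-tuple bool}] => n D DF.
have [s sn cov] := covers_exists H DF.
have [D1 D2 lt12 _] := (mem_net_intervals _ _ _ _).1 DF.
have VE : {subset neighbours rho d n D <= E}.
  move=> a /mem_neighbours[s' [sn' /andP[c1 c2] ->]]; apply: EP => //.
  by rewrite c1 (le_trans (ltW lt12)).
have /andP[c1 c2] := cov.
have sz : size [seq x \in neighbours rho d n D | x <- l] == size l.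
  by rewrite size_map.
apply/allpairsP; exists ((rho ^- n * (D.2 - off s), rho ^- n * (D.1 - off s)),
  Tuple sz); split=> /=.
- apply: allpairs_f; apply: EP => //.
    by rewrite c2 andbT (le_trans c1) // ltW.
  by rewrite c1 (le_trans (ltW lt12)).
- by rewrite mem_enum.
congr pair; first by rewrite /norm_length -mulrBr opprB addrA subrK.
rewrite -filter_mask; apply: lt_sorted_eq; first exact: neighbours_sorted.
  by apply: sorted_filter; [exact: lt_trans|exact: sort_undup_sorted].
move=> a; have al : (a \in l) = (a \in E) by rewrite mem_sort mem_undup.
rewrite mem_filter al; case: (boolP (a \in neighbours rho d n D)) => [aV|_] //=.
by rewrite (VE _ aV).
Qed.

End FiniteCores.

(** * Transition matrices *)

Record minimal_end_weights (R : realType) (m : nat) (p : 'I_m.+1 -> R) : Prop :=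
  MinimalEndWeights {
    weight_gt0 : forall j, 0 < p j;
    weight_sum : \sum_(j < m.+1) p j = 1;
    weight_ends : p ord0 = p ord_max;
    weight_min : forall j, p ord0 <= p j }.

Section Transitions.
Context {R : realType} {m : nat} {rho : R} {d : 'I_m.+1 -> R} {p : 'I_m.+1 -> R}.
Hypothesis H : tiling_ifs rho d.
Hypothesis Hp : minimal_end_weights p.
Local Notation off := (off rho d).
Local Notation F := (net_intervals rho d).
Local Notation N := (net_points rho d).
Local Notation covers := (covers rho d).
Local Notation cv := (char_vector rho d).
Local Notation nbs := (@charvec_nbs R).
Local Notation nsize a := (size (nbs a)).
Local Notation represents := (represents rho d).
Local Notation child := (child rho d).
Let p0 : R := p ord0.
Let p0_gt0 : 0 < p0 := weight_gt0 Hp ord0.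
Let rX n := lt0r_neq0 (ratioX_gt0 H n).

Lemma weight_le1 j : p j <= 1.
Proof.
rewrite -(weight_sum Hp) (bigD1 j) //= lerDl; apply: sumr_ge0 => i _.
exact/ltW/(weight_gt0 Hp).
Qed.

(** The homothety between two representatives of [alpha] maps one representative of [beta] onto the
    other, because a child is determined by its characteristic vector. The equation is then rescaled
    by a power of [rho]. *)
Lemma trans_indexE alpha beta n P D i k l : represents alpha beta n P D ->
  trans_index rho d alpha beta i k l <->
  P.1 - rho ^+ n * (neighbours rho d n P)`_i + rho ^+ n * d l =
  D.1 - rho ^+ n.+1 * (neighbours rho d n.+1 D)`_k.
Proof.
move=> rep; have [PD Pa Db] := rep; split; last first.
  by move=> e; exists n, P, D; rewrite -Pa -Db.
case=> n' [P' [D' [[PD' Pa' Db'] e]]].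
have [PF _ _] := PD.
have eqc : (cv n' P').1 = (cv n P).1 by rewrite Pa Pa'.
have ED : homothety2 (rho := rho) n' P' n P D' = D.
  apply: (char_vector_inj_children (homothety_is_parent H PF eqc PD') PD).
  by rewrite homothety_char_vector // Db.
have -> : D.1 = P.1 + rho ^+ n * (rho ^- n' * (D'.1 - P'.1)) by rewrite -ED.
rewrite -Pa -Db /= in e.
have -> : D'.1 = P'.1 - rho ^+ n' * (neighbours rho d n P)`_i + rho ^+ n' * d l +
    rho ^+ n'.+1 * (neighbours rho d n.+1 D)`_k by rewrite e subrK.
rewrite !exprSr; field; exact: rX.
Qed.

Definition trans_entry (alpha beta : charvec) (i k : nat) : R :=
  if [pick l | `[< trans_index rho d alpha beta i k l >]] is Some l
  then p0^-1 * p l else 0.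

Lemma trans_entryP alpha beta i k l : child alpha beta ->
  trans_index rho d alpha beta i k l -> trans_entry alpha beta i k = p0^-1 * p l.
Proof.
case=> n [P [D rep]] til; rewrite /trans_entry.
case: pickP => [l' /asboolP til'|/(_ l)]; last by rewrite asboolT.
have e := (trans_indexE _ _ _ rep).1 til; have e' := (trans_indexE _ _ _ rep).1 til'.
rewrite -e in e'; by move: e' => /addrI/(mulfI (rX n))/(shift_inj H) ->.
Qed.

Lemma trans_entry_ge0 alpha beta i k : 0 <= trans_entry alpha beta i k.
Proof.
rewrite /trans_entry; case: pickP => // l _.
by rewrite mulr_ge0 ?invr_ge0 // ltW // (weight_gt0 Hp).
Qed.

Lemma trans_entry_le alpha beta i k : trans_entry alpha beta i k <= p0^-1.
Proof.
rewrite /trans_entry; case: pickP => [l _|_]; last by rewrite invr_ge0 ltW.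
by rewrite ger_pMr ?invr_gt0 // weight_le1.
Qed.

(* The weight of the outer maps is minimal, so normalising by it makes every
   nonzero entry at least 1. *)
Lemma trans_entry_0_or_ge1 alpha beta i k :
  trans_entry alpha beta i k = 0 \/ 1 <= trans_entry alpha beta i k.
Proof.
rewrite /trans_entry; case: pickP => [l _|_]; [right|by left].
by rewrite mulrC ler_pdivlMr // mul1r (weight_min Hp).
Qed.

(** Every word covering the parent has a one-letter extension covering the child. *)
Lemma trans_entry_row alpha beta i : child alpha beta -> (i < nsize alpha)%N ->
  exists2 k, (k < nsize beta)%N & 1 <= trans_entry alpha beta i k.
Proof.
move=> ch ia; have [n [P [D rep]]] := ch.
have [PD Pa Db] := rep.
have : (neighbours rho d n P)`_i \in neighbours rho d n P.
  by apply: mem_nth; rewrite -Pa in ia.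
case/mem_neighbours=> s [sn cov eV].
have [j cov'] := covers_child H PD sn cov.
have : rho ^- n.+1 * (D.1 - off (rcons s j)) \in neighbours rho d n.+1 D.
  by apply/mem_neighbours; exists (rcons s j); rewrite size_rcons sn.
set a := (X in X \in _) => aV; exists (index a (neighbours rho d n.+1 D)).
  by rewrite -Db /= index_mem.
rewrite (@trans_entryP _ _ _ _ j) //.
  by rewrite mulrC ler_pdivlMr // mul1r (weight_min Hp).
apply/(trans_indexE _ _ _ rep); rewrite nth_index // eV /a.
rewrite !mulrA !divff // off_rcons sn; ring.
Qed.

(** A word covering the child covers the parent once its last letter is removed. *)
Lemma trans_entry_col alpha beta k : child alpha beta -> (k < nsize beta)%N ->
  exists2 i, (i < nsize alpha)%N & 1 <= trans_entry alpha beta i k.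
Proof.
move=> ch kb; have [n [P [D rep]]] := ch.
have [PD Pa Db] := rep.
have : (neighbours rho d n.+1 D)`_k \in neighbours rho d n.+1 D.
  by apply: mem_nth; rewrite -Db in kb.
case/mem_neighbours=> s []; case/lastP: s => // s j.
rewrite size_rcons => -[sn] cov eV.
have cov' := covers_parent H PD sn cov.
have : rho ^- n * (P.1 - off s) \in neighbours rho d n P.
  by apply/mem_neighbours; exists s.
set a := (X in X \in _) => aV; exists (index a (neighbours rho d n P)).
  by rewrite -Pa /= index_mem.
rewrite (@trans_entryP _ _ _ _ j) //.
  by rewrite mulrC ler_pdivlMr // mul1r (weight_min Hp).
apply/(trans_indexE _ _ _ rep); rewrite nth_index // eV /a.
rewrite !mulrA !divff // off_rcons sn; ring.
Qed.

(** Entries of [trans_path] with indices in [nat]: concatenating and rewriting paths then involves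
    no casts between dependent matrix sizes. *)
Fixpoint path_entry (alpha : charvec) (s : seq charvec) (i j : nat) : R :=
  if s is beta :: s' then
    \sum_(k < nsize beta) trans_entry alpha beta i k * path_entry beta s' k j
  else (i == j)%:R.

Lemma trans_pathE alpha s i j : trans_path rho d p alpha s i j = path_entry alpha s i j.
Proof.
elim: s alpha i j => [|beta s IH] alpha i j /=; first by rewrite !mxE.
by rewrite mxE; apply: eq_bigr => k _; rewrite IH mxE.
Qed.

Lemma path_entry_cat alpha s1 s2 i j : (i < nsize alpha)%N ->
  path_entry alpha (s1 ++ s2) i j =
  \sum_(k < nsize (last alpha s1)) path_entry alpha s1 i k * path_entry (last alpha s1) s2 k j.
Proof.
elim: s1 alpha i => [|beta s1 IH] alpha i ia /=.
  rewrite (bigD1 (Ordinal ia)) //= eqxx mul1r big1 ?addr0 // => k ki.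
  by rewrite eq_sym (negbTE (ki : val k != i)) mul0r.
under eq_bigr => k _ do rewrite IH // mulr_sumr.
rewrite exchange_big /=; apply: eq_bigr => l _; rewrite mulr_suml.
by apply: eq_bigr => k _; rewrite mulrA.
Qed.

Lemma path_entry_ge0 alpha s i j : 0 <= path_entry alpha s i j.
Proof.
elim: s alpha i => [|beta s IH] alpha i /=; first exact: ler0n.
by apply: sumr_ge0 => k _; rewrite mulr_ge0 // trans_entry_ge0.
Qed.

Lemma ler_sum_term (T : finType) (f : T -> R) k :
  (forall i, 0 <= f i) -> f k <= \sum_i f i.
Proof. by move=> f0; rewrite (bigD1 k) //= lerDl sumr_ge0. Qed.

Lemma path_entry_0_or_ge1 alpha s i j :
  path_entry alpha s i j = 0 \/ 1 <= path_entry alpha s i j.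
Proof.
elim: s alpha i => [|beta s IH] alpha i /=; first by case: eqP; [right|left].
pose f (k : 'I_(nsize beta)) := trans_entry alpha beta i k * path_entry beta s k j.
rewrite -/(\sum_k f k).
have f0 k : 0 <= f k by rewrite mulr_ge0 ?trans_entry_ge0 ?path_entry_ge0.
have [[k fk]|nf] := pselect (exists k, 1 <= f k).
  by right; apply: le_trans fk _; exact: ler_sum_term.
left; rewrite big1 // => k _; have : ~ 1 <= f k by move=> fk; apply: nf; exists k.
rewrite -/(f k) /f.
have [->|t1] := trans_entry_0_or_ge1 alpha beta i k; first by rewrite mul0r.
have [->|e1] := IH beta k; first by rewrite mulr0.
by case; rewrite mulr_ege1.
Qed.

Definition chain (alpha : charvec) (s : seq charvec) : bool :=
  path (fun beta gamma => `[< child beta gamma >]) alpha s.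

Lemma chain_cat alpha s1 s2 : chain alpha (s1 ++ s2) = chain alpha s1 && chain (last alpha s1) s2.
Proof. exact: cat_path. Qed.

Lemma path_entry_row alpha s i : chain alpha s -> (i < nsize alpha)%N ->
  exists2 j, (j < nsize (last alpha s))%N & 1 <= path_entry alpha s i j.
Proof.
elim: s alpha i => [|beta s IH] alpha i /=; first by move=> _ ia; exists i; rewrite ?eqxx.
case/andP=> /asboolP ab bs ia; have [k kb t1] := trans_entry_row ab ia.
have [j jl e1] := IH _ _ bs kb; exists j => //.
apply: le_trans (mulr_ege1 t1 e1) _.
apply: (ler_sum_term (f := fun k : 'I__ => trans_entry alpha beta i k * path_entry beta s k j)
  (Ordinal kb)).
by move=> ?; rewrite mulr_ge0 ?trans_entry_ge0 ?path_entry_ge0.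
Qed.

Lemma path_entry_col alpha s j : chain alpha s -> (j < nsize (last alpha s))%N ->
  exists2 i, (i < nsize alpha)%N & 1 <= path_entry alpha s i j.
Proof.
elim: s alpha => [|beta s IH] alpha /=; first by move=> _ ja; exists j; rewrite ?eqxx.
case/andP=> /asboolP ab bs jl; have [k kb e1] := IH _ bs jl.
have [i ia t1] := trans_entry_col ab kb; exists i => //.
apply: le_trans (mulr_ege1 t1 e1) _.
apply: (ler_sum_term (f := fun k : 'I__ => trans_entry alpha beta i k * path_entry beta s k j)
  (Ordinal kb)).
by move=> ?; rewrite mulr_ge0 ?trans_entry_ge0 ?path_entry_ge0.
Qed.

Definition path_norm (alpha : charvec) (s : seq charvec) : R :=
  \sum_(i < nsize alpha) \sum_(j < nsize (last alpha s)) path_entry alpha s i j.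

Lemma path_norm_ge0 alpha s : 0 <= path_norm alpha s.
Proof. by do 2![apply: sumr_ge0 => ? _]; exact: path_entry_ge0. Qed.

(** Column sums of the first factor meet row sums of the second. Bounding a row sum by the whole
    norm gives submultiplicativity; bounding a row or a column sum below by 1 gives monotonicity
    under extension on either side. *)
Lemma path_norm_cat alpha s1 s2 : path_norm alpha (s1 ++ s2) =
  \sum_(k < nsize (last alpha s1)) (\sum_(i < nsize alpha) path_entry alpha s1 i k) *
    (\sum_(j < nsize (last (last alpha s1) s2)) path_entry (last alpha s1) s2 k j).
Proof.
rewrite /path_norm last_cat.
under eq_bigr => i _.
  under eq_bigr => j _ do rewrite path_entry_cat //.
  rewrite exchange_big /=.
  under eq_bigr => k _ do rewrite -mulr_sumr.
  over.
rewrite exchange_big /=; apply: eq_bigr => k _.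
by rewrite mulr_suml.
Qed.

Lemma path_norm_cat_le alpha s1 s2 :
  path_norm alpha (s1 ++ s2) <= path_norm alpha s1 * path_norm (last alpha s1) s2.
Proof.
rewrite path_norm_cat [X in _ <= X * _]/path_norm exchange_big /= mulr_suml.
apply: ler_sum => k _; rewrite ler_wpM2l ?sumr_ge0 // => [i _|].
  exact: path_entry_ge0.
rewrite /path_norm; apply: (ler_sum_term (f := fun k : 'I__ =>
  \sum_(j < nsize (last (last alpha s1) s2)) path_entry (last alpha s1) s2 k j)).
by move=> i; apply: sumr_ge0 => j _; exact: path_entry_ge0.
Qed.

Lemma path_norm_catl alpha s1 s2 : chain (last alpha s1) s2 ->
  path_norm alpha s1 <= path_norm alpha (s1 ++ s2).
Proof.
move=> ch; rewrite path_norm_cat /path_norm exchange_big /=.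
apply: ler_sum => k _; rewrite ler_peMr ?sumr_ge0 // => [i _|].
  exact: path_entry_ge0.
have [j jl e1] := path_entry_row ch (ltn_ord k); apply: le_trans e1 _.
apply: (ler_sum_term (f := fun j : 'I__ => path_entry (last alpha s1) s2 k j) (Ordinal jl)).
by move=> ?; exact: path_entry_ge0.
Qed.

Lemma path_norm_catr alpha s1 s2 : chain alpha s1 ->
  path_norm (last alpha s1) s2 <= path_norm alpha (s1 ++ s2).
Proof.
move=> ch; rewrite path_norm_cat /path_norm.
apply: ler_sum => k _; rewrite ler_peMl ?sumr_ge0 // => [i _|].
  exact: path_entry_ge0.
have [i ia e1] := path_entry_col ch (ltn_ord k); apply: le_trans e1 _.
apply: (ler_sum_term (f := fun i : 'I__ => path_entry alpha s1 i k) (Ordinal ia)).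
by move=> ?; exact: path_entry_ge0.
Qed.

Definition positive_path (alpha : charvec) (s : seq charvec) : Prop :=
  forall i j, (i < nsize alpha)%N -> (j < nsize (last alpha s))%N -> 0 < path_entry alpha s i j.

Lemma positive_pathP alpha s : positive_mx (trans_path rho d p alpha s) <->
  positive_path alpha s.
Proof.
split=> [pos i j ia jl|pos i j]; last by rewrite trans_pathE pos.
by have := pos (Ordinal ia) (Ordinal jl); rewrite trans_pathE.
Qed.

(** A positive entry is at least 1, so [T(s2)] dominates the all-ones matrix, and inserting the
    latter between [T(s1)] and [T(s3)] yields exactly the product of the norms. *)
Lemma path_norm_positive alpha s1 s2 s3 : positive_path (last alpha s1) s2 ->
  path_norm alpha s1 * path_norm (last (last alpha s1) s2) s3 <=
  path_norm alpha (s1 ++ s2 ++ s3).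
Proof.
move=> pos; rewrite path_norm_cat {1}/path_norm exchange_big /= mulr_suml.
apply: ler_sum => k _; rewrite ler_wpM2l ?sumr_ge0 // => [i _|].
  exact: path_entry_ge0.
rewrite last_cat; under [leRHS]eq_bigr => j _ do rewrite path_entry_cat //.
rewrite exchange_big /= /path_norm; apply: ler_sum => l _; rewrite -mulr_sumr.
rewrite ler_peMl ?sumr_ge0 // => [i _|]; first exact: path_entry_ge0.
have [e0|//] := path_entry_0_or_ge1 (last alpha s1) s2 k l.
by have := pos k l (ltn_ord k) (ltn_ord l); rewrite e0 ltxx.
Qed.

Lemma path_norm_ge1 alpha s : chain alpha s -> (0 < nsize alpha)%N -> 1 <= path_norm alpha s.
Proof.
move=> ch a0; have [j jl e1] := path_entry_row ch a0; apply: le_trans e1 _.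
apply: (@le_trans _ _ (\sum_(j < nsize (last alpha s)) path_entry alpha s 0 j)).
  apply: (ler_sum_term (f := fun j : 'I__ => path_entry alpha s 0 j) (Ordinal jl)).
  by move=> ?; exact: path_entry_ge0.
apply: (ler_sum_term (f := fun i : 'I__ =>
  \sum_(j < nsize (last alpha s)) path_entry alpha s i j) (Ordinal a0)).
by move=> ?; apply: sumr_ge0 => ? _; exact: path_entry_ge0.
Qed.

(** Each factor has at most [K ^ 2] entries, all at most [1 / p0]. The additional power pays for the
    identity matrix of the empty path, of norm at most [K]. *)
Lemma path_norm_le (K : nat) alpha s : (0 < K)%N ->
  (forall beta, beta \in alpha :: s -> (nsize beta <= K)%N) ->
  path_norm alpha s <= (K%:R ^+ 2 / p0) ^+ (size s).+1.
Proof.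
move=> K0; have K1 : 1 <= K%:R :> R by rewrite ler1n.
have p1 : 1 <= p0^-1 by rewrite invf_ge1 // weight_le1.
have B0 : 0 <= K%:R ^+ 2 / p0 by rewrite mulr_ge0 ?exprn_ge0 // (le_trans ler01).
elim: s alpha => [|beta s IH] alpha sz.
  rewrite expr1 /path_norm /=; apply: (@le_trans _ _ (\sum_(i < nsize alpha) 1)).
    apply: ler_sum => i _; rewrite (bigD1 i) //= eqxx big1 ?addr0 // => j ji.
    by rewrite eq_sym (negbTE (ji : val j != val i)).
  rewrite sumr_const card_ord -mulr_natr mul1r.
  apply: (@le_trans _ _ K%:R); first by rewrite ler_nat sz // inE eqxx.
  by rewrite expr2 -mulrA ler_peMr ?ler0n // mulr_ege1.
rewrite -cat1s; apply: le_trans (path_norm_cat_le _ _ _) _.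
rewrite exprS; apply: ler_pM; rewrite ?path_norm_ge0 //; last first.
  by apply: IH => g gs; apply: sz; rewrite inE gs orbT.
rewrite /path_norm /=; apply: (@le_trans _ _
   (\sum_(i < nsize alpha) \sum_(j < nsize beta) p0^-1)).
  apply: ler_sum => i _; apply: ler_sum => j _.
  rewrite (bigD1 j) //= eqxx mulr1 big1 ?addr0 ?trans_entry_le // => k kj.
  by rewrite (negbTE (kj : val k != val j)) mulr0.
rewrite !sumr_const !card_ord -!mulrnA -[leLHS]mulr_natl.
rewrite ler_wpM2r ?(le_trans ler01) // natrM expr2 ler_pM ?ler0n // ler_nat;
  by apply: sz; rewrite !inE eqxx ?orbT.
Qed.

End Transitions.

Arguments trans_entry {R m} rho d p alpha beta i k.
Arguments path_entry {R m} rho d p alpha s i j.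
Arguments path_norm {R m} rho d p alpha s.
Arguments positive_path {R m} rho d p alpha s.
Arguments chain {R m} rho d alpha s.

(** * Weights of words *)

Section WordWeights.
Context {R : realType} {m : nat} {rho : R} {d : 'I_m.+1 -> R} {p : 'I_m.+1 -> R}.
Hypothesis H : tiling_ifs rho d.
Hypothesis Hp : minimal_end_weights p.
Local Notation off := (off rho d).
Local Notation F := (net_intervals rho d).
Local Notation N := (net_points rho d).
Local Notation covers := (covers rho d).
Local Notation cv := (char_vector rho d).
Local Notation nbs := (@charvec_nbs R).
Local Notation nsize a := (size (nbs a)).
Local Notation p0 := (p ord0).
Let p0_gt0 : 0 < p0 := weight_gt0 Hp ord0.
Let rX n := lt0r_neq0 (ratioX_gt0 H n).

Definition word_weight (s : seq 'I_m.+1) : R := \prod_(j <- s) p j.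

Lemma word_weight_gt0 s : 0 < word_weight s.
Proof. by apply: prodr_gt0 => j _; exact: (weight_gt0 Hp). Qed.

Lemma word_weight_rcons s j : word_weight (rcons s j) = word_weight s * p j.
Proof. by rewrite /word_weight -cats1 big_cat big_seq1. Qed.

Lemma word_weight_cat s t : word_weight (s ++ t) = word_weight s * word_weight t.
Proof. by rewrite /word_weight big_cat. Qed.

Lemma word_weight_ge s : p0 ^+ size s <= word_weight s.
Proof.
elim/last_ind: s => [|s j IH]; first by rewrite /word_weight big_nil.
rewrite size_rcons exprSr word_weight_rcons; apply: ler_pM => //.
- exact/exprn_ge0/ltW.
- exact: ltW.
- exact: (weight_min Hp).
Qed.

Definition net_weight (n : nat) (D : R * R) : R :=
  \sum_(s <- words n | covers n D s) word_weight s.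

(** Several words may share one offset; this is their total weight at the k-th neighbour. After
    division by [p0 ^+ n], these row vectors evolve by the primitive transition matrices. *)
Definition neighbour_weight (n : nat) (D : R * R) (k : nat) : R :=
  p0 ^- n * \sum_(s <- words n | off s == D.1 - rho ^+ n * (neighbours rho d n D)`_k)
              word_weight s.

Lemma covers_neighbour n D s : size s = n -> covers n D s ->
  exists2 k : 'I_(size (neighbours rho d n D)),
    off s = D.1 - rho ^+ n * (neighbours rho d n D)`_k &
    forall k' : 'I_(size (neighbours rho d n D)),
      off s = D.1 - rho ^+ n * (neighbours rho d n D)`_k' -> k' = k.
Proof.
move=> sn cov; set V := neighbours rho d n D.
have aV : rho ^- n * (D.1 - off s) \in V by apply/mem_neighbours; exists s.
have kV := aV; rewrite -index_mem in kV.
have e : off s = D.1 - rho ^+ n * V`_(Ordinal kV).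
  by rewrite /= nth_index // mulrA divff // mul1r opprB addrC subrK.
exists (Ordinal kV) => // k' e'.
have eV : V`_k' = V`_(Ordinal kV).
  by move: e'; rewrite {1}e => /addrI/oppr_inj/(mulfI (rX n)).
apply/val_inj/eqP; rewrite -(nth_uniq 0 (ltn_ord k') (ltn_ord (Ordinal kV))).
  by rewrite eV.
exact: neighbours_uniq.
Qed.

Lemma neighbour_covers n D s (k : 'I_(size (neighbours rho d n D))) : size s = n ->
  off s = D.1 - rho ^+ n * (neighbours rho d n D)`_k -> covers n D s.
Proof.
move=> sn e; have : (neighbours rho d n D)`_k \in neighbours rho d n D by exact: mem_nth.
case/mem_neighbours=> s' [sn' cov' eV].
by rewrite /covers e eV mulrA divff // mul1r opprB addrC subrK.
Qed.

Lemma net_weightE n D :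
  net_weight n D = p0 ^+ n * \sum_(k < size (neighbours rho d n D)) neighbour_weight n D k.
Proof.
rewrite /neighbour_weight -mulr_sumr mulrA divff ?mul1r; last first.
  exact/lt0r_neq0/exprn_gt0.
under [RHS]eq_bigr => k _ do rewrite big_mkcond.
rewrite exchange_big /= /net_weight big_mkcond /= big_seq_cond [RHS]big_seq_cond.
apply: eq_bigr => s; rewrite andbT mem_words => /eqP sn.
case: ifPn => [cov|ncov].
  have [k e uk] := covers_neighbour sn cov.
  rewrite (bigD1 k) //= -e eqxx big1 ?addr0 // => k' k'k.
  by case: eqP => // /uk ek; rewrite ek eqxx in k'k.
by rewrite big1 // => k _; case: eqP => // /(neighbour_covers sn) cov; rewrite cov in ncov.
Qed.

(** For a given prefix [s], at most one last letter reaches the k-th offset, since [d] is injective.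
    If one does, [s] covers [P] and lies at exactly one neighbour [i], whose matrix entry supplies
    the factor [p j / p0]; otherwise both contributions of [s] vanish. *)
Lemma neighbour_weight_step n P D k : is_parent rho d n P D ->
  (k < size (neighbours rho d n.+1 D))%N ->
  neighbour_weight n.+1 D k =
  \sum_(i < size (neighbours rho d n P))
    neighbour_weight n P i * trans_entry rho d p (cv n P) (cv n.+1 D) i k.
Proof.
move=> PD kD; set VP := neighbours rho d n P; set VD := neighbours rho d n.+1 D.
have rep : represents rho d (cv n P) (cv n.+1 D) n P D by [].
have ch : child rho d (cv n P) (cv n.+1 D) by exists n, P, D.
rewrite /neighbour_weight -/VP -/VD big_mkcond /= -/(words n.+1) big_words_S.
under [RHS]eq_bigr => i _ do rewrite -mulrA mulr_suml big_mkcond.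
rewrite -mulr_sumr [in RHS]exchange_big /= exprS invfM -mulrA mulrCA; congr (_ * _).
rewrite mulr_sumr big_seq [RHS]big_seq; apply: eq_bigr => s.
rewrite mem_words => /eqP sn.
set z := D.1 - _.
have [[j0 ej]|nj] := pselect (exists j, off (rcons s j) == z).
  have {}ej := eqP ej.
  have cov' : covers n.+1 D (rcons s j0).
    by apply: (@neighbour_covers _ _ _ (Ordinal kD)); rewrite ?size_rcons ?sn.
  have cov := covers_parent H PD sn cov'.
  have [i0 ei ui] := covers_neighbour sn cov.
  rewrite (bigD1 j0) //= ej eqxx big1 ?addr0; last first.
    move=> j jj0; case: eqP => // e; move: jj0.
    rewrite -ej !off_rcons in e; move: e => /addrI.
    by rewrite sn => /(mulfI (rX n))/(shift_inj H) ->; rewrite eqxx.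
  rewrite (bigD1 i0) //= -ei eqxx big1 ?addr0; last first.
    by move=> i ii0; case: eqP => // /ui e; rewrite e eqxx in ii0.
  rewrite (@trans_entryP _ _ _ _ _ H _ _ i0 k j0) //.
    by rewrite word_weight_rcons mulrCA mulrC; congr (_ * _); rewrite mulrC.
  by apply/(trans_indexE H _ _ _ rep); rewrite -/VP -ei -/VD -/z -ej off_rcons sn.
rewrite big1 ?mulr0; last by move=> j _; case: eqP => // e; case: nj; exists j; apply/eqP.
rewrite big1 // => i _; case: eqP => // ei; rewrite /trans_entry.
case: pickP => [l /asboolP/(trans_indexE H _ _ _ rep)|]; last by rewrite mulr0.
rewrite -/VP -/VD -ei => e; case: nj; exists l; apply/eqP.
by rewrite off_rcons sn.
Qed.

Lemma path_entry_rcons alpha s beta i j : (i < nsize alpha)%N -> (j < nsize beta)%N ->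
  path_entry rho d p alpha (rcons s beta) i j =
  \sum_(k < nsize (last alpha s)) path_entry rho d p alpha s i k *
     trans_entry rho d p (last alpha s) beta k j.
Proof.
move=> ia jb; rewrite -cats1 path_entry_cat //; apply: eq_bigr => k _ /=.
congr (_ * _); rewrite (bigD1 (Ordinal jb)) //= eqxx mulr1 big1 ?addr0 // => l lj.
by rewrite (negbTE (lj : val l != j)) mulr0.
Qed.

(** Starts at index 1: a path is given by its first letter [gamma 0] together with the letters that
    follow it. *)
Definition prefix_of (T : Type) (gamma : nat -> T) (n : nat) : seq T :=
  mkseq (fun i => gamma i.+1) n.

Lemma prefix_ofS (T : Type) (gamma : nat -> T) n :
  prefix_of gamma n.+1 = rcons (prefix_of gamma n) (gamma n.+1).
Proof. exact: mkseqS. Qed.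

Lemma last_prefix_of (T : Type) (gamma : nat -> T) n :
  last (gamma 0%N) (prefix_of gamma n) = gamma n.
Proof. by case: n => [|n] //; rewrite prefix_ofS last_rcons. Qed.

Lemma neighbours_root : neighbours rho d 0 (0, 1) = [:: 0].
Proof.
apply: lt_sorted_eq => //; first exact: neighbours_sorted.
move=> x; rewrite inE; apply/idP/eqP.
  case/mem_neighbours=> s [/size0nil-> _ ->].
  by rewrite /off /= expr0 invr1 mul1r subr0.
move=> ->; apply/mem_neighbours; exists [::]; rewrite /covers /off /=.
by rewrite expr0 invr1 mul1r subr0 add0r !lexx.
Qed.

(** The root has a single neighbour, so the product of the matrices from the root is a row vector,
    namely the vector of neighbour weights. *)
Lemma net_weight_path_norm (Delta : nat -> R * R) (gamma : nat -> charvec) n :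
  Delta 0%N \in F 0 ->
  (forall k, is_parent rho d k (Delta k) (Delta k.+1)) ->
  (forall k, gamma k = cv k (Delta k)) ->
  net_weight n (Delta n) = p0 ^+ n * path_norm rho d p (gamma 0%N) (prefix_of gamma n).
Proof.
move=> /net_intervals0 D0 PD gE.
have s0 : nsize (gamma 0%N) = 1%N by rewrite gE D0 -[nbs _]/(neighbours rho d 0 (0, 1)) neighbours_root.
have i0 : (0 < nsize (gamma 0%N))%N by rewrite s0.
have vE k : (k < nsize (gamma n))%N -> neighbour_weight n (Delta n) k =
    path_entry rho d p (gamma 0%N) (prefix_of gamma n) 0 k.
  elim: n k => [|n IH] k kn.
    have k0 : k = 0%N by move: kn; rewrite s0; case: k.
    rewrite k0 D0 /neighbour_weight neighbours_root /= big_cons big_nil.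
    rewrite /off /= mulr0 subr0 eqxx addr0 expr0 invr1 mul1r.
    by rewrite /word_weight big_nil.
  rewrite prefix_ofS path_entry_rcons // last_prefix_of.
  rewrite (neighbour_weight_step (PD n)) //; last by rewrite gE in kn.
  rewrite -!gE; have -> : neighbours rho d n (Delta n) = nbs (gamma n) by rewrite gE.
  by apply: eq_bigr => i _; rewrite IH.
rewrite net_weightE; congr (_ * _); rewrite /path_norm last_prefix_of.
have -> : neighbours rho d n (Delta n) = nbs (gamma n) by rewrite gE.
have -> : \sum_(i < nsize (gamma 0%N)) \sum_(j < nsize (gamma n))
     path_entry rho d p (gamma 0%N) (prefix_of gamma n) i j =
   \sum_(j < nsize (gamma n)) path_entry rho d p (gamma 0%N) (prefix_of gamma n) 0 j.
  by rewrite s0 big_ord1.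
by apply: eq_bigr => k _; rewrite vE.
Qed.

Lemma net_weight_gt0 n D : D \in F n -> 0 < net_weight n D.
Proof.
move=> DF; have [s sn cov] := covers_exists H DF.
rewrite /net_weight -big_filter (bigD1_seq s) /=; last first.
- exact/filter_uniq/words_uniq.
- by rewrite mem_filter cov mem_words sn eqxx.
rewrite ltr_wpDr ?word_weight_gt0 // sumr_ge0 // => t _.
exact/ltW/word_weight_gt0.
Qed.

End WordWeights.

Arguments word_weight {R m} p s.
Arguments net_weight {R m} rho d p n D.
Arguments neighbour_weight {R m} rho d p n D k.

(** * Words that touch a net interval only at an endpoint *)

Section Boundary.
Context {R : realType} {m : nat} {rho : R} {d : 'I_m.+1 -> R} {p : 'I_m.+1 -> R}.
Hypothesis H : tiling_ifs rho d.
Hypothesis Hp : minimal_end_weights p.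
Local Notation off := (off rho d).
Local Notation F := (net_intervals rho d).
Local Notation N := (net_points rho d).
Local Notation covers := (covers rho d).
Local Notation w := (word_weight p).
Local Notation p0 := (p ord0).
Let p0_gt0 : 0 < p0 := weight_gt0 Hp ord0.

(** A charging argument: each word of [T] is charged to a word of [C] with a label [l < n], and word
    and label together determine the charged word. A word of [C] is thus charged at most n times,
    the origin of the linear factor. *)
Lemma sum_weight_multiplicity n (T C : pred (seq 'I_m.+1))
    (r : nat -> rel (seq 'I_m.+1)) (c : R) : 0 <= c ->
  (forall s, size s = n -> T s ->
    exists l s', [/\ (l < n)%N, size s' = n, C s', r l s s' & w s <= c * w s']) ->
  (forall l s1 s2 s', size s1 = n -> size s2 = n -> T s1 -> T s2 ->
    r l s1 s' -> r l s2 s' -> s1 = s2) ->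
  \sum_(s <- words n | T s) w s <= c * n%:R * \sum_(s <- words n | C s) w s.
Proof.
move=> c0 ex un.
have w0 s : 0 <= w s by exact/ltW/(word_weight_gt0 Hp).
pose f s l s' := if r l s s' then c * w s' else 0.
have f0 s l s' : 0 <= f s l s' by rewrite /f; case: ifP => // _; rewrite mulr_ge0.
apply: (@le_trans _ _
    (\sum_(s <- words n | T s) \sum_(l < n) \sum_(s' <- words n | C s') f s l s')).
  rewrite big_seq_cond [leRHS]big_seq_cond; apply: ler_sum => s /andP[].
  rewrite mem_words => /eqP sn Ts; have [l [s' [ln sn' Cs' rl ws]]] := ex s sn Ts.
  apply: le_trans ws _; rewrite (bigD1 (Ordinal ln)) //= -big_filter.
  rewrite (bigD1_seq s') /=; last first.
  - exact/filter_uniq/words_uniq.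
  - by rewrite mem_filter Cs' mem_words sn' eqxx.
  rewrite {1}/f rl -addrA lerDl addr_ge0 // sumr_ge0 // => *.
  exact: sumr_ge0.
rewrite exchange_big /=; under eq_bigr => l _ do rewrite exchange_big /=.
apply: (@le_trans _ _ (\sum_(l < n) c * \sum_(s' <- words n | C s') w s')); last first.
  by rewrite sumr_const card_ord -[leLHS]mulr_natr mulrAC.
apply: ler_sum => l _.
rewrite mulr_sumr; apply: ler_sum => s' _; rewrite /f -big_mkcondr /=.
rewrite -big_filter; set L := seq.filter _ _.
have : {in L &, forall s1 s2, s1 = s2}.
  move=> s1 s2; rewrite !mem_filter !mem_words.
  move=> /andP[/andP[T1 r1] /eqP n1] /andP[/andP[T2 r2] /eqP n2].
  exact: un r1 r2.
have : uniq L by exact/filter_uniq/words_uniq.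
case: L => [|s1 [|s2 L]] /=; rewrite ?big_nil ?big_seq1 ?mulr_ge0 //.
move=> /andP[]; rewrite inE negb_or => /andP[/eqP ns _] _ eqL.
by case: ns; apply: eqL; rewrite !inE eqxx ?orbT.
Qed.

Lemma rcons_nseq (e : 'I_m.+1) k : rcons (nseq k e) e = nseq k.+1 e.
Proof. by elim: k => //= k ->. Qed.

Lemma strip_tail (e : 'I_m.+1) s : s <> nseq (size s) e ->
  exists t j k, s = rcons t j ++ nseq k e /\ j != e.
Proof.
elim/last_ind: s => [//|s j IH] ne.
have [je|je] := eqVneq j e; last by exists s, j, 0%N; rewrite cats0.
have [|t [j' [k [sE j'e]]]] := IH.
  by move=> sE; apply: ne; rewrite je size_rcons {1}sE rcons_nseq.
exists t, j', k.+1; split=> //.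
by rewrite sE je rcons_cat rcons_nseq.
Qed.

Lemma cat_rcons_tail (e : 'I_m.+1) l n s : size s = n -> (l < n)%N ->
  drop l.+1 s = nseq (n - l.+1) e ->
  s = rcons (take l s) (nth e s l) ++ nseq (n - l.+1) e.
Proof.
move=> sn ln ds; rewrite -{1}(cat_take_drop l s) (drop_nth e) ?sn //.
by rewrite ds cat_rcons.
Qed.

Lemma off_cat_nseq0 s k : off (s ++ nseq k ord0) = off s.
Proof.
elim: k => [|k IH]; first by rewrite cats0.
by rewrite -rcons_nseq -rcons_cat (off_rcons0 H).
Qed.

Lemma off_cat_nseq_max s k : off (s ++ nseq k ord_max) + rho ^+ (size s + k) =
  off s + rho ^+ size s.
Proof.
elim: k => [|k IH]; first by rewrite cats0 addn0.
have := off_rcons_max H (s ++ nseq k ord_max).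
by rewrite size_cat size_nseq IH rcons_cat rcons_nseq addnS.
Qed.

(** The midpoint of a gap between consecutive images would be covered by no map. *)
Lemma shift_step (i j : 'I_m.+1) : (i.+1 = j)%N -> d j <= d i + rho.
Proof.
move=> ij; rewrite leNgt; apply/negP => lt_ij.
have /andP[i0 _] := shift_bounds H i; have /andP[_ j1] := shift_bounds H j.
have r0 := ratio_gt0 H.
have [|l /andP[l1 l2]] := shift_cover H (x := (d j + (d i + rho)) / 2); first by lra.
have [li|il] := leqP l i; first by have := shift_le H li; lra.
by have := @shift_le _ _ _ _ H j l; rewrite -ij il => /(_ isT); lra.
Qed.

Lemma net_points_mono n k x : (n <= k)%N -> x \in N n -> x \in N k.
Proof.
by elim: k => [|k IH]; rewrite leq_eqVlt => /orP[/eqP->//|//] /IH h /h /(net_points_sub H).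
Qed.

Lemma word_cover_extend u k x : off u <= x <= off u + rho ^+ size u ->
  exists2 v, size v = k & off (u ++ v) <= x <= off (u ++ v) + rho ^+ (size u + k).
Proof.
move=> ux; elim: k => [|k [v vk uvx]].
  by exists [::]; rewrite ?cats0 ?addn0.
have [|j jx] := word_cover_split H (s := u ++ v) (x := x); first by rewrite size_cat vk.
exists (rcons v j); rewrite ?size_rcons ?vk // -rcons_cat addnS.
by move: jx; rewrite size_cat vk.
Qed.

(** The run of [e] has the least possible weight [p0 ^+ k], so any tail [v] of length k weighs at
    least as much. Exchanging [j] for [i] costs at most the factor [p0^-1]. *)
Lemma boundary_word_cover n D t (i j e : 'I_m.+1) k : D \in F n ->
  size (rcons t j ++ nseq k e) = n -> p e = p0 ->
  off (rcons t i) <= (D.1 + D.2) / 2 <= off (rcons t i) + rho ^+ (size t).+1 ->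
  exists2 s', [/\ size s' = n, covers n D s' & w (rcons t j ++ nseq k e) <= p0^-1 * w s'] &
    take (size t) s' = t.
Proof.
move=> DF sn pe ux; have [mid _] := net_interval_mid H DF.
have [|v vk uvx] := @word_cover_extend (rcons t i) k ((D.1 + D.2) / 2).
  by rewrite size_rcons.
have sn' : size (rcons t i ++ v) = n by move: sn; rewrite !size_cat !size_rcons size_nseq vk.
exists (rcons t i ++ v); last by rewrite cat_rcons take_size_cat.
split=> //.
  apply: covers_interior mid _ => //.
  by move: uvx; rewrite size_rcons -sn' size_cat size_rcons vk.
rewrite !word_weight_cat !word_weight_rcons.
have -> : w (nseq k e) = p0 ^+ k.
  by rewrite /word_weight big_nseq pe -Monoid.iteropE.
have wt := word_weight_gt0 Hp t; have wv := word_weight_ge Hp v.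
rewrite vk in wv; rewrite [leRHS]mulrC ler_pdivlMr // -!mulrA ler_pM2l //.
apply: (@le_trans _ _ (p0 ^+ k * p0)).
  by rewrite ger_pMl ?weight_le1 // mulr_gt0 // exprn_gt0.
rewrite mulrC; apply: ler_pM => //; [exact: ltW|exact/exprn_ge0/ltW|].
exact: (weight_min Hp).
Qed.

Lemma right_touching_weight n D : D \in F n ->
  \sum_(s <- words n | off s == D.2) w s <= p0^-1 * n%:R * net_weight rho d p n D.
Proof.
move=> DF; have /mem_net_intervals[D1 D2 lt12 DN] := DF.
have /andP[D1_ge0 _] := net_points_bounds H D1.
have [mid _] := net_interval_mid H DF.
(* The label [l] is the length of the part [t] before the changed letter. From [l] and [s'] one
   reads [t] and the final run; the letter in between follows from [off s = D.2]. *)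
apply: (sum_weight_multiplicity (r := fun l s s' => (take l s == take l s') &&
    (drop l.+1 s == nseq (n - l.+1) ord0))); first by rewrite invr_ge0 ltW.
- move=> s sn /eqP sD.
  (* The word made of [ord0] only has offset 0, which is at most [D.1] and so differs from [D.2]. *)
  have [|t [j [k [sE j0]]]] := @strip_tail ord0 s.
    move=> sE; move: lt12; rewrite -sD sE -[nseq _ _]cat0s off_cat_nseq0 /off /=.
    by rewrite ltNge D1_ge0.
  have jN : (0 < j)%N by rewrite lt0n; apply: contra j0 => /eqP jv; apply/eqP/val_inj.
  have iN : (j.-1 < m.+1)%N by rewrite prednK // ltnW.
  pose i : 'I_m.+1 := Ordinal iN.
  have ij : (i.+1 = j)%N by rewrite /= prednK.
  have offj : off (rcons t j) = D.2 by rewrite -sD sE off_cat_nseq0.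
  have tp := ratioX_gt0 H (size t).
  have offi : off (rcons t i) < D.2.
    by rewrite -offj !off_rcons ltrD2l ltr_pM2l // (shift_incr H) // -ij.
  have offi2 : D.2 <= off (rcons t i) + rho ^+ (size t).+1.
    by rewrite -offj !off_rcons exprSr -addrA -mulrDr lerD2l ler_pM2l // shift_step.
  have st : (size t < n)%N by rewrite -sn sE size_cat size_rcons addSn ltnS leq_addr.
  (* The image of [t i] starts strictly left of [D.2] and, having no gap to the next image, reaches
     [D.2]. Its left end is a net point of level n, hence at most [D.1], so the image contains the
     midpoint of [D]. *)
  have : off (rcons t i) \in N n.
    apply: (net_points_mono st); apply/mem_net_points; exists (rcons t i).
      by rewrite size_rcons.
    by left.
  move/DN => offi1.
  have [|||s' [sn' cov ws] ts'] := @boundary_word_cover n D t i j ord0 k DF.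
  - by rewrite -sE.
  - by [].
  - by case: offi1; lra.
  exists (size t), s'; split=> //; last by rewrite sE.
  rewrite ts' sE cat_rcons take_size_cat // eqxx /=.
  rewrite -cat_rcons drop_size_cat ?size_rcons //.
  by rewrite -sn sE size_cat size_rcons size_nseq addnC addnK.
- move=> l s1 s2 s' n1 n2 /eqP e1 /eqP e2 /andP[/eqP t1 /eqP d1] /andP[/eqP t2 /eqP d2].
  have [ln|nl] := ltnP l n; last first.
    by rewrite -[s1](take_oversize (n := l)) ?n1 // t1 -t2 take_oversize // n2.
  have sE1 := cat_rcons_tail n1 ln d1; have sE2 := cat_rcons_tail n2 ln d2.
  rewrite t1 in sE1; rewrite t2 in sE2.
  move: (nth _ s1 l) (nth _ s2 l) sE1 sE2 => j1 j2 sE1 sE2.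
  rewrite sE1 sE2; congr (rcons _ _ ++ _).
  apply: (shift_inj H); move: e1; rewrite -e2 sE1 sE2.
  rewrite !off_cat_nseq0 !off_rcons => /addrI/mulfI; apply.
  exact/lt0r_neq0/(ratioX_gt0 H).
Qed.

(** The mirror image: the run consists of [ord_max], of least weight because [p_m = p_0], and the
    letter before it is raised by one. *)
Lemma left_touching_weight n D : D \in F n ->
  \sum_(s <- words n | off s + rho ^+ n == D.1) w s <= p0^-1 * n%:R * net_weight rho d p n D.
Proof.
move=> DF; have /mem_net_intervals[D1 D2 lt12 DN] := DF.
have /andP[_ D2_le1] := net_points_bounds H D2.
have [mid _] := net_interval_mid H DF.
have offE t j k : size (rcons t j ++ nseq k ord_max) = n ->
    off (rcons t j ++ nseq k ord_max) + rho ^+ n = off (rcons t j) + rho ^+ (size t).+1.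
  move=> sn; rewrite -sn size_cat size_nseq off_cat_nseq_max size_rcons.
  by [].
apply: (sum_weight_multiplicity (r := fun l s s' => (take l s == take l s') &&
    (drop l.+1 s == nseq (n - l.+1) ord_max))); first by rewrite invr_ge0 ltW.
- move=> s sn /eqP sD.
  have [|t [j [k [sE j0]]]] := @strip_tail ord_max s.
    move=> sE; move: lt12; rewrite -sD -sn {1}sE -[nseq _ _]cat0s -[size s]add0n.
    rewrite (off_cat_nseq_max [::]) /off /= add0r expr0.
    by rewrite ltNge D2_le1.
  have jN : (j.+1 < m.+1)%N.
    rewrite ltnS ltn_neqAle -ltnS ltn_ord andbT.
    by apply: contra j0 => /eqP jv; apply/eqP/val_inj.
  pose i : 'I_m.+1 := Ordinal jN.
  have snE : size (rcons t j ++ nseq k ord_max) = n by rewrite -sE.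
  have offj : off (rcons t j) + rho ^+ (size t).+1 = D.1.
    by rewrite -(offE _ _ _ snE) -sE.
  have tp := ratioX_gt0 H (size t).
  have offi : off (rcons t i) <= D.1.
    rewrite -offj !off_rcons exprSr -addrA -mulrDr lerD2l ler_pM2l //.
    exact: shift_step.
  have offi2 : D.1 < off (rcons t i) + rho ^+ (size t).+1.
    by rewrite -offj ltrD2r !off_rcons ltrD2l ltr_pM2l // (shift_incr H).
  have st : (size t < n)%N by rewrite -sn sE size_cat size_rcons addSn ltnS leq_addr.
  have : off (rcons t i) + rho ^+ (size t).+1 \in N n.
    apply: (net_points_mono st); apply/mem_net_points; exists (rcons t i).
      by rewrite size_rcons.
    by right.
  move/DN => offi1.
  have [||s' [sn' cov ws] ts'] := @boundary_word_cover n D t i j ord_max k DF snE.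
  - by rewrite -(weight_ends Hp).
  - by case: offi1; lra.
  exists (size t), s'; split=> //; last by rewrite sE.
  rewrite ts' sE cat_rcons take_size_cat // eqxx /=.
  rewrite -cat_rcons drop_size_cat ?size_rcons //.
  by rewrite -sn sE size_cat size_rcons size_nseq addnC addnK.
- move=> l s1 s2 s' n1 n2 /eqP e1 /eqP e2 /andP[/eqP t1 /eqP d1] /andP[/eqP t2 /eqP d2].
  have [ln|nl] := ltnP l n; last first.
    by rewrite -[s1](take_oversize (n := l)) ?n1 // t1 -t2 take_oversize // n2.
  have sE1 := cat_rcons_tail n1 ln d1; have sE2 := cat_rcons_tail n2 ln d2.
  rewrite t1 in sE1; rewrite t2 in sE2.
  move: (nth _ s1 l) (nth _ s2 l) sE1 sE2 => j1 j2 sE1 sE2.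
  rewrite sE1 sE2; congr (rcons _ _ ++ _).
  apply: (shift_inj H); move: e1; rewrite -e2 sE1 sE2.
  rewrite offE -?sE1 // offE -?sE2 // => /addIr.
  rewrite !off_rcons => /addrI/mulfI; apply.
  exact/lt0r_neq0/(ratioX_gt0 H).
Qed.

End Boundary.

(** * The measure of balls *)

Section SupportNull.
Context {R : realType}.
Variable mu : probability (measurableTypeR R) R.

(* Countably many null intervals with rational endpoints exhaust the
   complement of the support. *)
Lemma setC_msupport_negligible : mu.-negligible (~` msupport mu).
Proof.
pose J (q : rat * rat) : set R := `]ratr q.1, ratr q.2[%classic.
pose G (n : nat) : set R :=
  if unpickle n is Some q then (if mu (J q) == 0%E then J q else set0) else set0.
apply: (@negligibleS _ _ _ mu (\bigcup_n G n)); last first.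
  apply: negligible_bigcup => n; rewrite /G; case: unpickle => [q|]; last exact: negligible_set0.
  case: ifPn => [/eqP q0|_]; last exact: negligible_set0.
  by apply/negligibleP => //; exact: measurable_itv.
move=> x /= /existsNP[U /not_implyP[Uo /not_implyP[Ux /negP]]].
rewrite -leNgt => U0.
have [e /= e0 eU] := (nbhs_ballP x U).1 (open_nbhs_nbhs (conj Uo Ux)).
have [q1 q1x] : exists q, ratr q \in `]x - e, x[%R.
  by apply: rat_in_itvoo; rewrite ltrBlDr ltrDl.
have [q2 q2x] : exists q, ratr q \in `]x, x + e[%R.
  by apply: rat_in_itvoo; rewrite ltrDl.
move: q1x q2x; rewrite !in_itv /= => /andP[q1a q1b] /andP[q2a q2b].
have := pickleK (q1, q2); move: (pickle _) => k kE.
exists k; first exact: I.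
rewrite /G kE.
have JU : J (q1, q2) `<=` U.
  rewrite ball_itv in eU; apply: subset_trans eU => y.
  by rewrite /J /= !in_itv /= => /andP[y1 y2]; apply/andP; split; lra.
have J0 : mu (J (q1, q2)) = 0%E.
  apply/eqP; rewrite eq_le measure_ge0 andbT; apply: le_trans U0.
  apply: le_measure => //; rewrite inE; last exact: open_measurable.
  exact: measurable_itv.
by rewrite J0 eqxx /J /= in_itv /=; apply/andP; split; lra.
Qed.

End SupportNull.

(** * Iterated self-similarity, and the tiling drawn from the support *)

Section SelfSimilar.
Context {R : realType} {m : nat} {rho : R} {d : 'I_m.+1 -> R} {p : 'I_m.+1 -> R}.
Variable mu : probability (measurableTypeR R) R.
Hypothesis rho_gt0 : 0 < rho.
Hypothesis Hp : minimal_end_weights p.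
Hypothesis mu_self_similar : self_similar rho d p mu.

Let nu (A : set R) : R := fine (mu A).

Lemma prob_fineE (A : set R) : measurable A -> mu A = (nu A)%:E.
Proof. by move=> mA; rewrite fineK // fin_num_measure. Qed.

Lemma prob_fine_ge0 (A : set R) : 0 <= nu A.
Proof. exact: fine_ge0. Qed.

Lemma prob_fine_le (A B : set R) : measurable A -> measurable B -> A `<=` B -> nu A <= nu B.
Proof.
move=> mA mB AB; rewrite -lee_fin -!prob_fineE //.
by apply: le_measure; rewrite ?inE.
Qed.

Lemma prob_fine_le1 (A : set R) : measurable A -> nu A <= 1.
Proof.
by move=> mA; rewrite -lee_fin -prob_fineE // probability_le1.
Qed.

Lemma simil_word_continuous s : continuous (simil_word rho d s).
Proof.
move=> x; rewrite (_ : simil_word rho d s = fun x => rho ^+ size s * x + off rho d s).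
  by apply: cvgD; [apply: cvgM; [exact: cvg_cst|exact: cvg_id]|exact: cvg_cst].
by apply/funext => y; rewrite simil_wordE.
Qed.

Lemma simil_word_measurable s (A : set R) : measurable A ->
  measurable (simil_word rho d s @^-1` A).
Proof.
move=> mA; rewrite -[X in measurable X]setTI.
exact: (continuous_measurable_fun (simil_word_continuous (s := s))).
Qed.

Lemma prob_word_sum n (A : set R) : measurable A ->
  nu A = \sum_(s <- words n) word_weight p s * nu (simil_word rho d s @^-1` A).
Proof.
move=> mA; elim: n => [|n IH].
  by rewrite big_seq1 /word_weight big_nil mul1r.
rewrite big_words_S IH; apply: eq_bigr => s _.
have mB := simil_word_measurable s mA; set B := _ @^-1` A in mB *.
have -> : nu B = \sum_j p j * nu (simil rho d j @^-1` B).
  apply: EFin_inj; rewrite -prob_fineE // mu_self_similar // -sumEFin.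
  apply: eq_bigr => j _; rewrite EFinM -prob_fineE //.
  exact: (@simil_word_measurable [:: j]).
rewrite mulr_sumr; apply: eq_bigr => j _; rewrite word_weight_rcons mulrA.
congr (_ * nu _); apply/funext => y.
by rewrite /B /preimage /mkset /= simil_word_rcons.
Qed.

Hypothesis d_incr : forall i j : 'I_m.+1, (i < j)%N -> d i < d j.
Hypothesis rho_lt1 : rho < 1.
Hypothesis mu_support : msupport mu = `[0, 1]%classic.

Lemma prob_setC01 (A : set R) : measurable A -> A `&` `[0, 1] = set0 -> nu A = 0.
Proof.
move=> mA A01; rewrite /nu; suff -> : mu A = 0%E by [].
apply/negligibleP => //; apply: negligibleS (setC_msupport_negligible mu).
by rewrite mu_support; exact/disjoints_subset.
Qed.

Lemma prob_open_gt0 (U : set R) x : open U -> U x -> 0 <= x <= 1 -> 0 < nu U.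
Proof.
move=> Uo Ux x01; have mU : measurable U by exact: open_measurable.
rewrite -lte_fin -prob_fineE //; have : msupport mu x by rewrite mu_support /= in_itv.
by apply.
Qed.

Lemma prob_step (A : set R) : measurable A ->
  nu A = \sum_j p j * nu (simil rho d j @^-1` A).
Proof.
move=> mA; rewrite (prob_word_sum 1 mA) big_words_S big_seq1.
by apply: eq_bigr => j _; rewrite /word_weight big_seq1.
Qed.

(** Each map sends the support into itself, since a neighbourhood of [S_j y] has mass at least [p_j]
    times that of its preimage; this bounds the shifts. Conversely the complement of the union of
    the images is open and null, so it contains no point of [0, 1]. Covering 0 and 1 fixes the
    extreme shifts. *)
Lemma tiling_of_support : tiling_ifs rho d.
Proof.
have similC j : continuous (simil rho d j) := @simil_word_continuous [:: j].
have in01 j y : 0 <= y <= 1 -> 0 <= simil rho d j y <= 1.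
  move=> y01; suff : msupport mu (simil rho d j y) by rewrite mu_support /= in_itv.
  move=> U Uo Ux; have mU : measurable U by exact: open_measurable.
  rewrite prob_fineE // lte_fin prob_step // (bigD1 j) //=.
  rewrite ltr_wpDr ?sumr_ge0 // => [i _|].
    by rewrite mulr_ge0 ?prob_fine_ge0 // ltW // (weight_gt0 Hp).
  rewrite mulr_gt0 ?(weight_gt0 Hp) //; apply: (@prob_open_gt0 _ y) => //.
  by apply: open_comp => // z _; exact: similC.
have d_ge0 j : 0 <= d j.
  by have /andP[] := in01 j 0 (ltac:(by rewrite lexx ler01)); rewrite /simil mulr0 add0r.
have d_le j : d j <= 1 - rho.
  have /andP[_] := in01 j 1 (ltac:(by rewrite lexx ler01)).
  by rewrite /simil mulr1; lra.
have cov x : 0 <= x <= 1 -> exists j, d j <= x <= d j + rho.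
  move=> x01; apply: contrapT => nx.
  pose U : set R := ~` \bigcup_(j in [set: 'I_m.+1]) `[d j, d j + rho]%classic.
  have Uo : open U.
    apply: closed_openC; apply: closed_bigcup; first exact: finite_finset.
    by move=> j _; exact: interval_closed.
  have Ux : U x by move=> [j _ /=]; rewrite in_itv /= => jx; apply: nx; exists j.
  have mU : measurable U by exact: open_measurable.
  have := prob_open_gt0 Uo Ux x01; rewrite prob_step //.
  rewrite big1 ?ltxx // => j _; rewrite (@prob_setC01 (_ @^-1` U)) ?mulr0 //.
    apply: open_measurable; apply: open_comp => // z _; exact: similC.
  rewrite -subset0 => y [/= Uy]; rewrite in_itv /= => /andP[y0 y1]; apply: Uy.
  exists j => //=; rewrite in_itv /= /simil lerDr mulr_ge0 ?(ltW rho_gt0) //=.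
  by rewrite addrC lerD2l ger_pMr.
have d_mono (i j : 'I_m.+1) : (i <= j)%N -> d i <= d j.
  by rewrite leq_eqVlt => /orP[/eqP/val_inj->//|/d_incr/ltW].
split=> //.
  have [|j /andP[j0 _]] := cov 0; first by rewrite lexx ler01.
  by apply/eqP; rewrite eq_le d_ge0 andbT (le_trans _ j0) // d_mono.
have [|j /andP[_ j1]] := cov 1; first by rewrite lexx ler01.
apply/eqP; rewrite eq_le d_le /=; apply: (@le_trans _ _ (d j)); first by lra.
by apply: d_mono; rewrite -ltnS ltn_ord.
Qed.

End SelfSimilar.

Section BallMeasure.
Context {R : realType} {m : nat} {rho : R} {d : 'I_m.+1 -> R} {p : 'I_m.+1 -> R}.
Variable mu : probability (measurableTypeR R) R.
Hypothesis H : tiling_ifs rho d.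
Hypothesis FT : finite_type rho d.
Hypothesis Hp : minimal_end_weights p.
Hypothesis mu_self_similar : self_similar rho d p mu.
Hypothesis mu_support : msupport mu = `[0, 1]%classic.
Local Notation off := (off rho d).
Local Notation F := (net_intervals rho d).
Local Notation N := (net_points rho d).
Local Notation covers := (covers rho d).
Local Notation p0 := (p ord0).
Let nu (A : set R) : R := fine (mu A).
Let p0_gt0 : 0 < p0 := weight_gt0 Hp ord0.

Lemma pos_lower_bound (T : eqType) (L : seq T) (f : T -> R) :
  exists2 kappa, 0 < kappa & forall c, c \in L -> 0 < f c -> kappa <= f c.
Proof.
elim: L => [|c L [k k0 kL]]; first by exists 1.
have [fc|fc] := ltP 0 (f c).
  exists (Num.min k (f c)); first by rewrite lt_min k0.
  move=> c'; rewrite inE => /orP[/eqP->|/kL h /h]; rewrite ge_min ?lexx ?orbT //.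
  by move=> ->.
exists k => // c'; rewrite inE => /orP[/eqP->|/kL//].
by rewrite ltNge fc.
Qed.

Lemma net_point_gap : exists2 delta, 0 < delta &
  forall n u v, u \in N n -> v \in N n -> u < v -> delta * rho ^+ n <= v - u.
Proof.
have [L LP] := finite_cores H FT.
have [k k0 kL] := pos_lower_bound L fst.
exists k => // n u v uN vN uv; have rn := ratioX_gt0 H n.
have [E [EF E1 E2]] := zip_behead_cover (net_points_sorted rho d n) uN vN (lexx _) uv.
have /mem_net_intervals[_ _ E12 EN] := EF.
have Eu : E.1 = u.
  by apply/eqP; rewrite eq_le E1; have [//|h] := EN _ uN; lra.
have Ev : E.2 <= v by have [h|//] := EN _ vN; lra.
apply: (@le_trans _ _ (E.2 - E.1)); last by lra.
rewrite -ler_pdivlMr // mulrC; apply: kL (LP _ _ EF) _.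
by rewrite mulr_gt0 ?invr_gt0 // subr_gt0.
Qed.

(** The interval is the preimage of [D] under a covering word. It depends only on the core, so
    finitely many occur, each with interior points in the support. *)
Lemma covering_image_lower_bound : exists2 kappa, 0 < kappa &
  forall n D a, D \in F n -> a \in neighbours rho d n D ->
    kappa <= nu `[a, a + norm_length rho n D]%classic.
Proof.
have [L LP] := finite_cores H FT.
have [k k0 kL] := pos_lower_bound (flatten [seq [seq (a, c.1) | a <- c.2] | c <- L])
  (fun c => nu `[c.1, c.1 + c.2]%classic).
exists k => // n D a DF aV; apply: (kL (a, norm_length rho n D)).
  by apply/flatten_mapP; exists (char_vector rho d n D).1; [exact: LP|exact: map_f].
have D12 := net_interval_lt DF.
have rn := ratioX_gt0 H n.
case/mem_neighbours: (aV) => s [sn /andP[s1 s2] aE].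
have a0 : 0 <= a by rewrite aE mulr_ge0 ?invr_ge0 ?(ltW rn) // subr_ge0.
have l0 : 0 < norm_length rho n D by rewrite mulr_gt0 ?invr_gt0 // subr_gt0.
have al1 : a + norm_length rho n D <= 1.
  by rewrite aE /norm_length -mulrDr mulrC ler_pdivrMr // mul1r; lra.
apply: (@lt_le_trans _ _ (nu `]a, a + norm_length rho n D[%classic)).
  apply: (prob_open_gt0 mu_support (x := a + norm_length rho n D / 2)).
  - exact: interval_open.
  - by rewrite /= in_itv /=; apply/andP; split; lra.
  - by apply/andP; split; lra.
apply: prob_fine_le; try exact: measurable_itv.
move=> x /=; rewrite !in_itv /= => /andP[x1 x2]; by rewrite !ltW.
Qed.

(** A net interval of level n is no longer than [rho ^+ n], so the ball contains [D]; each covering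
    word contributes its weight times the mass of its preimage of [D]. *)
Lemma ball_lower_bound : exists2 kappa, 0 < kappa &
  forall n D x r, D \in F n -> D.1 <= x <= D.2 -> rho ^+ n <= r ->
    kappa * net_weight rho d p n D <= nu `[x - r, x + r]%classic.
Proof.
have [k k0 kP] := covering_image_lower_bound; exists k => // n D x r DF /andP[x1 x2] rr.
have rn := ratioX_gt0 H n.
rewrite /nu (prob_word_sum mu_self_similar n (measurable_itv _)) /net_weight mulr_sumr.
rewrite big_mkcond /= big_seq [leRHS]big_seq; apply: ler_sum => s.
rewrite mem_words => /eqP sn; have w0 := word_weight_gt0 Hp s.
case: ifPn => [cov|_]; last by rewrite mulr_ge0 ?(ltW w0) // prob_fine_ge0.
rewrite mulrC ler_pM2l //; have /andP[c1 c2] := cov.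
apply: le_trans (kP n D (rho ^- n * (D.1 - off s)) DF _) _.
  by apply/mem_neighbours; exists s.
apply: prob_fine_le; first exact: measurable_itv.
  by apply: simil_word_measurable; exact: measurable_itv.
move=> y /=; rewrite !in_itv /= /norm_length -mulrDr => /andP[].
rewrite mulrC ler_pdivrMr // [_ * (_ + _)]mulrC ler_pdivlMr // => y1 y2.
by rewrite simil_wordE sn; apply/andP; split; lra.
Qed.

(** With a radius below the minimal gap, a word either covers [D], touches it at an end, or has an
    image that misses the ball. In the constant, 1 stands for the covering words and [2 * p0^-1] for
    the two touching families. *)
Lemma ball_upper_bound : exists delta, [/\ 0 < delta, delta <= 1 &
  forall n D x r, D \in F n -> D.1 <= x <= D.2 -> r < delta * rho ^+ n ->
    nu `[x - r, x + r]%classic <=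
      (1 + 2 * p0^-1) * n.+1%:R * net_weight rho d p n D].
Proof.
have [k0 k00 k0P] := net_point_gap.
have [delta [del0 del1 kP]] : exists delta, [/\ 0 < delta, delta <= 1 &
    forall n u v, u \in N n -> v \in N n -> u < v -> delta * rho ^+ n <= v - u].
  exists (Num.min k0 1); split; rewrite ?lt_min ?k00 ?ltr01 ?ge_min ?lexx ?orbT //.
  move=> n u v uN vN uv; apply: le_trans (k0P n u v uN vN uv).
  by rewrite ler_pM2r ?(ratioX_gt0 H) // ge_min lexx.
exists delta; split=> // n D x r DF /andP[x1 x2] rr.
have rn := ratioX_gt0 H n.
have /mem_net_intervals[D1 D2 D12 DN] := DF.
rewrite /nu (prob_word_sum mu_self_similar n (measurable_itv _)).
set B := `[_, _]%classic.
have mB : measurable B by exact: measurable_itv.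
have w0 s : 0 <= word_weight p s by exact/ltW/(word_weight_gt0 Hp).
apply: (@le_trans _ _ (net_weight rho d p n D +
    (\sum_(s <- words n | off s == D.2) word_weight p s +
     \sum_(s <- words n | off s + rho ^+ n == D.1) word_weight p s))).
  have mk P : \sum_(s <- words n | P s) word_weight p s =
      \sum_(s <- words n) if P s then word_weight p s else 0 by rewrite big_mkcond.
  rewrite /net_weight (mk (covers n D)) (mk (fun s => off s == D.2)).
  rewrite (mk (fun s => off s + rho ^+ n == D.1)) -!big_split.
  rewrite big_seq [leRHS]big_seq; apply: ler_sum => s; rewrite mem_words => /eqP sn.
  change (word_weight p s * fine (mu (simil_word rho d s @^-1` B)) <=
    (if covers n D s then word_weight p s else 0) +
    ((if off s == D.2 then word_weight p s else 0) +
     (if off s + rho ^+ n == D.1 then word_weight p s else 0))).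
  have le_w : word_weight p s * fine (mu (simil_word rho d s @^-1` B)) <= word_weight p s.
    by rewrite ler_piMr // prob_fine_le1 //; exact: simil_word_measurable.
  (* If the image of [0, 1] misses the ball, the preimage of the ball misses the support. *)
  have far : (forall y, 0 <= y <= 1 -> ~ B (rho ^+ n * y + off s)) ->
      word_weight p s * fine (mu (simil_word rho d s @^-1` B)) = 0.
    move=> h; rewrite (prob_setC01 mu_support) ?mulr0 //.
      exact: simil_word_measurable.
    rewrite -subset0 => y [/=]; rewrite simil_wordE sn => By.
    by rewrite in_itv /= => y01; exact: (h y).
  have ite (b : bool) : 0 <= if b then word_weight p s else 0 by case: b.
  have [cov|Ds|sD] := covers_trichotomy DF sn.
  - by rewrite cov (le_trans le_w) // lerDl addr_ge0.
  - have [e|ne] := eqVneq (off s) D.2.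
      by apply: (le_trans le_w); rewrite addrCA lerDl addr_ge0.
    rewrite far ?addr_ge0 // => y /andP[y0 y1]; rewrite /B /= in_itv /=.
    have sN : off s \in N n by apply/mem_net_points; exists s; auto.
    have lt_s : D.2 < off s by rewrite lt_neqAle eq_sym ne.
    have := kP _ _ _ D2 sN lt_s; have ry : 0 <= rho ^+ n * y by rewrite mulr_ge0 // ltW.
    by move=> ?; apply/negP; rewrite negb_and -!ltNge; apply/orP; right; lra.
  - have [e|ne] := eqVneq (off s + rho ^+ n) D.1.
      by apply: (le_trans le_w); rewrite addrA lerDr addr_ge0.
    rewrite far ?addr_ge0 // => y /andP[y0 y1]; rewrite /B /= in_itv /=.
    have sN : off s + rho ^+ n \in N n by apply/mem_net_points; exists s; auto.
    have lt_s : off s + rho ^+ n < D.1 by rewrite lt_neqAle ne.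
    have ry : rho ^+ n * y <= rho ^+ n * 1 by rewrite ler_pM2l.
    have := kP _ _ _ sN D1 lt_s; rewrite mulr1 in ry.
    by move=> ?; apply/negP; rewrite negb_and -!ltNge; apply/orP; left; lra.
have lt_ := right_touching_weight H Hp DF; have rt_ := left_touching_weight H Hp DF.
have W0 : 0 <= net_weight rho d p n D by exact: sumr_ge0.
apply: le_trans (lerD (lexx _) (lerD lt_ rt_)) _.
set W := net_weight rho d p n D in W0 *.
have n0 : 0 <= n%:R :> R by exact: ler0n.
have pW : 0 <= p0^-1 * W by rewrite mulr_ge0 // invr_ge0 ltW.
have nW : 0 <= n%:R * W by rewrite mulr_ge0.
rewrite -natr1; lra.
Qed.

End BallMeasure.

(** * Local dimension as a growth rate *)

Section LogSandwich.
Context {R : realType}.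

(** Convergence of [a n / n] to [t], written without division. *)
Definition avg_cvg (a : nat -> R) (t : R) : Prop :=
  forall e, 0 < e -> exists N, forall n, (N <= n)%N -> `|a n - t * n%:R| <= e * n%:R.

Lemma archi_nat (x : R) : exists N, forall n, (N <= n)%N -> x <= n%:R.
Proof.
exists (Num.Def.archi_bound `|x|) => n Nn; apply: le_trans (ler_norm x) _.
by apply: le_trans (ltW (archi_boundP (normr_ge0 x))) _; rewrite ler_nat.
Qed.

Lemma archi_lin (A e : R) : 0 < e -> exists N, forall n, (N <= n)%N -> A <= e * n%:R.
Proof.
move=> e0; have [N NP] := archi_nat (A / e); exists N => n /NP.
by rewrite ler_pdivrMr // mulrC.
Qed.

Lemma ln_le_lin (A e : R) : 0 < e ->
  exists N, forall n, (N <= n)%N -> A + ln n.+1%:R <= e * n%:R.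
Proof.
move=> e0; have e20 : 0 < e / 2 by rewrite divr_gt0.
have [N NP] := archi_lin (A + e / 2 - 1 - ln (e / 2)) e20.
exists N => n /NP An.
have y0 : 0 < e / 2 * n.+1%:R by rewrite mulr_gt0 // ltr0n.
(* The bound [ln y <= y - 1] at [y = (e / 2) * (n + 1)]: the slope becomes [e / 2], and the rest is
   constant. *)
have := @le_ln1Dx R (e / 2 * n.+1%:R - 1); rewrite [1 + _]addrC subrK.
move=> /(_ (ltac:(by rewrite ltrBrDl subrr))).
have E : e / 2 * n.+1%:R = e / 2 * n%:R + e / 2 by rewrite -natr1; ring.
rewrite lnM ?posrE ?ltr0n // E; lra.
Qed.

Lemma exprn_lt_eventually (rho e : R) : 0 < rho -> rho < 1 -> 0 < e ->
  exists N, forall n, (N <= n)%N -> rho ^+ n < e.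
Proof.
move=> r0 r1 e0; have : `|rho| < 1 by rewrite gtr0_norm.
move=> /cvg_expr/cvgrPdist_lt/(_ _ e0)[N _ NP]; exists N => n Nn.
have := NP n Nn; rewrite /= sub0r normrN gtr0_norm //.
exact: exprn_gt0.
Qed.

Lemma exprn_scale (rho r : R) : 0 < rho -> rho < 1 -> 0 < r -> r < 1 ->
  exists n, rho ^+ n.+1 <= r < rho ^+ n.
Proof.
move=> rho0 rho1 r0 r1.
have ex : exists n, rho ^+ n <= r.
  by have [N /(_ N (leqnn N)) h] := exprn_lt_eventually rho0 rho1 r0; exists N; exact: ltW.
case: (ex_minnP ex) => -[|n] nr nmin; first by rewrite expr0 leNgt r1 in nr.
by exists n; rewrite nr /= ltNge; apply/negP => /nmin; rewrite ltnn.
Qed.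

Lemma lnX_natr (rho : R) n : 0 < rho -> ln (rho ^+ n) = n%:R * ln rho.
Proof. by move=> r0; rewrite lnXn // mulr_natl. Qed.

(** Here [f r] is the logarithm of the mass of the ball and [Phi n] that of the weight at level n.
    For r of order [rho ^+ n] they differ by [O(1 + ln n)], negligible against [ln r], which is of
    order n. *)
Lemma log_sandwich (rho c1 c2 c3 delta : R) (f : R -> R) (Phi : nat -> R) (t : R) :
  0 < rho -> rho < 1 -> 0 < delta ->
  (forall n r, rho ^+ n <= r -> c1 + Phi n <= f r) ->
  (forall n r, 0 < r -> r < delta * rho ^+ n -> f r <= c2 + ln n.+1%:R + Phi n) ->
  (forall n, `|Phi n.+1 - Phi n| <= c3) ->
  (forall e, 0 < e -> exists2 eta, 0 < eta &
     forall r, 0 < r -> r < eta -> `|t - f r / ln r| <= e) <->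
  avg_cvg (fun n => Phi n / ln rho) t.
Proof.
move=> rho0 rho1 del0 low up lip.
have lam0 : ln rho < 0 by rewrite ln_lt0 // rho0.
have [lam lamp rhoE] : exists2 lam, 0 < lam & ln rho = - lam.
  by exists (- ln rho); rewrite ?oppr_gt0 ?opprK.
have c30 : 0 <= c3 by apply: le_trans (normr_ge0 _) (lip 0%N).
(* Going back k levels absorbs [delta] in the upper bound; by the Lipschitz bound the shift changes
   [Phi] by a constant only. *)
have [k /(_ k (leqnn k)) kP] := exprn_lt_eventually rho0 rho1 del0.
have lipk j n : `|Phi (n + j)%N - Phi n| <= j%:R * c3.
  elim: j => [|j IH]; first by rewrite addn0 subrr normr0 mul0r.
  rewrite addnS -natr1 mulrDl mul1r -[_ - _](subrKA (Phi (n + j)%N)) addrC.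
  by apply: le_trans (ler_normD _ _) _; rewrite lerD.
have near e : 0 < e -> exists N, forall n r, (N <= n)%N ->
    rho ^+ n.+1 <= r < rho ^+ n -> `|f r - Phi n.+1| <= e * n%:R.
  move=> e0; have [N NP] := ln_le_lin (`|c1| + `|c2| + k.+1%:R * c3) e0.
  exists (N + k)%N => n r Nn /andP[rl ru].
  have kn : (k <= n)%N by rewrite (leq_trans _ Nn) // leq_addl.
  have lnr := NP n (leq_trans (leq_addr _ _) Nn).
  have r0 : 0 < r by rewrite (lt_le_trans _ rl) ?exprn_gt0.
  have h1 := low _ _ rl.
  have h2 : f r <= c2 + ln (n - k).+1%:R + Phi (n - k)%N.
    apply: up => //; apply: lt_le_trans ru _; rewrite -{1}(subnK kn) exprD mulrC.
    by rewrite ler_pM2r ?exprn_gt0 // ltW.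
  have h3 : `|Phi n.+1 - Phi (n - k)%N| <= k.+1%:R * c3.
    by rewrite -{1}(subnK kn) -addnS lipk.
  have h4 : ln (n - k).+1%:R <= ln n.+1%:R :> R.
    by rewrite ler_ln ?posrE ?ltr0n // ler_nat ltnS leq_subr.
  have := ler_norm c2; have := lerNnormlW (lexx `|c1|) => g1 g2.
  have k3 : 0 <= k.+1%:R * c3 by rewrite mulr_ge0.
  have l0 : 0 <= ln n.+1%:R :> R by rewrite ln_ge0 // ler1n.
  have := normr_ge0 c1; have := normr_ge0 c2 => g3 g4.
  move: h3; rewrite !ler_norml => /andP[h3 h3']; apply/andP; split; lra.
have scale n r : rho ^+ n.+1 <= r < rho ^+ n ->
    - (n.+1%:R * lam) <= ln r /\ ln r <= - (n%:R * lam).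
  move=> /andP[rl ru]; have r0 : 0 < r by rewrite (lt_le_trans _ rl) ?exprn_gt0.
  rewrite -!mulrN -rhoE -!lnX_natr // !ler_ln ?posrE ?exprn_gt0 //; split=> //.
  exact: ltW.
split=> [lim|avg] e e0.
- pose e1 := e * lam / (2 * (1 + lam)).
  have e10 : 0 < e1 by rewrite divr_gt0 ?mulr_gt0 // addr_gt0.
  have e1E : e1 * (2 * (1 + lam)) = e * lam by rewrite divfK // mulf_neq0 // ?gt_eqF // addr_gt0.
  have [N1 N1P] := near _ e10.
  have [eta eta0 etaP] := lim _ e10.
  have [N2 N2P] := exprn_lt_eventually rho0 rho1 eta0.
  exists (N1 + N2).+1 => -[//|n]; rewrite ltnS => Nn.
  have rn : 0 < rho ^+ n.+1 by exact: exprn_gt0.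
  have h1 : `|f (rho ^+ n.+1) - Phi n.+1| <= e1 * n%:R.
    apply: N1P; first by rewrite (leq_trans _ Nn) // leq_addr.
    by rewrite lexx exprS gtr_pMl // exprn_gt0.
  have h2 := etaP _ rn (N2P n.+1 (leqW (leq_trans (leq_addl _ _) Nn))).
  rewrite lnX_natr // rhoE in h2 *.
  have nl : 0 < n.+1%:R * lam by rewrite mulr_gt0 // ltr0n.
  have h3 : `|t * (n.+1%:R * lam) + f (rho ^+ n.+1)| <= e1 * (n.+1%:R * lam).
    have -> : t * (n.+1%:R * lam) + f (rho ^+ n.+1) =
        (t - f (rho ^+ n.+1) / (n.+1%:R * - lam)) * (n.+1%:R * lam).
      by rewrite mulrN invrN mulrN opprK mulrDl divfK // gt_eqF.
    by rewrite normrM (gtr0_norm nl) ler_pM2r.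
  have -> : Phi n.+1 / - lam - t * n.+1%:R =
      ((f (rho ^+ n.+1) - Phi n.+1) - (t * (n.+1%:R * lam) + f (rho ^+ n.+1))) / lam.
    by field; rewrite gt_eqF.
  rewrite normrM normfV (gtr0_norm lamp) ler_pdivrMr //.
  apply: le_trans (ler_normB _ _) _.
  have e1n : e1 * n%:R <= e1 * n.+1%:R by rewrite ler_pM2l // ler_nat.
  apply: le_trans (lerD h1 h3) _.
  have -> : e * n.+1%:R * lam = e * lam * n.+1%:R by rewrite mulrAC.
  rewrite -e1E; have : 0 <= e1 * n.+1%:R by rewrite mulr_ge0 // ltW.
  have : 0 <= e1 * (n.+1%:R * lam) by rewrite mulr_ge0 // ltW.
  by move=> ??; lra.
- pose e1 := e * lam / (4 * (1 + lam)).
  have e10 : 0 < e1 by rewrite divr_gt0 ?mulr_gt0 // addr_gt0.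
  have e1E : e1 * (4 * (1 + lam)) = e * lam by rewrite divfK // mulf_neq0 // ?gt_eqF // addr_gt0.
  have [N1 N1P] := near _ e10.
  have [N2 N2P] := avg _ e10.
  have [N3 N3P] := @archi_lin (e * lam / 2 + `|t| * lam) (e * lam / 4)
     (ltac:(by rewrite divr_gt0 // mulr_gt0)).
  pose N := (N1 + N2 + N3).+1.
  exists (rho ^+ N) => [|r r0 rN]; first exact: exprn_gt0.
  have r1 : r < 1 by rewrite (lt_le_trans rN) // exprn_ile1 // ltW.
  have [n nr] := exprn_scale rho0 rho1 r0 r1.
  have [s1 s2] := scale _ _ nr.
  have Nn : (N <= n)%N.
    rewrite leqNgt; apply/negP => nN; case/andP: nr => rl _.
    have : rho ^+ N <= rho ^+ n.+1 by rewrite ler_wiXn2l // ltW.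
    by move: rN; move=> /lt_le_trans h /h/lt_le_trans/(_ rl); rewrite ltxx.
  have n0 : (0 < n)%N by rewrite (leq_trans _ Nn).
  have h1 : `|f r - Phi n.+1| <= e1 * n%:R.
    by apply: N1P nr; rewrite (leq_trans _ Nn) // /N ltnW // ltnS -addnA leq_addr.
  have h2 : `|Phi n.+1 / - lam - t * n.+1%:R| <= e1 * n.+1%:R.
    rewrite -rhoE; apply: N2P; rewrite (leq_trans _ (leqW Nn)) // /N ltnW // ltnS addnAC.
    exact: leq_addl.
  have h3 : e * lam / 2 + `|t| * lam <= e * lam / 4 * n%:R.
    by apply: N3P; rewrite (leq_trans _ Nn) // /N ltnW // ltnS leq_addl.
  have lr0 : ln r < 0 by rewrite ln_lt0 // r0.
  have -> : t - f r / ln r = (t * ln r - f r) / ln r by field; rewrite lt_eqF.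
  rewrite normrM normfV (ltr0_norm lr0) ler_pdivrMr ?oppr_gt0 //.
  have h4 : `|Phi n.+1 + t * (n.+1%:R * lam)| <= e1 * n.+1%:R * lam.
    have -> : Phi n.+1 + t * (n.+1%:R * lam) = (Phi n.+1 / - lam - t * n.+1%:R) * - lam.
      by field; rewrite gt_eqF.
    by rewrite normrM normrN (gtr0_norm lamp) ler_pM2r.
  have h5 : `|t * (ln r + n.+1%:R * lam)| <= `|t| * lam.
    rewrite normrM ler_wpM2l // ler_norml; rewrite -natr1 in s1 *.
    by apply/andP; split; lra.
  have -> : t * ln r - f r = t * (ln r + n.+1%:R * lam) -
     (Phi n.+1 + t * (n.+1%:R * lam)) - (f r - Phi n.+1) by ring.
  apply: le_trans (ler_normB _ _) _; apply: le_trans (lerD (ler_normB _ _) (lexx _)) _.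
  apply: le_trans (lerD (lerD h5 h4) h1) _.
  have ln_n : e * (n%:R * lam) <= e * - ln r by rewrite ler_pM2l //; lra.
  apply: le_trans ln_n; rewrite -natr1.
  have E : e * (n%:R * lam) = e1 * (4 * (1 + lam)) * n%:R by rewrite e1E; ring.
  have E2 : e * lam / 4 * n%:R = e1 * (1 + lam) * n%:R by rewrite -e1E; field.
  have E3 : e * lam / 2 = 2 * e1 * (1 + lam) by rewrite -e1E; field.
  rewrite E; rewrite E2 E3 in h3.
  have q1 : 0 <= e1 * n%:R by rewrite mulr_ge0 // ltW.
  have q2 : 0 <= e1 * n%:R * lam by rewrite mulr_ge0 // ltW.
  have q3 : 0 < e1 * lam by rewrite mulr_gt0.
  by lra.
Qed.

End LogSandwich.

(** * The exponent of a path and its link with the local dimension *)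

Section PathGrowth.
Context {R : realType} {m : nat} {rho : R} {d : 'I_m.+1 -> R} {p : 'I_m.+1 -> R}.
Hypothesis H : tiling_ifs rho d.
Hypothesis FT : finite_type rho d.
Hypothesis Hp : minimal_end_weights p.
Local Notation F := (net_intervals rho d).
Local Notation cv := (char_vector rho d).
Local Notation nbs := (@charvec_nbs R).
Local Notation nsize a := (size (nbs a)).
Local Notation p0 := (p ord0).
Local Notation chain := (chain rho d).
Local Notation path_norm := (path_norm rho d p).
Let p0_gt0 : 0 < p0 := weight_gt0 Hp ord0.
Let lam_lt0 : ln rho < 0.
Proof. by rewrite ln_lt0 // (ratio_gt0 H) (ratio_lt1 H). Qed.

(* The exponent of [p0 ^ n ||T||] with respect to [rho]: along a symbolic
   representation, its average per letter is the local dimension. *)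
Definition path_exponent (alpha : charvec) (s : seq charvec) : R :=
  (ln (path_norm alpha s) + (size s)%:R * ln p0) / ln rho.

Lemma Omega_size alpha : Omega rho d alpha -> (0 < nsize alpha)%N.
Proof. by case=> n [D [DF <-]]; exact: (size_neighbours_gt0 H). Qed.

Lemma Omega_size_bound : exists2 K, (0 < K)%N & forall alpha, Omega rho d alpha -> (nsize alpha <= K)%N.
Proof.
have [L LP] := finite_cores H FT.
have [K KP] : exists K, forall c, c \in L -> (size c.2 <= K)%N.
  elim: L {LP} => [|c L [K KP]]; first by exists 0%N.
  exists (maxn (size c.2) K) => c'; rewrite inE => /orP[/eqP->|/KP h].
    by rewrite leq_maxl.
  by rewrite leq_max h orbT.
by exists K.+1 => // _ [n [D [DF <-]]]; apply: leqW; apply: KP (LP _ _ DF).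
Qed.

Lemma child_Omega alpha beta : child rho d alpha beta -> Omega rho d beta.
Proof. by case=> n [P [D [[_ DF _] _ <-]]]; exists n.+1, D. Qed.

Lemma chain_Omega alpha s : Omega rho d alpha -> chain alpha s ->
  forall beta, beta \in alpha :: s -> Omega rho d beta.
Proof.
elim: s alpha => [|g s IH] alpha Oa /=; first by move=> _ beta; rewrite inE => /eqP->.
case/andP=> /asboolP ag gs beta; rewrite inE => /orP[/eqP->//|].
exact: IH (child_Omega ag) gs _.
Qed.

Lemma path_norm_gt0 alpha s : Omega rho d alpha -> chain alpha s -> 0 < path_norm alpha s.
Proof.
move=> Oa ch; apply: lt_le_trans (path_norm_ge1 H Hp ch (Omega_size Oa)).
exact: ltr01.
Qed.

(** Attaching a piece multiplies the norm by a number between 1 and the norm of the piece, which is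
    at most exponential in its length; the powers of [p0] are counted per letter. *)
Lemma path_exponent_lipschitz : exists2 c, 0 <= c & forall alpha s1 s2,
  Omega rho d alpha -> chain alpha (s1 ++ s2) ->
  [/\ `|path_exponent alpha s1| <= c * (size s1).+1%:R,
     `|path_exponent alpha (s1 ++ s2) - path_exponent alpha s1| <= c * (size s2).+1%:R &
     `|path_exponent alpha (s1 ++ s2) - path_exponent (last alpha s1) s2| <= c * (size s1).+1%:R].
Proof.
have [K K0 KP] := Omega_size_bound.
set B := ln (K%:R ^+ 2 / p0).
have KK : 1 <= K%:R ^+ 2 / p0.
  rewrite ler_pdivlMr // mul1r (@le_trans _ _ 1) //; first exact: (weight_le1 Hp).
  by rewrite -natrX ler1n expn_gt0 K0.
have B0 : 0 <= B by rewrite ln_ge0.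
have lnle alpha s : Omega rho d alpha -> chain alpha s ->
    0 <= ln (path_norm alpha s) <= (size s).+1%:R * B.
  move=> Oa ch; have n1 := path_norm_ge1 H Hp ch (Omega_size Oa).
  rewrite ln_ge0 //= -lnX_natr ?(lt_le_trans ltr01 KK) //.
  rewrite ler_ln ?posrE ?(lt_le_trans ltr01 n1) ?exprn_gt0 ?(lt_le_trans ltr01 KK) //.
  apply: path_norm_le => // beta bs; apply: KP; exact: chain_Omega Oa ch _ bs.
exists ((B + `|ln p0|) / - ln rho).
  by rewrite divr_ge0 ?addr_ge0 // oppr_ge0 ltW.
move=> alpha s1 s2 Oa; rewrite chain_cat => /andP[ch1 ch2].
have ch : chain alpha (s1 ++ s2) by rewrite chain_cat ch1.
have Ol : Omega rho d (last alpha s1) by apply: (chain_Omega Oa ch1); exact: mem_last.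
have lnle1 := lnle _ _ Oa ch1; have lnle2 := lnle _ _ Ol ch2.
have P1 := path_norm_gt0 Oa ch1; have P2 := path_norm_gt0 Ol ch2; have P := path_norm_gt0 Oa ch.
have u : ln (path_norm alpha (s1 ++ s2)) <= ln (path_norm alpha s1) + ln (path_norm (last alpha s1) s2).
  by rewrite -lnM ?posrE // ler_ln ?posrE ?mulr_gt0 // path_norm_cat_le.
have l1 : ln (path_norm alpha s1) <= ln (path_norm alpha (s1 ++ s2)).
  by rewrite ler_ln ?posrE // (path_norm_catl H Hp).
have l2 : ln (path_norm (last alpha s1) s2) <= ln (path_norm alpha (s1 ++ s2)).
  by rewrite ler_ln ?posrE // (path_norm_catr H Hp).
have gen (x : R) (k : nat) y : `|y| <= k.+1%:R * B ->
    x = (y + k%:R * ln p0) / ln rho -> `|x| <= (B + `|ln p0|) / - ln rho * k.+1%:R.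
  move=> yB ->; rewrite normrM normfV (ltr0_norm lam_lt0) mulrAC.
  rewrite ler_pM2r ?invr_gt0 ?oppr_gt0 //.
  apply: le_trans (ler_normD _ _) _; rewrite mulrDl [B * _]mulrC lerD // normrM.
  by rewrite [leRHS]mulrC (ger0_norm (ler0n _ k)) ler_wpM2r // ler_nat.
split.
- apply: gen erefl; rewrite ger0_norm; by case/andP: lnle1.
- apply: (gen _ _ (ln (path_norm alpha (s1 ++ s2)) - ln (path_norm alpha s1))).
    by rewrite ger0_norm ?subr_ge0 //; case/andP: lnle2 => _; lra.
  by rewrite /path_exponent size_cat natrD; ring.
- apply: (gen _ _ (ln (path_norm alpha (s1 ++ s2)) - ln (path_norm (last alpha s1) s2))).
    by rewrite ger0_norm ?subr_ge0 //; case/andP: lnle1 => _; lra.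
  by rewrite /path_exponent size_cat natrD; ring.
Qed.

(** One side is submultiplicativity. For the other, positivity of [T(eta)] compares with the norm of
    [s2] alone, and removing [eta] from [eta ++ s2] costs at most [ln ||T(eta)||], the origin of
    [C]. *)
Lemma path_exponent_almost_additive (alpha0 : charvec) (eta : seq charvec) :
  Omega rho d alpha0 -> chain alpha0 eta -> positive_path rho d p alpha0 eta ->
  exists2 C, 0 <= C & forall alpha s1 s2,
  Omega rho d alpha -> last alpha s1 = alpha0 -> chain alpha (s1 ++ eta ++ s2) ->
  `|path_exponent alpha (s1 ++ eta ++ s2) - path_exponent alpha s1
    - path_exponent alpha0 (eta ++ s2)| <= C.
Proof.
move=> O0 ch0 pos; have n1 := path_norm_ge1 H Hp ch0 (Omega_size O0).
exists (ln (path_norm alpha0 eta) / - ln rho).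
  by rewrite divr_ge0 ?ln_ge0 // oppr_ge0 ltW.
move=> alpha s1 s2 Oa la ch.
have := ch; rewrite chain_cat la => /andP[ch1 ch2].
have := ch2; rewrite chain_cat => /andP[_ ch3].
have O3 : Omega rho d (last alpha0 eta) by apply: (chain_Omega O0 ch0); exact: mem_last.
have P1 := path_norm_gt0 Oa ch1; have P2 := path_norm_gt0 O0 ch2; have P := path_norm_gt0 Oa ch.
have P3 := path_norm_gt0 O3 ch3; have P0 := path_norm_gt0 O0 ch0.
have u : ln (path_norm alpha (s1 ++ eta ++ s2)) <=
    ln (path_norm alpha s1) + ln (path_norm alpha0 (eta ++ s2)).
  rewrite -lnM ?posrE // ler_ln ?posrE ?mulr_gt0 //.
  by have := path_norm_cat_le Hp alpha s1 (eta ++ s2); rewrite la.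
have l : ln (path_norm alpha s1) + ln (path_norm (last alpha0 eta) s2) <=
    ln (path_norm alpha (s1 ++ eta ++ s2)).
  rewrite -lnM ?posrE // ler_ln ?posrE ?mulr_gt0 //.
  by have := @path_norm_positive _ _ _ _ _ Hp alpha s1 eta s2; rewrite la; apply.
have u2 : ln (path_norm alpha0 (eta ++ s2)) <=
    ln (path_norm alpha0 eta) + ln (path_norm (last alpha0 eta) s2).
  rewrite -lnM ?posrE // ler_ln ?posrE ?mulr_gt0 //.
  exact: path_norm_cat_le.
have -> : path_exponent alpha (s1 ++ eta ++ s2) - path_exponent alpha s1
    - path_exponent alpha0 (eta ++ s2) =
    (ln (path_norm alpha (s1 ++ eta ++ s2)) - ln (path_norm alpha s1) -
      ln (path_norm alpha0 (eta ++ s2))) / ln rho.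
  by rewrite /path_exponent !size_cat !natrD; ring.
rewrite normrM normfV (ltr0_norm lam_lt0) ler_pM2r ?invr_gt0 ?oppr_gt0 //.
by rewrite ler_norml; apply/andP; split; lra.
Qed.

Section LocalDim.
Variable mu : probability (measurableTypeR R) R.
Hypothesis mu_self_similar : self_similar rho d p mu.
Hypothesis mu_support : msupport mu = `[0, 1]%classic.

Lemma prefix_chain (gamma : nat -> charvec) n :
  (forall k, child rho d (gamma k) (gamma k.+1)) -> chain (gamma 0%N) (prefix_of gamma n).
Proof.
move=> ch; elim: n => [//|n IH]; rewrite prefix_ofS -cats1 chain_cat IH last_prefix_of /=.
by rewrite andbT asboolT.
Qed.

Lemma symbolic_rep_child gamma x : symbolic_rep rho d gamma x ->
  (forall k, child rho d (gamma k) (gamma k.+1)) /\ gamma 0%N = cv 0 (0, 1).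
Proof.
case=> Delta DP; split=> [k|].
  have [_ _ PD ->] := DP k; have [_ _ _ ->] := DP k.+1.
  by exists k, (Delta k), (Delta k.+1).
by have [_ /net_intervals0 D0 _ ->] := DP 0%N; rewrite D0.
Qed.

Lemma root_Omega : Omega rho d (cv 0 (0, 1)).
Proof. by exists 0%N, (0, 1); split=> //; apply/net_intervals0. Qed.

Lemma has_local_dimE gamma x t : symbolic_rep rho d gamma x ->
  has_local_dim mu x t <->
  avg_cvg (fun n => path_exponent (gamma 0%N) (prefix_of gamma n)) t.
Proof.
move=> sr; have [ch g0] := symbolic_rep_child sr.
have O0 : Omega rho d (gamma 0%N) by rewrite g0; exact: root_Omega.
have [Delta DP] := sr.
have [kap kap0 kapP] := ball_lower_bound H FT Hp mu_self_similar mu_support.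
have [delta [del0 del1 delP]] := ball_upper_bound H FT Hp mu_self_similar mu_support.
have [c c0 lip] := path_exponent_lipschitz.
pose W n := net_weight rho d p n (Delta n).
have WE n : W n = p0 ^+ n * path_norm (gamma 0%N) (prefix_of gamma n).
  apply: (net_weight_path_norm H Hp); first by have [] := DP 0%N.
    by move=> k; have [] := DP k.
  by move=> k; have [] := DP k.
have W0 n : 0 < W n by have [_ DF _ _] := DP n; exact: (net_weight_gt0 H Hp DF).
have lnW n : ln (W n) / ln rho = path_exponent (gamma 0%N) (prefix_of gamma n).
  rewrite WE lnM ?posrE ?exprn_gt0 //; last exact: (path_norm_gt0 O0 (prefix_chain n ch)).
  by rewrite lnX_natr // /path_exponent size_mkseq addrC.
set f := fun r => ln (fine (mu `[x - r, x + r]%classic)).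
have C0 : 0 < 1 + 2 * p0^-1 by rewrite addr_gt0 // mulr_gt0 // invr_gt0.
have Bpos r : 0 < r -> 0 < fine (mu `[x - r, x + r]%classic).
  move=> r0; have [n /(_ n (leqnn n)) nr] :=
    exprn_lt_eventually (ratio_gt0 H) (ratio_lt1 H) r0.
  have [xD DF _ _] := DP n.
  by apply: lt_le_trans (kapP n _ x r DF xD (ltW nr)); rewrite mulr_gt0 // W0.
have low n r : rho ^+ n <= r -> ln kap + ln (W n) <= f r.
  move=> nr; have [xD DF _ _] := DP n; rewrite -lnM ?posrE //.
  have r0 : 0 < r by rewrite (lt_le_trans _ nr) // (ratioX_gt0 H).
  by rewrite /f ler_ln ?posrE ?mulr_gt0 ?Bpos //; exact: kapP.
have up n r : 0 < r -> r < delta * rho ^+ n ->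
    f r <= ln (1 + 2 * p0^-1) + ln n.+1%:R + ln (W n).
  move=> r0 rn; have [xD DF _ _] := DP n.
  rewrite -!lnM ?posrE ?mulr_gt0 ?ltr0n //.
  by rewrite /f ler_ln ?posrE ?Bpos ?mulr_gt0 ?ltr0n //; exact: delP.
have lipW n : `|ln (W n.+1) - ln (W n)| <= c * 2 * - ln rho.
  have -> : ln (W n.+1) - ln (W n) = (ln (W n.+1) / ln rho - ln (W n) / ln rho) * ln rho.
    by field; rewrite lt_eqF.
  rewrite normrM (ltr0_norm lam_lt0) ler_pM2r ?oppr_gt0 // !lnW prefix_ofS -cats1.
  have [_ + _] := lip (gamma 0%N) (prefix_of gamma n) [:: gamma n.+1] O0
    (ltac:(by rewrite cats1 -prefix_ofS prefix_chain)).
  by [].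
have <- : (fun n => ln (W n) / ln rho) =
    (fun n => path_exponent (gamma 0%N) (prefix_of gamma n)) by apply/funext.
rewrite -(log_sandwich t (ratio_gt0 H) (ratio_lt1 H) del0 low up lipW).
rewrite /has_local_dim; split.
  move=> /cvgrPdist_le lim e e0; have /nbhs_ballP[eta /= eta0 etaP] := lim e e0.
  exists eta => // r r0 re; apply: etaP => //.
  by rewrite /ball /= sub0r normrN gtr0_norm.
move=> lim; apply/cvgrPdist_le => e e0; have [eta eta0 etaP] := lim e e0.
apply/nbhs_ballP; exists eta => //= r; rewrite /ball /= sub0r normrN => re r0.
by apply: etaP => //; rewrite -(gtr0_norm r0).
Qed.

End LocalDim.
End PathGrowth.

Arguments path_exponent {R m} rho d p alpha s.

(** * Blocks in a loop class *)

Section Realization.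
Context {R : realType} {m : nat} {rho : R} {d : 'I_m.+1 -> R}.
Hypothesis H : tiling_ifs rho d.
Hypothesis FT : finite_type rho d.
Local Notation F := (net_intervals rho d).
Local Notation cv := (char_vector rho d).
Local Notation root := (cv 0 (0, 1)).
Local Notation chain := (chain rho d).
Local Notation child := (child rho d).
Local Notation Omega := (Omega rho d).

Lemma child_realized n P alpha beta : P \in F n -> (cv n P).1 = alpha.1 ->
  child alpha beta -> exists2 D, is_parent rho d n P D & cv n.+1 D = beta.
Proof.
move=> PF Pa [n' [P' [D' [PD' Pa' Db']]]].
have eqc : (cv n' P').1 = (cv n P).1 by rewrite Pa' Pa.
exists (homothety2 (rho := rho) n' P' n P D').
  exact: (homothety_is_parent H PF eqc PD').
by rewrite (homothety_char_vector H PF eqc PD').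
Qed.

(** The children depend on the core only, which lets finitely many cores stand for all vectors. *)
Lemma child_core alpha alpha' beta : Omega alpha' -> alpha.1 = alpha'.1 ->
  child alpha beta -> child alpha' beta.
Proof.
case=> n [P [PF Pa]] e ch.
have [|D PD Db] := @child_realized n P alpha beta PF _ ch; first by rewrite Pa.
by exists n, P, D.
Qed.

Lemma symbolic_rep_exists gamma : gamma 0%N = root ->
  (forall k, child (gamma k) (gamma k.+1)) -> exists x, symbolic_rep rho d gamma x.
Proof.
move=> g0 ch.
(* At each level a child with the prescribed vector exists, by homothety, so [xget] never returns
   its default. *)
pose Delta := fix Delta n : R * R := if n is k.+1 then
  xget (0, 1) [set D | is_parent rho d k (Delta k) D /\ cv k.+1 D = gamma k.+1] else (0, 1).
have DP n : Delta n \in F n /\ cv n (Delta n) = gamma n /\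
    is_parent rho d n (Delta n) (Delta n.+1).
  have step k : Delta k \in F k -> cv k (Delta k) = gamma k ->
      is_parent rho d k (Delta k) (Delta k.+1) /\ cv k.+1 (Delta k.+1) = gamma k.+1.
    move=> DF Dg; apply: (xgetPex (0, 1)
      (P := [set D | is_parent rho d k (Delta k) D /\ cv k.+1 D = gamma k.+1])).
    have [|D PD Db] := child_realized DF _ (ch k); first by rewrite Dg.
    by exists D.
  have inv k : Delta k \in F k /\ cv k (Delta k) = gamma k.
    elim: k => [|k [DF Dg]]; first by split=> //; apply/net_intervals0.
    by have [[_ ? _] ?] := step k DF Dg.
  by have [DF Dg] := inv n; have [? _] := step n DF Dg.
have mono n k : (Delta n).1 <= (Delta (n + k)%N).1 /\ (Delta (n + k)%N).2 <= (Delta n).2.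
  elim: k => [|k [h1 h2]]; first by rewrite addn0.
  rewrite addnS; have [_ [_ [_ _ /andP[g1 g2]]]] := DP (n + k)%N.
  by split; [exact: le_trans g1|exact: le_trans h2].
have lt12 n : (Delta n).1 < (Delta n).2 by have [/net_interval_lt] := DP n.
have le12 n k : (Delta n).1 <= (Delta k).2.
  have [nk|kn] := leqP n k.
    have [h1 _] := mono n (k - n)%N; rewrite subnKC // in h1.
    by apply: le_trans h1 (ltW (lt12 k)).
  have [_ h2] := mono k (n - k)%N; rewrite subnKC // in h2; last exact: ltnW.
  by apply: le_trans (ltW (lt12 n)) h2.
pose A := range (fun n => (Delta n).1).
have Aub k : ubound A (Delta k).2 by move=> _ [n _ <-].
have Asup : has_sup A by split; [exists (Delta 0%N).1, 0%N|exists (Delta 0%N).2].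
exists (sup A), Delta => n; have [DF [Dg PD]] := DP n.
split=> //; apply/andP; split.
  by apply: ub_le_sup; [case: Asup|exists n].
by apply: ge_sup => //; case: Asup.
Qed.

Lemma Omega_chain alpha : Omega alpha -> exists2 s, chain root s & last root s = alpha.
Proof.
case=> n [D [DF <-]]; elim: n D DF => [|n IH] D DF.
  by move/net_intervals0: DF => ->; exists [::].
have [P PD] := parent_exists H DF; have [PF _ _] := PD.
have [s ch la] := IH P PF; exists (rcons s (cv n.+1 D)); last by rewrite last_rcons.
rewrite -cats1 chain_cat ch la /= andbT; apply/asboolP; by exists n, P, D.
Qed.

End Realization.

Section Loops.
Context {R : realType} {m : nat} {rho : R} {d : 'I_m.+1 -> R} {p : 'I_m.+1 -> R}.
Variable mu : probability (measurableTypeR R) R.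
Hypothesis H : tiling_ifs rho d.
Hypothesis FT : finite_type rho d.
Hypothesis Hp : minimal_end_weights p.
Hypothesis mu_self_similar : self_similar rho d p mu.
Hypothesis mu_support : msupport mu = `[0, 1]%classic.
Local Notation F := (net_intervals rho d).
Local Notation cv := (char_vector rho d).
Local Notation root := (cv 0 (0, 1)).
Local Notation chain := (chain rho d).
Local Notation child := (child rho d).
Local Notation Omega := (Omega rho d).
Local Notation D := (path_exponent rho d p).
Local Notation sz s := ((size s)%:R : R).

Variables (W : set (@charvec R)) (alpha0 : @charvec R) (eta : seq (@charvec R)).
Hypothesis W_Omega : W `<=` Omega.
Hypothesis W_loop : forall alpha beta, W alpha -> W beta ->
  exists s, [/\ s != [::], path_in rho d W alpha s & last alpha s = beta].
Hypothesis W_alpha0 : W alpha0.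
Hypothesis eta_neq0 : eta != [::].
Hypothesis eta_path : path_in rho d W alpha0 eta.
Hypothesis eta_pos : positive_path rho d p alpha0 eta.

Let O0 : Omega alpha0 := W_Omega W_alpha0.

Lemma W_path_in alpha s : W alpha ->
  path_in rho d W alpha s <-> chain alpha s /\ (forall g, g \in s -> W g).
Proof.
move=> Wa; split=> [[[_ ch] sW]|[ch sW]].
  by split=> // g gs; apply: sW; rewrite inE gs orbT.
split; first by split=> //; exact: W_Omega.
by move=> g; rewrite inE => /orP[/eqP->//|]; exact: sW.
Qed.

(** One return path per core suffices: its first step depends only on the core of its start, and
    being nonempty it keeps its last letter when the start is replaced. *)
Lemma bounded_return : exists L0, forall g, W g ->
  exists s, [/\ chain g s, (forall h, h \in s -> W h), last g s = alpha0 & (size s <= L0)%N].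
Proof.
have [L LP] := finite_cores H FT.
suff [L0 L0P] : exists L0, forall g, W g -> g.1 \in L ->
    exists s, [/\ chain g s, (forall h, h \in s -> W h), last g s = alpha0 & (size s <= L0)%N].
  exists L0 => g Wg; apply: L0P => //.
  by have [n [P [PF <-]]] := W_Omega Wg; exact: LP.
elim: L {LP} => [|c L [L0 IH]]; first by exists 0%N.
have [[gc [Wgc gcc]]|nc] := pselect (exists gc, W gc /\ gc.1 = c); last first.
  exists L0 => g Wg; rewrite inE => /orP[/eqP gc|]; last exact: IH.
  by case: nc; exists g.
have [s [s0 sp ls]] := W_loop Wgc W_alpha0.
exists (maxn (size s) L0) => g Wg; rewrite inE => /orP[/eqP ge|gL]; last first.
  have [s' [h1 h2 h3 h4]] := IH g Wg gL; exists s'; split=> //.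
  by rewrite leq_max h4 orbT.
have [chs sW] := (W_path_in _ Wgc).1 sp.
exists s; split=> //; last by rewrite leq_maxl.
  case: s s0 chs {sp ls sW} => // b s _ /= /andP[/asboolP cb ->].
  rewrite andbT; apply/asboolP; apply: (child_core H _ _ cb); first exact: W_Omega.
  by rewrite gcc.
by case: s s0 ls {sp chs sW}.
Qed.

(** The starting letter [alpha0] is left out, so that concatenation of loops is concatenation of
    lists. *)
Definition is_block (b : seq (@charvec R)) : Prop :=
  [/\ chain alpha0 b, last alpha0 b = alpha0, (forall g, g \in b -> W g) &
      exists v, b = eta ++ v].

Lemma size_block b : is_block b -> (0 < size b)%N.
Proof. by case=> _ _ _ [v ->]; rewrite size_cat; case: eta eta_neq0. Qed.

Lemma block_cat b s : is_block b -> chain alpha0 s -> last alpha0 s = alpha0 ->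
  (forall g, g \in s -> W g) -> is_block (b ++ s).
Proof.
move=> [ch la bW [v bE]] chs las sW; split.
- by rewrite chain_cat ch la.
- by rewrite last_cat la.
- by move=> g; rewrite mem_cat => /orP[/bW|/sW].
- by exists (v ++ s); rewrite bE catA.
Qed.

Lemma flatten_blocks (bs : seq (seq (@charvec R))) : (forall b, b \in bs -> is_block b) ->
  [/\ chain alpha0 (flatten bs), last alpha0 (flatten bs) = alpha0,
      (forall g, g \in flatten bs -> W g) & bs != [::] -> is_block (flatten bs)].
Proof.
elim: bs => [|b bs IH] bsP; first by split.
have bP : is_block b by apply: bsP; rewrite inE eqxx.
have [|ch la bW _] := IH; first by move=> b' b'bs; apply: bsP; rewrite inE b'bs orbT.
have bb : is_block (flatten (b :: bs)) by exact: block_cat.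
by case: (bb) => h1 h2 h3 _; split.
Qed.

Lemma block_almost_additive : exists2 C, 0 <= C &
  (forall s b, chain alpha0 s -> last alpha0 s = alpha0 -> is_block b ->
    `|D alpha0 (s ++ b) - D alpha0 s - D alpha0 b| <= C) /\
  forall bs, bs != [::] -> (forall b, b \in bs -> is_block b) ->
    `|D alpha0 (flatten bs) - \sum_(b <- bs) D alpha0 b| <= C * sz bs.
Proof.
have [_ /= eP] := eta_path; have che : chain alpha0 eta by case: eta_path => -[].
have [C C0 CP] := path_exponent_almost_additive H Hp O0 che eta_pos.
have CP1 s b : chain alpha0 s -> last alpha0 s = alpha0 -> is_block b ->
    `|D alpha0 (s ++ b) - D alpha0 s - D alpha0 b| <= C.
  move=> ch la [chb lb bW [v bE]]; rewrite bE in chb *; apply: CP => //.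
  by rewrite chain_cat ch la.
exists C => //; split=> //.
elim/last_ind => [//|bs b IH] _ bsP.
have bP : is_block b by apply: bsP; rewrite mem_rcons inE eqxx.
rewrite -cats1 flatten_cat big_cat /= cats0 big_seq1.
have [->|bs0] := eqVneq bs [::].
  by rewrite big_nil add0r subrr normr0 mulr1.
have bsP' b' : b' \in bs -> is_block b'.
  by move=> b'bs; apply: bsP; rewrite mem_rcons inE b'bs orbT.
have [ch la _ _] := flatten_blocks bsP'.
have h1 := CP1 _ _ ch la bP; have h2 := IH bs0 bsP'.
rewrite size_cat /= addn1 -natr1 mulrDr mulr1.
set x := D alpha0 (flatten bs ++ b) in h1 *; set y := D alpha0 (flatten bs) in h1 h2 *.
have -> : x - (\sum_(b <- bs) D alpha0 b + D alpha0 b) =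
  (y - \sum_(b <- bs) D alpha0 b) + (x - y - D alpha0 b) by ring.
by apply: le_trans (ler_normD _ _) _; rewrite lerD.
Qed.

(** * Points coded by an infinite sequence of blocks *)

Section Concatenation.
Variables (pre : seq (@charvec R)) (u : nat -> seq (@charvec R)).
Hypothesis pre_chain : chain root pre.
Hypothesis pre_last : last root pre = alpha0.
Hypothesis u_block : forall k, is_block (u k).

Definition cat_blocks (k : nat) : seq (@charvec R) := flatten (mkseq u k).

Lemma cat_blocksS k : cat_blocks k.+1 = cat_blocks k ++ u k.
Proof. by rewrite /cat_blocks mkseqS -cats1 flatten_cat /= cats0. Qed.

Lemma cat_blocks_extend k l : exists w, cat_blocks (k + l) = cat_blocks k ++ w.
Proof.
elim: l => [|l [w IH]]; first by exists [::]; rewrite addn0 cats0.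
by exists (w ++ u (k + l)); rewrite addnS cat_blocksS IH catA.
Qed.

Lemma size_cat_blocks k : (k <= size (cat_blocks k))%N.
Proof.
elim: k => // k IH; rewrite cat_blocksS size_cat -addn1.
by rewrite leq_add // size_block.
Qed.

Lemma cat_blocks_loop k : [/\ chain alpha0 (cat_blocks k),
  last alpha0 (cat_blocks k) = alpha0 & forall g, g \in cat_blocks k -> W g].
Proof.
have [|h1 h2 h3 _] := @flatten_blocks (mkseq u k); last by split.
by move=> b /mapP[i _ ->].
Qed.

(** Blocks are nonempty, so n of them reach past position n and the default of [nth] is not met. *)
Definition letters (n : nat) : @charvec R := nth alpha0 (root :: pre ++ cat_blocks n) n.

Lemma lettersE n k : (n <= size (pre ++ cat_blocks k))%N ->
  letters n = nth alpha0 (root :: pre ++ cat_blocks k) n.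
Proof.
move=> nk; have nn : (n <= size (pre ++ cat_blocks n))%N.
  by rewrite size_cat (leq_trans (size_cat_blocks n)) // leq_addl.
have [kn|/ltnW kn] := leqP n k.
  have [w wE] := cat_blocks_extend n (k - n); rewrite subnKC // in wE.
  by rewrite wE catA -cat_cons nth_cat /= ltnS nn.
have [w wE] := cat_blocks_extend k (n - k); rewrite subnKC // in wE.
by rewrite /letters wE catA -cat_cons nth_cat /= ltnS nk.
Qed.

Lemma letters_prefix n k : (n <= size (pre ++ cat_blocks k))%N ->
  prefix_of letters n = take n (pre ++ cat_blocks k).
Proof.
move=> nk; rewrite -(map_nth_iota0 alpha0 nk); apply/eq_in_map => i.
rewrite mem_iota add0n => /andP[_ ilt].
by rewrite (@lettersE _ k) // (leq_trans ilt).
Qed.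

Lemma letters_child n : child (letters n) (letters n.+1).
Proof.
have nn : (n.+1 <= size (pre ++ cat_blocks n.+1))%N.
  by rewrite size_cat (leq_trans (size_cat_blocks n.+1)) // leq_addl.
rewrite (lettersE nn) (lettersE (ltnW nn)).
have ch : chain root (pre ++ cat_blocks n.+1).
  by rewrite chain_cat pre_chain pre_last; case: (cat_blocks_loop n.+1).
by move/(pathP alpha0): ch => /(_ n nn)/asboolP.
Qed.

Lemma letters_W n : (size pre < n)%N -> W (letters n).
Proof.
case: n => // n; rewrite ltnS => pn.
have nn : (n.+1 <= size (pre ++ cat_blocks n.+1))%N.
  by rewrite size_cat (leq_trans (size_cat_blocks n.+1)) // leq_addl.
rewrite (lettersE nn) /= nth_cat ltnNge pn /=.
have [_ _ h] := cat_blocks_loop n.+1; apply: h; apply: mem_nth.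
by rewrite ltn_subLR // -size_cat.
Qed.

Lemma letters_shift n k : (n <= size (cat_blocks k))%N ->
  letters (size pre + n) = nth alpha0 (alpha0 :: cat_blocks k) n.
Proof.
move=> nk; rewrite (@lettersE _ k) ?size_cat ?leq_add2l //.
rewrite -cat_cons lastI pre_last cat_rcons nth_cat size_belast.
by rewrite ltnNge leq_addr /= addKn.
Qed.

Lemma blocks_point : exists x, symbolic_rep rho d letters x.
Proof. by apply: (symbolic_rep_exists H) letters_child => //; rewrite /letters. Qed.

(** The hypothesis controls averages at the ends of blocks only. As the next block is short against
    the word already built, stopping inside it changes the average by a negligible amount. *)
Lemma blocks_local_dim t x :
  (forall e, 0 < e -> exists K, forall k, (K <= k)%N ->
     `|D alpha0 (cat_blocks k) - t * sz (cat_blocks k)| <= e * sz (cat_blocks k) /\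
     sz (u k) <= e * sz (cat_blocks k)) ->
  symbolic_rep rho d letters x -> has_local_dim mu x t.
Proof.
move=> hyp sr; apply/(has_local_dimE H FT Hp mu_self_similar mu_support t sr).
have [c c0 lip] := path_exponent_lipschitz H FT Hp.
move=> e e0.
have l0 : letters 0 = root by [].
set Q := c * (size pre).+1%:R + c + `|t| * sz pre.
have q0 : 0 < 2 * (c + 1 + `|t|) by rewrite mulr_gt0 // addrAC ltr_wpDl // addr_ge0.
(* The three terms pay for the unfinished block in the exponent, the deviation at the last block
   end, and the unfinished block in [t * n]. The other half of [e] absorbs [Q], the cost of the
   fixed prefix. *)
pose e1 := e / (2 * (c + 1 + `|t|)).
have e10 : 0 < e1 by rewrite divr_gt0.
have e1E : e1 * (c + 1 + `|t|) = e / 2.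
  by rewrite /e1; field; move: q0; rewrite pmulr_rgt0 // => /lt0r_neq0.
have [K KP] := hyp _ e10.
have [N NP] := @archi_lin R Q (e / 2) (ltac:(by rewrite divr_gt0)).
exists (N + (size pre + size (cat_blocks K)))%N => n nN.
have Nn : (N <= n)%N by rewrite (leq_trans _ nN) // leq_addr.
have pKn : (size pre + size (cat_blocks K) <= n)%N by rewrite (leq_trans _ nN) // leq_addl.
(* The least such [k] counts the blocks completed within n letters; [tau] below is the part of block
   [k] read so far. *)
pose P k := (n < size pre + size (cat_blocks k.+1))%N.
have ex : exists k, P k.
  by exists n; apply: leq_trans (size_cat_blocks n.+1) _; rewrite leq_addl.
case: (ex_minnP ex) => k; rewrite {1}/P => nk kmin.
have kn : (size pre + size (cat_blocks k) <= n)%N.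
  case: k nk kmin => [|k] nk kmin.
    by rewrite /cat_blocks /= addn0 (leq_trans _ pKn) // leq_addr.
  by rewrite leqNgt; apply/negP => /kmin; rewrite ltnn.
have Kk : (K <= k)%N.
  rewrite leqNgt; apply/negP => kK; move: (leq_ltn_trans pKn nk).
  rewrite ltn_add2l ltnNge => /negP; apply.
  have [w wE] := cat_blocks_extend k.+1 (K - k.+1); rewrite subnKC // in wE.
  by rewrite wE size_cat leq_addr.
have [hD hu] := KP k Kk.
set w := cat_blocks k in hD hu kn *.
pose tau := take (n - (size pre + size w)) (u k).
have prefE : prefix_of letters n = (pre ++ w) ++ tau.
  rewrite (@letters_prefix n k.+1); last by rewrite size_cat ltnW.
  rewrite cat_blocksS catA take_cat size_cat ltnNge kn /=.
  by rewrite /tau -/w.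
have tau_le : (size tau <= size (u k))%N by rewrite size_take_min geq_minr.
have szn : n = (size pre + size w + size tau)%N.
  have := congr1 size prefE; rewrite size_mkseq !size_cat => {1}->.
  by [].
have chn : chain root ((pre ++ w) ++ tau).
  by rewrite -prefE -l0; apply: prefix_chain; exact: letters_child.
have Or : Omega root by exact: root_Omega.
have [_ h1 _] := lip _ _ _ Or chn.
have [_ _] := lip root pre w Or (ltac:(by move: chn; rewrite chain_cat => /andP[])).
rewrite pre_last => h2.
rewrite l0 prefE.
have nE : n%:R = sz pre + sz w + sz tau :> R by rewrite {1}szn !natrD.
have w0 : 0 <= sz w by exact: ler0n.
have p0' : 0 <= sz pre by exact: ler0n.
have tau0 : 0 <= sz tau by exact: ler0n.
have htau : sz tau <= e1 * sz w by apply: le_trans hu; rewrite ler_nat.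
set X := D root ((pre ++ w) ++ tau) in h1 *; set Y := D root (pre ++ w) in h1 h2.
set Z := D alpha0 w in h2 hD.
have -> : X - t * n%:R = (X - Y) + (Y - Z) + (Z - t * sz w) - t * (sz pre + sz tau).
  by rewrite nE; ring.
have h3 : `|t * (sz pre + sz tau)| <= `|t| * sz pre + `|t| * (e1 * sz w).
  by rewrite normrM -mulrDr ler_wpM2l // ger0_norm ?addr_ge0 // lerD2l.
apply: le_trans (ler_normB _ _) _; apply: le_trans (lerD (ler_normD _ _) (lexx _)) _.
apply: le_trans (lerD (lerD (ler_normD _ _) (lexx _)) (lexx _)) _.
apply: le_trans (lerD (lerD (lerD h1 h2) hD) h3) _.
have hct : c * (size tau).+1%:R <= c * (e1 * sz w) + c.
  by rewrite -natr1 mulrDr mulr1 lerD2r ler_wpM2l.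
have QN := NP n Nn.
have ew : e / 2 * sz w <= e / 2 * n%:R by rewrite ler_pM2l ?divr_gt0 // nE; lra.
have ew' : c * (e1 * sz w) + e1 * sz w + `|t| * (e1 * sz w) = e / 2 * sz w.
  by rewrite -e1E; ring.
by move: QN; rewrite /Q; lra.
Qed.

End Concatenation.

(** * The set of limits of averages over long blocks *)

Definition block_dims : set R := [set t | forall e, 0 < e -> forall C, exists b,
  [/\ is_block b, C <= e * sz b & `|D alpha0 b - t * sz b| <= e * sz b]].

Lemma block_dims_closed t : (forall e, 0 < e -> exists2 t', block_dims t' & `|t - t'| <= e) ->
  block_dims t.
Proof.
move=> tP e e0 C; have e20 : 0 < e / 2 by rewrite divr_gt0.
have [t' At' tt'] := tP _ e20; have [b [bP Cb Db]] := At' _ e20 C.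
have b0 : 0 <= sz b by exact: ler0n.
exists b; split=> //; first by rewrite (le_trans Cb) // ler_wpM2r //; lra.
have -> : D alpha0 b - t * sz b = (D alpha0 b - t' * sz b) - (t - t') * sz b by ring.
apply: le_trans (ler_normB _ _) _; rewrite normrM (ger0_norm b0).
have := ler_wpM2r b0 tt'; lra.
Qed.

Lemma block_dims_bounded : exists M, forall t, block_dims t -> `|t| <= M.
Proof.
have [c c0 lip] := path_exponent_lipschitz H FT Hp.
exists (2 * c + 1) => t /(_ 1 ltr01 0)[b [bP _ Db]].
have b1 : 1 <= sz b by rewrite ler1n size_block.
have [ch _ _ _] := bP.
have [h _ _] := lip alpha0 b [::] O0 (ltac:(by rewrite cats0)).
rewrite -natr1 in h.
have cb : c * (sz b + 1) <= 2 * c * sz b by rewrite mulrDr mulr1; have := ler_wpM2l c0 b1; lra.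
have b0 : 0 < sz b by rewrite (lt_le_trans _ b1).
rewrite -(ler_pM2r b0) -{1}(gtr0_norm b0) -normrM.
have -> : t * sz b = D alpha0 b - (D alpha0 b - t * sz b) by ring.
by apply: le_trans (ler_normB _ _) _; lra.
Qed.

(** A block is appended because the preperiod of a periodic point has the form
    [gamma_0, ..., gamma_q] and so at least one letter. *)
Lemma nonempty_prefix b : is_block b -> exists pre q,
  [/\ chain root pre, last root pre = alpha0 & size pre = q.+1].
Proof.
move=> bP; have [s chs ls] := Omega_chain H O0; have [ch la _ _] := bP.
have := size_block bP; exists (s ++ b), (size s + size b).-1; split.
- by rewrite chain_cat chs ls.
- by rewrite last_cat ls.
- by rewrite size_cat prednK // addn_gt0; apply/orP; right.
Qed.

(** Comparing both with [a (k * l)] shows that the intervals from [(a k - C) / k] to [(a k + C) / k]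
    meet pairwise. The supremum of their left ends belongs to all of them. *)
Lemma almost_linear (a : nat -> R) (C : R) :
  (forall k l, (0 < k)%N -> (0 < l)%N -> `|a (k * l)%N - k%:R * a l| <= C * k%:R) ->
  exists r, forall k, (0 < k)%N -> `|a k - r * k%:R| <= C.
Proof.
move=> aP.
have cross k l : (0 < k)%N -> (0 < l)%N -> (a k - C) / k%:R <= (a l + C) / l%:R.
  move=> k0 l0; rewrite ler_pdivrMr ?ltr0n // mulrAC ler_pdivlMr ?ltr0n //.
  have := aP k l k0 l0; have := aP l k l0 k0; rewrite mulnC !ler_norml.
  by move=> /andP[h1 _] /andP[_ h2]; rewrite !mulrBl !mulrDl; lra.
pose A := [set (a k - C) / k%:R | k in [set k | (0 < k)%N]].
have A0 : A !=set0 by exists ((a 1%N - C) / 1%:R), 1%N.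
have Aub l : (0 < l)%N -> ubound A ((a l + C) / l%:R).
  by move=> l0 _ [k k0 <-]; exact: cross.
have As : has_sup A by split=> //; exists ((a 1%N + C) / 1%:R); exact: Aub.
exists (sup A) => k k0.
have h1 : (a k - C) / k%:R <= sup A by apply: ub_le_sup; [case: As|exists k].
have h2 : sup A <= (a k + C) / k%:R by apply: ge_sup => //; exact: Aub.
rewrite ler_pdivrMr ?ltr0n // in h1; rewrite ler_pdivlMr ?ltr0n // in h2.
by rewrite ler_norml; apply/andP; split; lra.
Qed.

Lemma cat_blocks_const b k : cat_blocks (fun=> b) k = flatten (nseq k b).
Proof.
elim: k => // k IH; rewrite cat_blocksS IH -[b in RHS]cats0.
elim: k {IH} => [|k IH] /=; first by rewrite !cats0.
by move: IH; rewrite /= !cats0 -catA => ->.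
Qed.

Lemma size_flatten_nseq (T : Type) (s : seq T) k : size (flatten (nseq k s)) = (k * size s)%N.
Proof. by elim: k => // k IH; rewrite /= size_cat IH mulSn. Qed.

Lemma nth_flatten_nseq (T : Type) (x0 : T) (s s' : seq T) k n : (n < k * size s)%N ->
  nth x0 (flatten (nseq k s) ++ s') n = nth x0 s (n %% size s).
Proof.
elim: k n => [|k IH] n; first by rewrite mul0n.
rewrite mulSn => nk /=; rewrite -catA nth_cat.
have [ns|sn] := ltnP n (size s); first by rewrite modn_small.
rewrite IH; last by rewrite ltn_subLR.
by rewrite -{2}(subnK sn) modnDr.
Qed.

Lemma cons_flatten_nseq (T : eqType) (x : T) s k : last x s = x ->
  x :: flatten (nseq k s) = flatten (nseq k (belast x s)) ++ [:: x].
Proof.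
move=> ls; elim: k => //= k IH.
by rewrite -cat_cons lastI ls cat_rcons IH catA.
Qed.

Lemma sum_nseq (T : Type) (f : T -> R) k x : \sum_(b <- nseq k x) f b = k%:R * f x.
Proof.
elim: k => [|k IH]; first by rewrite big_nil mul0r.
by rewrite /= big_cons IH -natr1 mulrDl mul1r addrC.
Qed.

(** The exponent of [s] repeated k times is almost linear in k, so the point of period [s] has a
    local dimension [t]; the case k = 1 compares it with the average of [s]. The constant does not
    depend on [s]. *)
Lemma block_periodic : exists2 C, 0 <= C &
  forall s, is_block s -> exists x t, [/\ periodic_in rho d W x, has_local_dim mu x t &
    `|D alpha0 s - t * sz s| <= C].
Proof.
have [C C0 [_ CP]] := block_almost_additive.
exists C => // s sP; have [pre [q [prech prel preq]]] := nonempty_prefix sP.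
have s1 : 0 < sz s by rewrite ltr0n size_block.
pose a k := D alpha0 (flatten (nseq k s)).
have powP k : (0 < k)%N -> is_block (flatten (nseq k s)).
  move=> k0; have [|_ _ _] := @flatten_blocks (nseq k s).
    by move=> b'; rewrite mem_nseq => /andP[_ /eqP->].
  by apply; case: k k0.
(* The power [k * l] of [s] is read as k copies of the block formed by l copies of [s]. *)
have [k l k0 l0|r rP] := @almost_linear a C.
  have := CP (nseq k (flatten (nseq l s))); rewrite size_nseq sum_nseq.
  have -> : flatten (nseq k (flatten (nseq l s))) = flatten (nseq (k * l) s).
    by elim: (k) => // i IH; rewrite /= IH mulSn nseqD flatten_cat.
  apply; first by case: (k) k0.
  by move=> b'; rewrite mem_nseq => /andP[_ /eqP->]; exact: powP.
have [x sr] := blocks_point prech prel (fun _ : nat => sP).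
exists x, (r / sz s); split.
- exists alpha0, s; have [ch la sW _] := sP; split; last first.
    by apply/(W_path_in _ W_alpha0).
  split; first by split=> //; have := size_block sP; case: (s).
  exists (letters pre (fun=> s)) => //; exists q => k.
  have kk : (k <= size (cat_blocks (fun=> s) k))%N by exact: size_cat_blocks.
  rewrite -preq (letters_shift prel (fun _ : nat => sP) kk) cat_blocks_const.
  have ks : (k < k.+1 * size (belast alpha0 s))%N.
    by rewrite size_belast (leq_trans (leqnn k.+1)) // leq_pmulr // size_block.
  have e : nth alpha0 (alpha0 :: flatten (nseq k s)) k =
      nth alpha0 (alpha0 :: flatten (nseq k.+1 s)) k.
    have -> : nseq k.+1 s = nseq k s ++ [:: s] by rewrite -[k.+1]addn1 nseqD.
    rewrite flatten_cat -cat_cons nth_cat /=.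
    by rewrite ltnS -cat_blocks_const kk.
  by rewrite e (cons_flatten_nseq _ la) nth_flatten_nseq // size_belast.
- apply: (blocks_local_dim prech prel (fun _ : nat => sP) _ sr) => e e0.
  have [K KP] := @archi_lin R C (e * sz s) (ltac:(by rewrite mulr_gt0)).
  have [K' K'P] := @archi_lin R 1 e e0.
  exists (K + K').+1 => k Kk; have k0 : (0 < k)%N by rewrite (leq_trans _ Kk).
  have Kk1 : (K <= k)%N by rewrite (leq_trans _ Kk) // ltnW // ltnS leq_addr.
  have Kk2 : (K' <= k)%N by rewrite (leq_trans _ Kk) // ltnW // ltnS leq_addl.
  rewrite cat_blocks_const size_flatten_nseq natrM; split.
    have -> : r / sz s * (k%:R * sz s) = r * k%:R by field; rewrite gt_eqF.
    apply: le_trans (rP k k0) _; apply: le_trans (KP k Kk1) _.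
    by rewrite mulrAC mulrA.
  by rewrite mulrA ler_peMl ?(ltW s1) // K'P.
- have := rP 1%N isT; rewrite /a /= cats0 mulr1 divfK ?gt_eqF //.
Qed.

Lemma exists_block : exists b, is_block b.
Proof.
have [_ etaW] := eta_path; have We : W (last alpha0 eta) by apply: etaW; exact: mem_last.
have [s [_ sp ls]] := W_loop We W_alpha0.
have [chs sW] := (W_path_in _ We).1 sp; have [che eW] := (W_path_in _ W_alpha0).1 eta_path.
exists (eta ++ s); split; last by exists s.
- by rewrite chain_cat che chs.
- by rewrite last_cat.
- by move=> g; rewrite mem_cat => /orP[/eW|/sW].
Qed.

Lemma prefix_of_add (T : Type) (gamma : nat -> T) n k :
  prefix_of gamma (n + k) = prefix_of gamma n ++ prefix_of (fun i => gamma (n + i)%N) k.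
Proof.
elim: k => [|k IH]; first by rewrite addn0 cats0.
by rewrite addnS !prefix_ofS IH rcons_cat addnS.
Qed.

(** The segment from [gamma N] to [gamma n] is closed up by a fixed path [pre] from [alpha0], which
    begins with a block and so with [eta], and by a return path of length at most [L0]. The total
    error [Q] does not depend on n. *)
Lemma point_in_block_dims x t : point_in rho d W x -> has_local_dim mu x t -> block_dims t.
Proof.
case=> gamma [sr [N NW]]; move/(has_local_dimE H FT Hp mu_self_similar mu_support t sr) => avg.
have [ch g0] := symbolic_rep_child sr.
have [b [chb lb bW [v bE]]] := exists_block.
have WN : W (gamma N) by exact: NW.
have [s1 [_ s1p ls1]] := W_loop W_alpha0 WN.
have [ch1 s1W] := (W_path_in _ W_alpha0).1 s1p.
have [L0 L0P] := bounded_return.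
have [c c0 lip] := path_exponent_lipschitz H FT Hp.
move=> e e0 C; have e20 : 0 < e / 2 by rewrite divr_gt0.
pose pre := b ++ s1.
pose Q := c * N.+1%:R + c * (size pre).+1%:R + c * L0.+1%:R + `|t| * (sz pre + L0%:R + N%:R).
have [K1 K1P] := avg _ e20.
have [K2 K2P] := @archi_lin R (Q + `|C| + e * N%:R) (e / 2) e20.
pose n := (N + (K1 + K2))%N.
have K1n : (K1 <= n)%N by rewrite /n addnC -addnA leq_addr.
have K2n : (K2 <= n)%N by rewrite /n addnA leq_addl.
pose seg := prefix_of (fun i => gamma (N + i)%N) (K1 + K2).
have lseg : last (gamma N) seg = gamma n.
  by rewrite -[gamma N](congr1 gamma (addn0 N)) (last_prefix_of (fun i => gamma (N + i)%N)).
have Wn : W (gamma n) by apply: NW; exact: leq_addr.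
have [s2 [ch2 s2W ls2 s2L]] := L0P _ Wn.
have chseg : chain (gamma N) seg.
  have := @prefix_chain _ _ rho d (fun k => gamma (N + k)%N) (K1 + K2).
  by rewrite addn0; apply => k; rewrite addnS.
have lpre : last alpha0 pre = gamma N by rewrite last_cat lb.
have chpre : chain alpha0 pre by rewrite chain_cat chb lb.
have Og : Omega (gamma N) by exact: W_Omega.
have szseg : size seg = (K1 + K2)%N by rewrite size_mkseq.
have nE : n%:R = N%:R + sz seg :> R by rewrite szseg /n natrD.
have h1 : `|D (gamma 0%N) (prefix_of gamma n) - D (gamma N) seg| <= c * N.+1%:R.
  have Or : Omega (gamma 0%N) by rewrite g0; exact: root_Omega.
  have chn : chain (gamma 0%N) (prefix_of gamma N ++ seg).
    by rewrite -prefix_of_add; exact: prefix_chain.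
  have [_ _] := lip _ _ _ Or chn.
  by rewrite -prefix_of_add last_prefix_of size_mkseq.
have h2 : `|D (gamma N) (seg ++ s2) - D (gamma N) seg| <= c * L0.+1%:R.
  have [|_ h _] := lip (gamma N) seg s2 Og; first by rewrite chain_cat chseg lseg.
  by apply: le_trans h _; rewrite ler_wpM2l // ler_nat.
have chall : chain alpha0 (pre ++ seg ++ s2).
  by rewrite chain_cat chpre lpre chain_cat chseg lseg.
have h3 : `|D alpha0 (pre ++ seg ++ s2) - D (gamma N) (seg ++ s2)| <= c * (size pre).+1%:R.
  by have [_ _] := lip alpha0 pre (seg ++ s2) O0 chall; rewrite lpre.
have s2L' : sz s2 <= L0%:R by rewrite ler_nat.
have szall : sz (pre ++ seg ++ s2) = sz pre + sz seg + sz s2.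
  by rewrite !size_cat !natrD addrA.
have z1 : 0 <= sz pre by exact: ler0n.
have z2 : 0 <= sz s2 by exact: ler0n.
have z3 : 0 <= N%:R :> R by exact: ler0n.
have Kn := K2P n K2n; rewrite nE in Kn.
have eseg : e * (N%:R + sz seg) <= e * N%:R + e * sz (pre ++ seg ++ s2).
  by rewrite mulrDr lerD2l ler_pM2l // szall; lra.
have Q0 : 0 <= Q.
  by rewrite /Q !addr_ge0 // ?mulr_ge0 // !addr_ge0 // ler0n.
exists (pre ++ seg ++ s2); split=> //.
- rewrite /pre -catA; apply: block_cat => //; first by split=> //; exists v.
  + by move: chall; rewrite /pre -catA chain_cat lb => /andP[].
  + by rewrite last_cat ls1 last_cat lseg.
  move=> g; rewrite !mem_cat => /or3P[/s1W//||/s2W//].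
  by case/mapP=> i _ ->; apply: NW; exact: leq_addr.
- by move: Kn eseg Q0 (ler_norm C) (normr_ge0 C) (mulr_ge0 (ltW e20) z3); clear lb bE ls1 lseg ls2 lpre g0; lra.
have hn := K1P n K1n.
set X := D alpha0 _ in h3 *; set Y := D (gamma N) (seg ++ s2) in h2 h3.
set Z := D (gamma N) seg in h1 h2; set V := D (gamma 0%N) _ in h1 hn.
have -> : X - t * sz (pre ++ seg ++ s2) =
  (X - Y) + (Y - Z) - (V - Z) + (V - t * n%:R) - t * (sz pre + sz s2 - N%:R).
  by rewrite szall nE; ring.
apply: le_trans (ler_normB _ _) _.
apply: le_trans (lerD (ler_normD _ _) (lexx _)) _.
apply: le_trans (lerD (lerD (ler_normB _ _) (lexx _)) (lexx _)) _.
apply: le_trans (lerD (lerD (lerD (ler_normD _ _) (lexx _)) (lexx _)) (lexx _)) _.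
apply: le_trans (lerD (lerD (lerD (lerD h3 h2) h1) hn) (lexx _)) _.
have h4 : `|t * (sz pre + sz s2 - N%:R)| <= `|t| * (sz pre + L0%:R + N%:R).
  rewrite normrM ler_wpM2l // ler_norml; apply/andP; split; lra.
have nC := normr_ge0 C.
by move: h4 nC eseg Kn; rewrite /Q nE; clear lb bE ls1 lseg ls2 lpre g0; lra.
Qed.

(** A mixture in which a proportion close to [theta] of the letters comes from [b1], where
    [t = theta * t1 + (1 - theta) * t2]. Junctions, deviations of [b1] and of [b2], and rounding of
    [theta] cost [e / 4] each. *)
Lemma block_dims_convex t1 t2 t : block_dims t1 -> block_dims t2 -> t1 <= t <= t2 ->
  block_dims t.
Proof.
move=> A1 A2 /andP[le1 le2].
have [eq12|lt12] := eqVneq t1 t2.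
  by have -> : t = t1 by apply/eqP; rewrite eq_le le1 eq12 le2.
have d12 : 0 < t2 - t1 by rewrite subr_gt0 lt_neqAle lt12 (le_trans le1).
have [C C0 [_ CP]] := block_almost_additive.
move=> e e0 C'; have e40 : 0 < e / 4 by rewrite divr_gt0.
have [b1 [b1P Cb1 Db1]] := A1 _ e40 (C + `|C'|).
have [b2 [b2P Cb2 Db2]] := A2 _ e40 (C + `|C'|).
have [N NP] := @archi_lin R (t2 - t1) (e / 4) e40.
pose n := N.+1; pose theta := (t2 - t) / (t2 - t1).
have th0 : 0 <= theta by rewrite divr_ge0 ?(ltW d12) // subr_ge0.
have th1 : theta <= 1 by rewrite ler_pdivrMr // mul1r; lra.
have thE : theta * (t2 - t1) = t2 - t by rewrite divfK // gt_eqF.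
pose q := Num.truncn (theta * n%:R).
have /andP[q1 q2] : q%:R <= theta * n%:R < q.+1%:R.
  by apply: truncn_itv; rewrite mulr_ge0.
have qn : (q <= n)%N.
  by rewrite -(ler_nat R) (le_trans q1) // -[leRHS]mul1r ler_wpM2r.
(* Cross-multiplying by the sizes makes the letters from [b1] and from [b2] stand in the exact ratio
   [q] to [n - q]. *)
pose i := (size b2 * q)%N; pose j := (size b1 * (n - q))%N.
pose bs := nseq i b1 ++ nseq j b2.
have s1 := size_block b1P; have s2 := size_block b2P.
have ij : (0 < i + j)%N.
  rewrite addn_gt0 !muln_gt0 s1 s2 /= subn_gt0.
  by case: (ltnP 0 q) => //; rewrite leqn0 => /eqP ->.
have bs0 : bs != [::] by rewrite -size_eq0 size_cat !size_nseq -lt0n.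
have bsP b : b \in bs -> is_block b.
  by rewrite mem_cat !mem_nseq => /orP[]/andP[_ /eqP->].
have [_ _ _ /(_ bs0) wP] := flatten_blocks bsP.
have := CP bs bs0 bsP.
rewrite /bs big_cat !sum_nseq size_cat !size_nseq.
set w := flatten _ in wP * => hw.
have szw : sz w = sz b1 * sz b2 * n%:R.
  rewrite /w flatten_cat size_cat !size_flatten_nseq /i /j natrD !natrM natrB //.
  by ring.
have sb1 : 1 <= sz b1 by rewrite ler1n.
have sb2 : 1 <= sz b2 by rewrite ler1n.
have n1 : 1 <= n%:R :> R by rewrite ler1n.
have s10 : 0 <= sz b1 by exact: ler0n.
have s20 : 0 <= sz b2 by exact: ler0n.
have n0 : 0 <= n%:R :> R by exact: ler0n.
have iE : i%:R = sz b2 * q%:R :> R by rewrite /i natrM.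
have jE : j%:R = sz b1 * (n%:R - q%:R) :> R by rewrite /j natrM natrB.
have i0 : 0 <= i%:R :> R by exact: ler0n.
have j0 : 0 <= j%:R :> R by exact: ler0n.
have ijw : i%:R * sz b1 + j%:R * sz b2 = sz w by rewrite szw iE jE; ring.
have w0 : 0 <= sz w by exact: ler0n.
have CC : C <= e / 4 * sz b1 /\ C <= e / 4 * sz b2.
  by have := normr_ge0 C'; split; lra.
exists w; split=> //.
- have : sz b1 * 1 <= sz b1 * (sz b2 * n%:R) by rewrite ler_wpM2l // mulr_ege1.
  rewrite mulr1 mulrA -szw => b1w.
  have := ler_norm C'; have : e / 4 * sz b1 <= e / 4 * sz w by rewrite ler_pM2l.
  have : 0 <= e * sz w by rewrite mulr_ge0 // ltW.
  by lra.
have hC : C * (i + j)%:R <= e / 4 * sz w.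
  rewrite natrD mulrDr -ijw mulrDr lerD //.
    by rewrite mulrC mulrCA ler_wpM2l //; case: CC.
  by rewrite mulrC mulrCA ler_wpM2l //; case: CC.
have hb1 : `|i%:R * (D alpha0 b1 - t1 * sz b1)| <= e / 4 * (i%:R * sz b1).
  by rewrite normrM ger0_norm // mulrCA ler_wpM2l.
have hb2 : `|j%:R * (D alpha0 b2 - t2 * sz b2)| <= e / 4 * (j%:R * sz b2).
  by rewrite normrM ger0_norm // mulrCA ler_wpM2l.
have hq : `|sz b1 * sz b2 * ((q%:R - theta * n%:R) * (t1 - t2))| <= e / 4 * sz w.
  rewrite szw [leRHS]mulrCA normrM ger0_norm ?mulr_ge0 // ler_wpM2l ?mulr_ge0 // normrM.
  rewrite -[leRHS]mul1r; apply: ler_pM => //.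
    by rewrite -natr1 in q2; rewrite ler_norml; apply/andP; split; lra.
  by rewrite distrC gtr0_norm // NP.
have -> : D alpha0 w - t * sz w =
   (D alpha0 w - (i%:R * D alpha0 b1 + j%:R * D alpha0 b2)) +
   i%:R * (D alpha0 b1 - t1 * sz b1) + j%:R * (D alpha0 b2 - t2 * sz b2) +
   sz b1 * sz b2 * ((q%:R - theta * n%:R) * (t1 - t2)).
  have tE : t = t2 - theta * (t2 - t1) by rewrite thE; ring.
  by rewrite iE jE szw {1}tE; ring.
apply: le_trans (ler_normD _ _) _.
apply: le_trans (lerD (ler_normD _ _) (lexx _)) _.
apply: le_trans (lerD (lerD (ler_normD _ _) (lexx _)) (lexx _)) _.
apply: le_trans (lerD (lerD (lerD hw hb1) hb2) hq) _.
have eij : e / 4 * (i%:R * sz b1) + e / 4 * (j%:R * sz b2) = e / 4 * sz w.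
  by rewrite -mulrDr ijw.
have ew : 0 <= e / 4 * sz w by rewrite mulr_ge0 // ltW.
by lra.
Qed.

(* Longer and longer blocks of average close to [t] are concatenated, each one
   short with respect to the word already built. *)
Lemma block_dims_point t : block_dims t ->
  exists2 x, point_in rho d W x & has_local_dim mu x t.
Proof.
move=> At; have [C C0 [CP _]] := block_almost_additive.
have [v vP] : exists v : nat -> seq (@charvec R), forall j, [/\ is_block (v j),
    C <= j.+1%:R^-1 * sz (v j) &
    `|D alpha0 (v j) - t * sz (v j)| <= j.+1%:R^-1 * sz (v j)].
  have /choice[v vP] : forall j, exists b, [/\ is_block b,
      C <= j.+1%:R^-1 * sz b & `|D alpha0 b - t * sz b| <= j.+1%:R^-1 * sz b].
    by move=> j; apply: At; rewrite invr_gt0 ltr0n.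
  by exists v.
(* With [L] letters already built, take the best block [v j] whose length is at most [L / (j + 1)].
   Since [L] grows without bound, so does [j]. *)
pose sel (L : nat) : nat := \max_(j < L.+1 | (j.+1 * size (v j) <= L)%N) j.
have sel_ge j0 L : (j0 <= L)%N -> (j0.+1 * size (v j0) <= L)%N -> (j0 <= sel L)%N.
  move=> jL jv; have jL' : (j0 < L.+1)%N by [].
  exact: (leq_bigmax_cond (P := fun j : 'I_L.+1 => (j.+1 * size (v j) <= L)%N)
    (F := fun j : 'I_L.+1 => (j : nat)) (Ordinal jL')).
have sel_ok j0 L : (j0 <= L)%N -> (j0.+1 * size (v j0) <= L)%N ->
    ((sel L).+1 * size (v (sel L)) <= L)%N.
  move=> jL jv; have jL' : (j0 < L.+1)%N by [].
  have card0 : (0 < #|[pred j : 'I_L.+1 | (j.+1 * size (v j) <= L)%N]|)%N.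
    by apply/card_gt0P; exists (Ordinal jL').
  have [j jP jE] := eq_bigmax_cond (fun j : 'I_L.+1 => (j : nat)) card0.
  by rewrite /sel jE.
pose Wd := fix Wd k : seq (@charvec R) :=
  if k is k'.+1 then Wd k' ++ v (sel (size (Wd k'))) else [::].
pose u k := v (sel (size (Wd k))).
have uP k : is_block (u k) by have [] := vP (sel (size (Wd k))).
have WdE k : cat_blocks u k = Wd k.
  by elim: k => // k IH; rewrite cat_blocksS IH.
have [pre [q [prech prel preq]]] := nonempty_prefix (uP 0%N).
have [x sr] := blocks_point prech prel uP.
exists x.
  exists (letters pre u); split=> //; exists (size pre).+1 => j; exact: letters_W.
apply: (blocks_local_dim prech prel uP _ sr) => e e0.
pose w k := cat_blocks u k; pose E k := `|D alpha0 (w k) - t * sz (w k)|.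
have wk k : (k <= size (w k))%N by exact: size_cat_blocks.
pose j k := sel (size (w k)).
have uE k : u k = v (j k) by rewrite /u /j /w WdE.
have large j0 : exists K, forall k, (K <= k)%N ->
    (j0 <= j k)%N /\ ((j k).+1 * size (u k) <= size (w k))%N.
  exists (j0 + j0.+1 * size (v j0))%N => k Kk.
  have h1 : (j0 <= size (w k))%N.
    by rewrite (leq_trans _ (wk k)) // (leq_trans _ Kk) // leq_addr.
  have h2 : (j0.+1 * size (v j0) <= size (w k))%N.
    by rewrite (leq_trans _ (wk k)) // (leq_trans _ Kk) // leq_addl.
  by rewrite uE; split; [exact: sel_ge|exact: (sel_ok j0)].
(* Two equal shares: the junction constant [C], small against the length of the block by the choice
   of [v], and the deviation of the block from [t]. *)
have step k : E k.+1 <= E k + 2 * ((j k).+1%:R^-1 * sz (u k)).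
  have [ch la _] := cat_blocks_loop uP k.
  have h := CP _ _ ch la (uP k).
  have [_ Ck Dk] := vP (j k); rewrite -uE in Ck Dk.
  rewrite /E /w cat_blocksS size_cat natrD.
  set X := D alpha0 (_ ++ _) in h *; set Y := D alpha0 (cat_blocks u k) in h *.
  have -> : X - t * (sz (cat_blocks u k) + sz (u k)) =
    (Y - t * sz (cat_blocks u k)) + (X - Y - D alpha0 (u k)) + (D alpha0 (u k) - t * sz (u k)).
    by ring.
  apply: le_trans (ler_normD _ _) _; apply: le_trans (lerD (ler_normD _ _) (lexx _)) _.
  rewrite -addrA lerD2l; apply: le_trans (lerD (le_trans h Ck) Dk) _.
  by rewrite mulr_natl mulr2n.
have [N NP] := @archi_lin R 4 e e0.
have [K KP] := large N.
have jN k : (K <= k)%N -> (j k).+1%:R^-1 <= e / 4.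
  move=> /KP[Nj _]; have := NP (j k).+1 (leqW Nj).
  rewrite -[(j k).+1%:R^-1]mul1r ler_pdivrMr ?ltr0n //; lra.
have stepK i : E (K + i)%N <= E K + e / 2 * (sz (w (K + i)%N) - sz (w K)).
  elim: i => [|i IH]; first by rewrite addn0 subrr mulr0 addr0.
  rewrite addnS; apply: le_trans (step _) _; have := jN _ (leq_addr i K).
  have -> : sz (w (K + i).+1) = sz (w (K + i)) + sz (u (K + i)).
    by rewrite /w cat_blocksS size_cat natrD.
  move=> h; have := ler_wpM2r (ler0n R (size (u (K + i)))) h.
  move: (_^-1 * _) (E (K + i)%N) IH => X Y; lra.
have [K2 K2P] := @archi_lin R (E K) (e / 2) (ltac:(by rewrite divr_gt0)).
exists (K + K2)%N => k Kk.
have KK : (K <= k)%N by rewrite (leq_trans _ Kk) // leq_addr.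
have KK2 : (K2 <= size (w k))%N.
  by rewrite (leq_trans _ (wk k)) // (leq_trans _ Kk) // leq_addl.
split.
  have := stepK (k - K)%N; rewrite subnKC // -/(w k) -/(E k) => h.
  have := K2P _ KK2; have : 0 <= e / 2 * sz (w K) by rewrite mulr_ge0 // divr_ge0 // ltW.
  by move: h; lra.
have [_ jw] := KP k KK.
have jw' : (j k).+1%:R * sz (u k) <= sz (w k) by rewrite -natrM ler_nat.
rewrite -ler_pdivlMl ?ltr0n // in jw'; apply: le_trans jw' _.
rewrite ler_wpM2r // (le_trans (jN k KK)) //; lra.
Qed.

Lemma block_dims_interval : exists a b, a <= b /\ block_dims = `[a, b]%classic.
Proof.
have [M MP] := block_dims_bounded.
have [b0 b0P] := exists_block.
have [C C0 perP] := block_periodic.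
have A0 : block_dims !=set0.
  have [x [t [[alpha [s [[cyc [gamma sr [q gE]]] sp]]] dimx _]]] := perP _ b0P.
  exists t; apply: (point_in_block_dims _ dimx).
  exists gamma; split=> //; exists q.+1 => j qj.
  rewrite -(subnKC qj) gE; case: cyc => s0 _ _; have [_ sW] := sp.
  apply: sW; apply: mem_belast; apply: mem_nth; rewrite size_belast ltn_mod.
  by case: (s) s0.
have Aub : has_sup block_dims.
  by split=> //; exists M => t /MP; exact: le_trans (ler_norm t).
have Alb : has_inf block_dims.
  by split=> //; exists (- M) => t /MP; rewrite ler_norml => /andP[].
have As : block_dims (sup block_dims).
  apply: block_dims_closed => e e0; have [t At lt_t] := sup_adherent e0 Aub.
  exists t => //; have := ub_le_sup (proj2 Aub) At => le_t.
  by rewrite ger0_norm ?subr_ge0 //; lra.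
have Ai : block_dims (inf block_dims).
  apply: block_dims_closed => e e0; have [t At lt_t] := inf_adherent e0 Alb.
  exists t => //; have := ge_inf (proj2 Alb) At => le_t.
  by rewrite distrC ger0_norm ?subr_ge0 //; lra.
exists (inf block_dims), (sup block_dims); split.
  by have [t At] := A0; apply: le_trans (ge_inf (proj2 Alb) At) (ub_le_sup (proj2 Aub) At).
apply/seteqP; split=> t /=; rewrite in_itv /=.
  by move=> At; rewrite (ge_inf (proj2 Alb) At) (ub_le_sup (proj2 Aub) At).
exact: block_dims_convex.
Qed.

Lemma periodic_in_point_in x : periodic_in rho d W x -> point_in rho d W x.
Proof.
case=> alpha [s [[[s0 _ _] [gamma sr [q gE]]] [_ sW]]].
exists gamma; split=> //; exists q.+1 => j qj.
rewrite -(subnKC qj) gE; apply: sW; apply: mem_belast; apply: mem_nth.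
by rewrite size_belast ltn_mod; case: (s) s0.
Qed.

Lemma local_dims_loop_class : local_dims mu [set x | point_in rho d W x] = block_dims.
Proof.
apply/seteqP; split=> t.
  by case=> x xW; exact: point_in_block_dims.
by move=> /block_dims_point[x xW dimx]; exists x.
Qed.

(** Density comes from a block of average close to [t] and so long that [C] is negligible against
    it: the periodic point it generates has local dimension within [e] of [t]. *)
Lemma closure_periodic_dims :
  closure (local_dims mu [set x | periodic_in rho d W x]) = block_dims.
Proof.
have [C C0 perP] := block_periodic.
apply/seteqP; split=> t.
  move=> clt; apply: block_dims_closed => e e0.
  have [t' [[x xper dimx] tt']] := clt _ (nbhsx_ballx t e e0).
  exists t'; last by apply: ltW; move: tt'; rewrite /ball /=.
  by apply: (point_in_block_dims _ dimx); exact: periodic_in_point_in.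
move=> At B /nbhs_ballP[e /= e0 eB]; have e40 : 0 < e / 4 by rewrite divr_gt0.
have [b [bP Cb Db]] := At _ e40 C.
have [x [t' [xper dimx h]]] := perP b bP.
exists t'; split; first by exists x.
apply: eB; rewrite /ball /=.
have b0 : 0 < sz b by rewrite ltr0n size_block.
rewrite -(ltr_pM2r b0) -{1}(gtr0_norm b0) -normrM.
have -> : (t - t') * sz b = (D alpha0 b - t' * sz b) - (D alpha0 b - t * sz b) by ring.
apply: le_lt_trans (ler_normB _ _) _.
have : 0 < e * sz b by rewrite mulr_gt0.
by lra.
Qed.

End Loops.

Theorem mainTheorem4 (R : realType) (m : nat) (rho : R)
    (d p : 'I_m.+1 -> R) (mu : probability (measurableTypeR R) R)
    (m_ge1 : (1 <= m)%N)
    (rho_gt0 : 0 < rho) (rho_lt1 : rho < 1)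
    (d_incr : forall i j : 'I_m.+1, (i < j)%N -> d i < d j)
    (p_gt0 : forall j, 0 < p j)
    (p_sum : \sum_(j < m.+1) p j = 1)
    (mu_self_similar : self_similar rho d p mu)
    (mu_finite_type : finite_type rho d)
    (p_ends : p ord0 = p ord_max)
    (p_min : forall j, p ord0 <= p j)
    (mu_support : msupport mu = `[0, 1]%classic)
    (W : set (@charvec R))
    (W_loop : loop_class rho d W)
    (W_positive : positive_type rho d p W) :
  exists a b : R,
    [/\ a <= b,
        local_dims mu [set x | point_in rho d W x] = `[a, b]%classic
      & `[a, b]%classic = closure (local_dims mu [set x | periodic_in rho d W x])].
Proof.
have Hp : minimal_end_weights p by split.
have H : tiling_ifs rho d by exact: (tiling_of_support rho_gt0 Hp mu_self_similar).
have [_ W_Omega W_conn] := W_loop.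
have [alpha [eta [eta0 etaW /positive_pathP eta_pos]]] := W_positive.
have Wa : W alpha by case: etaW => _; apply; rewrite inE eqxx.
have [a [b [ab E]]] :=
  block_dims_interval H mu_finite_type Hp mu_self_similar mu_support W_Omega W_conn Wa eta0 etaW eta_pos.
exists a, b; split=> //; rewrite -E.
  exact: (local_dims_loop_class H mu_finite_type Hp mu_self_similar mu_support W_Omega W_conn Wa eta0 etaW eta_pos).
symmetry.
exact: (closure_periodic_dims H mu_finite_type Hp mu_self_similar mu_support W_Omega W_conn Wa eta0 etaW eta_pos).
Qed.
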